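(* Let $k$ be a field of characteristic zero, let $R$ be a regular local augmented $k$-algebra of Krull dimension $n$ with maximal ideal $\mathfrak{m}$, let $x_1,\dots,x_n$ be a regular sequence generating $\mathfrak{m}$, and let $w\in\mathfrak{m}$ have an isolated singularity at $\mathfrak{m}$. Let $X,Y$ be objects of the category of matrix factorizations $\mathrm{MF}(R,w)$, and let $Q$ be the twisted differential of $Y$. Then the pairing $$\mathrm{Hom}(X,Y)\otimes_R \mathrm{Hom}(Y,X[n])\to k,\qquad (F,G)\mapsto (-1)^{\binom{n+1}{2}}\frac{1}{n!}\,\mathrm{Res}\left[\begin{array}{c}\mathrm{tr}\big(FG\,(dQ)^{\wedge n}\big)\\ \partial_1 w,\ \partial_2 w,\ \dots,\ \partial_n w\end{array}\right]$$ is a homologically non-degenerate pairing on the morphism complexes of $\mathrm{MF}(R,w)$; that is, the induced map $\mathrm{Hom}(X,Y)\to \mathrm{Hom}_k(\mathrm{Hom}(Y,X[n]),k)$ is a quasi-isomorphism.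
   Context: Augmented means that the residue field is $k$. $R$ is viewed inside $k[[x_1,\dots,x_n]]$; differentials are universally finite differentials, the module of top forms $\Omega^n$ is free of rank one on $d\underline{x}=dx_1\wedge\dots\wedge dx_n$, and $\partial_i=\partial/\partial x_i$. Since the singularity of $\mathrm{Spec}(R/w)$ is isolated and $\operatorname{char} k=0$, the sequence $\partial_1w,\dots,\partial_nw$ is a system of parameters of $R$. Matrix factorizations: an object of $\mathrm{MF}(R,w)$ is a $\mathbb{Z}/2$-graded finite free $R$-module $X=X^0\oplus X^1$ with an odd $R$-linear endomorphism $d$ (the twisted differential) satisfying $d^2=w\cdot\mathrm{id}$. After choosing bases the twisted differential is given by an odd supermatrix $Q=\begin{pmatrix}0&\varphi\\ \psi&0\end{pmatrix}$ with $Q^2=w\,\mathrm{id}$. $\mathrm{Hom}(X,Y)$ is the $\mathbb{Z}/2$-graded complex of all $R$-linear maps $X\to Y$ with differential $F\mapsto d_Y F-(-1)^{|F|}F d_X$. $[n]$ is the $n$-fold shift of the $\mathbb{Z}/2$-grading. Notation: $\partial_iQ$ is the entrywise derivative of $Q$ and $$(dQ)^{\wedge n}=\sum_{\sigma\in S_n}\mathrm{sign}(\sigma)\,\partial_{\sigma(1)}Q\cdots\partial_{\sigma(n)}Q .$$ $\mathrm{tr}$ is the graded trace (supertrace) $\mathrm{tr}\begin{pmatrix}A&B\\C&D\end{pmatrix}=\mathrm{trace}(A)-\mathrm{trace}(D)$; the composite $FG(dQ)^{\wedge n}$ is regarded as an $R$-linear endomorphism of the free module underlying $Y$. Grothendieck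 residue symbol: for $f\in R$ and a system of parameters $t_1,\dots,t_n$, $\mathrm{Res}\left[\begin{array}{c} f\\ t_1,\dots,t_n\end{array}\right]$ means $\mathrm{Res}\left[\begin{array}{c} f\,d\underline{x}\\ t_1,\dots,t_n\end{array}\right]\in k$, the image under the residue map $\mathrm{Res}:H^n_{\mathfrak m}(\Omega^n)\to k$ of the local cohomology class represented by the Čech cocycle $\frac{f\,d\underline{x}}{t_1\cdots t_n}$. It is computed as follows: choose $i$ with $\mathfrak{m}^i\subset(t_1,\dots,t_n)$, write $x_j^i=\sum_l C_{jl}t_l$ with $C_{jl}\in R$, set $r=\det(C)f$; the residue is the coefficient of $(x_1\cdots x_n)^{-1}$ in the Laurent expansion of $\frac{r}{x_1^i\cdots x_n^i}$, where $r$ is expanded as a power series in $k[[x_1,\dots,x_n]]$. *)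

(* Defs.v *)
From HB Require Import structures.
From mathcomp Require Import all_boot all_order all_fingroup all_algebra.
From mathcomp Require Import ring_quotient.
From mathcomp Require Import boolp classical_sets functions.

Set Implicit Arguments.
Unset Strict Implicit.
Unset Printing Implicit Defensive.

Import GRing.Theory.
Local Open Scope classical_set_scope.
Local Open Scope ring_scope.

Section Ideals.
Variable A : comNzRingType.

Definition gen_ideal (S : set A) : set A :=
  [set r | exists (N : nat) (a s : 'I_N -> A),
     (forall j, S (s j)) /\ r = \sum_j a j * s j].

Fixpoint ideal_pow (I : set A) (i : nat) : set A :=
  if i is j.+1 then gen_ideal [set a * b | a in I & b in ideal_pow I j]
  else setT.

(* The library predicate idealr_closed includes properness (1 is excluded). *)
Definition proper_idealP (I : set A) : Prop := idealr_closed (mem I).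

Definition prime_idealP (p : set A) : Prop :=
  proper_idealP p /\ prime_idealr_closed (mem p).

Definition noetherian : Prop :=
  forall I : set A, proper_idealP I ->
    exists (N : nat) (g : 'I_N -> A), I = gen_ideal (range g).

Definition local_ring (m : set A) : Prop :=
  proper_idealP m /\ forall I : set A, proper_idealP I -> I `<=` m.

Definition prime_chain (l : nat) (p : nat -> set A) : Prop :=
  (forall i, (i <= l)%N -> prime_idealP (p i)) /\
  (forall i, (i < l)%N -> p i `<` p i.+1).

Definition krull_dim (n : nat) : Prop :=
  (exists p, prime_chain n p) /\
  (forall l p, prime_chain l p -> (l <= n)%N).

Definition regular_local_ring (m : set A) (n : nat) : Prop :=
  [/\ noetherian, local_ring m, krull_dim n &
      exists x : 'I_n -> A, m = gen_ideal (range x)].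

Definition regular_sequence (n : nat) (x : 'I_n -> A) : Prop :=
  (forall (i : 'I_n) (a : A),
     gen_ideal [set x j | j in [set j : 'I_n | (j < i)%N]] (x i * a) ->
     gen_ideal [set x j | j in [set j : 'I_n | (j < i)%N]] a) /\
  ~ gen_ideal (range x) 1.

End Ideals.

(* Quotients and localizations are described up to isomorphism. *)
Definition is_quotient (A B : comNzRingType) (f : {rmorphism A -> B})
    (I : set A) : Prop :=
  (forall b, exists a, f a = b) /\ (forall a, f a = 0 <-> I a).

Definition is_localization (A B : comNzRingType) (f : {rmorphism A -> B})
    (p : set A) : Prop :=
  [/\ forall s, ~ p s -> exists b, f s * b = 1,
      forall b, exists a s, ~ p s /\ f s * b = f a &
      forall a, f a = 0 <-> exists s, ~ p s /\ s * a = 0].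

Definition regular_at (A : comNzRingType) (p : set A) : Prop :=
  exists (B : comNzRingType) (f : {rmorphism A -> B}) (M : set B) (d : nat),
    is_localization f p /\ regular_local_ring M d.

(* The singular locus of Spec (R/w) is exactly the closed point {m}. *)
Definition isolated_singularity (R : comNzRingType) (m : set R) (w : R)
    : Prop :=
  exists (A : comNzRingType) (pi : {rmorphism R -> A}),
    is_quotient pi (gen_ideal [set w]) /\
    forall q : set A, prime_idealP q -> (~ regular_at q <-> q = pi @` m).

Section Augmented.
Variables (k : fieldType) (R : comAlgType k).

(* k -> R -> R/m is bijective. *)
Definition augmented (m : set R) : Prop :=
  forall r : R, exists! c : k, m (r - c%:A).

Definition is_derivation (N : lmodType R) (D : R -> N) : Prop :=
  (forall (c : k) (a b : R), D (c *: a + b) = c%:A *: D a + D b) /\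
  (forall a b : R, D (a * b) = a *: D b + b *: D a).

Definition finitely_generated (N : lmodType R) : Prop :=
  exists (p : nat) (g : 'I_p -> N),
    forall v, exists a : 'I_p -> R, v = \sum_i a i *: g i.

(* d : R -> Omega is a universally finite differential of R over k. *)
Definition universally_finite (Omega : lmodType R) (d : R -> Omega) : Prop :=
  [/\ finitely_generated Omega, is_derivation d &
      forall (N : lmodType R) (D : R -> N),
        finitely_generated N -> is_derivation D ->
        exists! h : Omega -> N, linear h /\ forall a, h (d a) = D a].

(* del i a is the coefficient of d x_i in d a. *)
Definition partial_derivatives (Omega : lmodType R) (d : R -> Omega)
    (n : nat) (x : 'I_n -> R) (del : 'I_n -> R -> R) : Prop :=
  forall a : R, d a = \sum_i del i a *: d (x i).

(* s is the family of coefficients of the image of r in k[[x_1, ..., x_n]],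
   indexed by exponents: r agrees modulo m^N with the truncation of the series
   in total degree < N. *)
Definition power_series_of (m : set R) (n : nat) (x : 'I_n -> R) (r : R)
    (s : ('I_n -> nat) -> k) : Prop :=
  forall N : nat, ideal_pow m N
    (r - \sum_(b : {ffun 'I_n -> 'I_N} | (\sum_i b i < N)%N)
           s (fun i => b i) *: \prod_i x i ^+ b i).

(* The coefficient of (x_1 ... x_n)^-1 in r / (x_1^i ... x_n^i) is the
   coefficient of (x_1 ... x_n)^(i-1) in r. *)
Definition is_residue (m : set R) (n : nat) (x t : 'I_n -> R) (f : R) (c : k)
    : Prop :=
  exists (i : nat) (C : 'M[R]_n) (s : ('I_n -> nat) -> k),
    [/\ (0 < i)%N /\ ideal_pow m i `<=` gen_ideal (range t),
        forall j, x j ^+ i = \sum_l C j l * t l,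
        power_series_of m x (\det C * f) s &
        c = s (fun=> i.-1)].

(* The value does not depend on the choices in is_residue when t is a system
   of parameters; the default 0 is only used when no choice is possible. *)
Definition residue (m : set R) (n : nat) (x t : 'I_n -> R) (f : R) : k :=
  xget 0 [set c | is_residue m x t f c].

End Augmented.

(* The free module has a homogeneous basis indexed by 'I_(mf_rank), the i-th
   element having degree mf_par i; matrices act on column vectors. *)
Record matfact (R : comNzRingType) (w : R) := MatFact {
  mf_rank : nat;
  mf_par : 'I_mf_rank -> bool;
  mf_d : 'M[R]_mf_rank;
  mf_odd : forall i j, mf_par i = mf_par j -> mf_d i j = 0;
  mf_sq : mf_d *m mf_d = w%:M }.

Section Shift.
Variables (R : comNzRingType) (w : R) (n : nat) (X : matfact w).

Let par (i : 'I_(mf_rank X)) := mf_par i (+) odd n.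
Let d : 'M[R]_(mf_rank X) := (-1) ^+ n *: mf_d X.

Fact mf_shift_odd i j : par i = par j -> d i j = 0.
Proof. by move=> /addIb e; rewrite mxE mf_odd // mulr0. Qed.

Fact mf_shift_sq : d *m d = w%:M.
Proof.
by rewrite -scalemxAl -scalemxAr scalerA mf_sq -expr2 sqrr_sign scale1r.
Qed.

(* X[n]: the parity is shifted by n and the differential is (-1)^n d. *)
Definition mf_shift : matfact w := MatFact mf_shift_odd mf_shift_sq.
End Shift.

(* A Z/2-graded complex of k-vector spaces: the pieces of degree false and true
   are subspaces of z2_space, and z2_diff b is the differential on the piece of
   degree b. *)
Record z2_complex (k : fieldType) := Z2Complex {
  z2_space :> lmodType k;
  z2_piece : bool -> set z2_space;
  z2_diff : bool -> z2_space -> z2_space;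
  z2_submod : forall b, submod_closed (mem (z2_piece b));
  z2_linear : forall b, linear (z2_diff b);
  z2_diff_odd : forall b v, z2_piece b v -> z2_piece (~~ b) (z2_diff b v);
  z2_diff_sq : forall b v, z2_piece b v -> z2_diff (~~ b) (z2_diff b v) = 0 }.

(* A degree-preserving k-linear map commuting with the differentials up to a
   global sign and inducing bijections on the cohomology in both degrees.
   When the sign is -1, composing f with v |-> (-1)^|v| v gives a chain map,
   which has the same effect on cohomology up to signs. *)
Definition quasi_isomorphism (k : fieldType) (C D : z2_complex k)
    (f : C -> D) : Prop :=
  [/\ linear f,
      forall b v, z2_piece b v -> z2_piece b (f v),
      exists e : bool, forall b v, z2_piece b v ->
        f (z2_diff b v) = (-1) ^+ e *: z2_diff b (f v),
      forall b v, z2_piece b v -> z2_diff b v = 0 ->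
        (exists u, z2_piece (~~ b) u /\ f v = z2_diff (~~ b) u) ->
        exists u, z2_piece (~~ b) u /\ v = z2_diff (~~ b) u &
      forall b v', z2_piece b v' -> z2_diff b v' = 0 ->
        exists v u', [/\ z2_piece b v, z2_diff b v = 0,
          z2_piece (~~ b) u' & v' = f v + z2_diff (~~ b) u']].

(* The alias carries the k-vector space structure (restriction of scalars). *)
Definition kmatrix (k : fieldType) (R : comAlgType k) (p q : nat) : Type :=
  'M[R]_(p, q).

Section KMatrix.
Variables (k : fieldType) (R : comAlgType k) (p q : nat).
HB.instance Definition _ := GRing.Zmodule.copy (kmatrix R p q) 'M[R]_(p, q).

Let scale (c : k) (F : kmatrix R p q) : kmatrix R p q :=
  (c%:A : R) *: (F : 'M[R]_(p, q)).

Fact kmatrix_scaleA a b F : scale a (scale b F) = scale (a * b) F.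
Proof. by rewrite /scale scalerA mulr_algl scalerA. Qed.
Fact kmatrix_scale1 : left_id 1 scale.
Proof. by move=> F; rewrite /scale scale1r (scale1r (F : 'M[R]_(p, q))). Qed.
Fact kmatrix_scaleDr : right_distributive scale +%R.
Proof. by move=> a F G; rewrite /scale (scalerDr a%:A (F : 'M[R]_(p, q))). Qed.
Fact kmatrix_scaleDl F : {morph scale^~ F : a b / a + b}.
Proof.
by move=> a b; rewrite /scale scalerDl (scalerDl (F : 'M[R]_(p, q))).
Qed.
HB.instance Definition _ := GRing.Zmodule_isLmodule.Build k (kmatrix R p q)
  kmatrix_scaleA kmatrix_scale1 kmatrix_scaleDr kmatrix_scaleDl.

Lemma kmatrix_scaleE (c : k) (F : kmatrix R p q) :
  c *: F = (c%:A : R) *: (F : 'M[R]_(p, q)) :> 'M[R]_(p, q).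
Proof. by []. Qed.
End KMatrix.

Section HomComplex.
Variables (k : fieldType) (R : comAlgType k) (w : R) (X Y : matfact w).

Definition mf_hom : lmodType k := kmatrix R (mf_rank Y) (mf_rank X).

Definition hom_piece (b : bool) : set mf_hom :=
  [set F : 'M[R]_(mf_rank Y, mf_rank X) |
    forall i j, mf_par i (+) mf_par j != b -> F i j = 0].

Definition hom_diff (b : bool) (F : mf_hom) : mf_hom :=
  mf_d Y *m (F : 'M[R]_(_, _))
    - ((-1 : R) ^+ b *: ((F : 'M[R]_(_, _)) *m mf_d X)).

Fact hom_piece_submod b : submod_closed (mem (hom_piece b)).
Proof.
split=> [|a u v]; rewrite !inE /hom_piece /=.
  by move=> i j _; rewrite mxE.
by move=> hu hv i j hij; rewrite !mxE hu // hv // mulr0 addr0.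
Qed.

Fact hom_diff_linear b : linear (hom_diff b).
Proof.
move=> c F G; rewrite /hom_diff (kmatrix_scaleE c F).
rewrite (kmatrix_scaleE c (_ - _)) mulmxDr mulmxDl -scalemxAr -scalemxAl.
rewrite !scalerDr scalerN !scalerA mulrC opprD.
by rewrite -!addrA; congr (_ + _); rewrite addrCA.
Qed.

Fact hom_diff_odd c b (F : mf_hom) :
  hom_piece b F -> hom_piece (~~ b) (hom_diff c F).
Proof.
move=> hF i j hij.
have h1 : (mf_d Y *m (F : 'M[R]_(_, _))) i j = 0.
  rewrite mxE big1 // => l _.
  have [e|ne] := eqVneq (mf_par i) (mf_par l); first by rewrite mf_odd ?mul0r.
  rewrite hF ?mulr0 //; move: ne hij => {hF}.
  by case: (mf_par i); case: (mf_par l); case: (mf_par j); case: b.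
have h2 : ((F : 'M[R]_(_, _)) *m mf_d X) i j = 0.
  rewrite mxE big1 // => l _.
  have [e|ne] := eqVneq (mf_par l) (mf_par j).
    by rewrite [mf_d X l j]mf_odd // mulr0.
  rewrite hF ?mul0r //; move: ne hij => {hF h1}.
  by case: (mf_par i); case: (mf_par l); case: (mf_par j); case: b.
by rewrite /hom_diff mxE h1 mxE [X in - X]mxE h2 mulr0 subr0.
Qed.

Fact hom_diff_sq b (F : mf_hom) : hom_diff (~~ b) (hom_diff b F) = 0.
Proof.
rewrite /hom_diff mulmxBr mulmxBl -!scalemxAr -!scalemxAl !mulmxA mf_sq.
rewrite scalerBr scalerA -[F *m _ *m _]mulmxA mf_sq mul_scalar_mx mul_mx_scalar.
set P := w *: _; set Q := (mf_d Y *m _ *m _).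
have -> : (-1) ^+ (~~ b) = - (-1) ^+ b :> R.
  by case: b; rewrite ?expr1 ?expr0 ?opprK.
by rewrite mulNr -expr2 sqrr_sign !scaleNr scale1r opprK opprD opprK addrA
  subrK subrr.
Qed.

Definition hom_complex : z2_complex k :=
  Z2Complex hom_piece_submod hom_diff_linear
    (fun b => @hom_diff_odd b b) (fun b F _ => hom_diff_sq b F).

(* The complex Hom_k(Hom(X, Y), k), k sitting in degree 0: the functionals of
   degree b are those vanishing on the piece of the other degree, and the
   differential is phi |-> - (-1)^|phi| phi o d. *)
Definition dual_space : lmodType k := (mf_hom -> k^o).

Definition dual_piece (b : bool) : set dual_space :=
  [set phi : mf_hom -> k^o |
    scalar phi /\ forall F, hom_piece (~~ b) F -> phi F = 0].

Definition dual_diff (b : bool) (phi : dual_space) : dual_space :=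
  fun F => - ((-1) ^+ b * (phi : mf_hom -> k^o) (hom_diff (~~ b) F)).

Fact dual_piece_submod b : submod_closed (mem (dual_piece b)).
Proof.
split=> [|a u v]; rewrite !inE /dual_piece /=.
  by split=> // c F G; rewrite mulr0 addr0.
move=> [lu hu] [lv hv]; split=> [c F G|F hF].
  rewrite !fctE lu lv /GRing.scale /= !mulrDr !addrA; congr (_ + _).
  by rewrite !mulrA [c * a]mulrC -!addrA; congr (_ + _); rewrite addrC.
by rewrite !fctE hu // hv // scaler0 addr0.
Qed.

Fact dual_diff_linear b : linear (dual_diff b).
Proof.
move=> c u v; apply/funext => F; rewrite /dual_diff !fctE.
by rewrite mulrDr opprD /GRing.scale /= mulrCA mulrN.
Qed.

Fact dual_diff_odd b (phi : dual_space) :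
  dual_piece b phi -> dual_piece (~~ b) (dual_diff b phi).
Proof.
move=> [lphi hphi]; split=> [c F G|F hF].
  rewrite /dual_diff hom_diff_linear lphi mulrDr opprD mulrN.
  by rewrite [_ * (c * _)]mulrCA.
rewrite /dual_diff hphi ?mulr0 ?oppr0 //.
by apply: hom_diff_odd; move: hF; rewrite negbK.
Qed.

Fact dual_diff_sq b (phi : dual_space) :
  dual_piece b phi -> dual_diff (~~ b) (dual_diff b phi) = 0.
Proof.
move=> [lphi _]; apply/funext => F; rewrite /dual_diff negbK.
rewrite -{2}[b]negbK.
have -> : hom_diff (~~ b) (hom_diff b F) = 0 by exact: hom_diff_sq.
have h0 : phi 0 = 0.
  have /eqP := lphi 1 0 0; rewrite scaler0 addr0 mul1r.
  by rewrite eq_sym -subr_eq0 addrK => /eqP.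
by rewrite h0 !mulr0 !oppr0 mulr0 oppr0.
Qed.

Definition dual_hom_complex : z2_complex k :=
  Z2Complex dual_piece_submod dual_diff_linear dual_diff_odd dual_diff_sq.

End HomComplex.

Section KapustinLin.
Variables (k : fieldType) (R : comAlgType k) (m : set R) (n : nat).
Variables (x : 'I_n -> R) (del : 'I_n -> R -> R) (w : R).

Definition supertrace (Y : matfact w) (M : 'M[R]_(mf_rank Y)) : R :=
  \sum_i (-1) ^+ mf_par i * M i i.

Definition dQ_wedge (Y : matfact w) : 'M[R]_(mf_rank Y) :=
  \sum_(sigma : 'S_n)
    (-1) ^+ sigma *: \prod_(i < n) map_mx (del (sigma i)) (mf_d Y).

Definition kapustin_li (X Y : matfact w) (F : mf_hom X Y)
    (G : mf_hom Y (mf_shift n X)) : k :=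
  (-1) ^+ 'C(n.+1, 2) * (n`!%:R)^-1 *
  residue m x (fun i => del i w)
    (supertrace ((F : 'M[R]_(mf_rank Y, mf_rank X))
                  *m (G : 'M[R]_(mf_rank X, mf_rank Y)) *m dQ_wedge Y)).

End KapustinLin.

(* Main.v *)
(* Let E = Hom(X, Y), let x_j^i = \sum_l C_jl del_l w, and let theta read off
   the coefficient of (x_1 ... x_n)^(i-1), so that the residue of f at the
   partials of w is theta (det C * f).  The endomorphism
   mu_j = \sum_l C_jl del_l Q of Y is a null-homotopy of y_j = x_j^i, and
   the antisymmetrised product of the mu_j is det C * (dQ)^{/\ n}.  Hence the
   pairing is theta (tr (F G mu_1 ... mu_n)) up to antisymmetrisation, and only
   the y_j, never the partials of w, need to be a regular sequence.

   Every cycle of E / yE is the class of mu_1 ... mu_n e plus shorter products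
   of the mu_j, for a cycle e of E, and the shorter products pair with cycles
   into (y).  A functional on E that kills boundaries lifts to one on E / yE,
   where the perfect pairing theta on R / (y) represents it.  This gives
   surjectivity on homology in each of the two variables, and surjectivity in
   one variable implies injectivity in the other.

   That the partials of w generate an m-primary ideal is proved by
   contradiction: otherwise they all lie in a prime q with dim R/q = 1, and
   R/(q + (z^N)) is free of finite rank over k[z]/z^N for some z.  A derivation
   in w (if w is not in q) or a linear form on q nonzero at w (if w is in q, by
   regularity of (R/w)_q), combined with the trace over k[z]/z^N, yields a
   derivation-like form that contradicts the vanishing of the partials
   modulo q. *)
Require Import Defs.
From HB Require Import structures.
From mathcomp Require Import all_boot all_fingroup all_algebra.
From mathcomp Require Import ring mpoly.
From mathcomp Require Import boolp classical_sets functions.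

Set Implicit Arguments.
Unset Strict Implicit.
Unset Printing Implicit Defensive.

Import GRing.Theory.
Local Open Scope classical_set_scope.
Local Open Scope ring_scope.

(** Differentiating [Q * Q = w] once makes each [del l Q] a null-homotopy of [del l w];
    differentiating twice makes these homotopies anticommute up to a scalar and a null-homotopy. The
    scalars are harmless: a product missing one of the n homotopies pairs a cycle with a cocycle
    into (y). Hence the products in the antisymmetrisation agree up to sign, and their number is
    cancelled by the factor 1/n! of the pairing.

    Powers of the parameters are regular in any order and with any exponents by a direct induction,
    whereas regularity of the partials would rest on the Cohen-Macaulay property.

    The signs of the Hom differentials depend on the degree. Grading operators extend both
    differentials to matrices of mixed degree, where they are linear and adjoint under the trace;
    homogeneous components return only at the end.

    The dual is that of an infinite-dimensional space, so functionals are extended by Zorn's lemma.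
    Characteristic zero enters twice: in n!, and in the rank of R/(q + (z)), which is the trace of
    an identity. *)

Section IdealTheory.
Variable A : comNzRingType.
Implicit Types (I K L : set A) (S : set A).

(** Unlike [proper_idealP] this admits the whole ring, so colons, sums and saturations need no
    properness check. *)
Definition is_ideal I : Prop :=
  I 0 /\ forall a u v, I u -> I v -> I (a * u + v).

Section Closure.
Variables (I : set A) (hI : is_ideal I).

Lemma ideal0 : I 0. Proof. by case: hI. Qed.

Lemma idealMl a u : I u -> I (a * u).
Proof. by move=> hu; rewrite -[_ * _]addr0; case: hI => h0; apply. Qed.

Lemma idealMr a u : I u -> I (u * a).
Proof. by rewrite mulrC; apply: idealMl. Qed.

Lemma idealD u v : I u -> I v -> I (u + v).
Proof. by move=> hu hv; rewrite -[u]mul1r; case: hI => _; apply. Qed.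

Lemma idealN u : I u -> I (- u).
Proof. by rewrite -mulN1r; apply: idealMl. Qed.

Lemma idealB u v : I u -> I v -> I (u - v).
Proof. by move=> hu hv; apply: idealD => //; apply: idealN. Qed.

Lemma ideal_sum (T : Type) (r : seq T) (P : pred T) (F : T -> A) :
  (forall i, P i -> I (F i)) -> I (\sum_(i <- r | P i) F i).
Proof.
by move=> hF; apply: (big_ind I); [exact: ideal0 | exact: idealD |].
Qed.

Lemma idealBC u v : I (u - v) -> I (v - u).
Proof. by move/idealN; rewrite opprB. Qed.

End Closure.

Lemma ideal_eqmod I u v : is_ideal I -> I (u - v) -> I u <-> I v.
Proof.
move=> hI huv; split=> h.
  have -> : v = u - (u - v) by ring.
  by apply: idealB.
have -> : u = v + (u - v) by ring.
by apply: idealD.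
Qed.

Lemma proper_idealPE I : proper_idealP I <-> is_ideal I /\ ~ I 1.
Proof.
rewrite /proper_idealP /idealr_closed; split.
  case=> h0 h1 h; split; first split.
  - by move: h0; rewrite inE.
  - by move=> a u v hu hv; have := h a u v; rewrite !inE; apply.
  - by move=> hi; move: h1; rewrite notin_setE.
case=> -[h0 h] h1; split; rewrite ?inE ?notin_setE //.
by move=> a u v; rewrite !inE; apply: h.
Qed.

Definition is_prime I : Prop :=
  [/\ is_ideal I, ~ I 1 & forall a b, I (a * b) -> I a \/ I b].

Lemma prime_idealPE I : prime_idealP I <-> is_prime I.
Proof.
rewrite /prime_idealP /prime_idealr_closed; split.
  case=> /proper_idealPE [hI h1] h; split=> // a b hab.
  have := h a b; rewrite !inE => /(_ hab) /orP [] /set_mem; by [left | right].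
case=> hI h1 h; split; first by apply/proper_idealPE.
by move=> a b; rewrite inE => /h [] ?; apply/orP; [left | right]; rewrite inE.
Qed.

Lemma prime_exp I : is_prime I -> forall a N, I (a ^+ N) -> I a.
Proof.
move=> [hI h1 hp] a; elim=> [|N IH]; first by rewrite expr0.
by rewrite exprS => /hp [].
Qed.

Lemma gen_ideal_is_ideal S : is_ideal (gen_ideal S).
Proof.
split; first by exists 0%N, (fun=> 0), (fun=> 0); split; [case | rewrite big_ord0].
move=> a u v [N [b [s [hs ->]]]] [M [c [t [ht ->]]]].
exists (N + M)%N, (fun j : 'I_(N + M) => match fintype.split j with inl i => a * b i | inr i => c i end),
  (fun j : 'I_(N + M) => match fintype.split j with inl i => s i | inr i => t i end); split.
  by move=> j; case: (fintype.split j).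
rewrite big_split_ord /= mulr_sumr; congr (_ + _); apply: eq_bigr => i _.
  by case: fintype.splitP; [move=> j /= /ord_inj <-; rewrite mulrA | move=> j /= e; have := ltn_ord i; rewrite e ltnNge leq_addr].
case: fintype.splitP => j /=; last by move/addnI/ord_inj <-.
by move=> e; have := ltn_ord j; rewrite -e ltnNge leq_addr.
Qed.

Lemma gen_ideal_sub S : S `<=` gen_ideal S.
Proof.
move=> s hs; exists 1%N, (fun=> 1), (fun=> s); split=> //.
by rewrite big_ord1 mul1r.
Qed.

Lemma gen_ideal_min S I : is_ideal I -> S `<=` I -> gen_ideal S `<=` I.
Proof.
move=> hI hS u [N [a [s [hs ->]]]]; apply: ideal_sum => // j _.
by apply: idealMl => //; apply: hS.
Qed.

Lemma setT_is_ideal : is_ideal (setT : set A).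
Proof. by []. Qed.

Lemma set0_is_ideal : is_ideal [set 0 : A].
Proof. by split=> // a u v -> ->; rewrite mulr0 addr0. Qed.

Definition principal (z : A) : set A := [set u | exists r, u = r * z].

Lemma principal_is_ideal z : is_ideal (principal z).
Proof.
split; first by exists 0; rewrite mul0r.
by move=> a _ _ [r ->] [s ->]; exists (a * r + s); ring.
Qed.

Definition adjoin I z : set A := [set u | exists a r, I a /\ u = a + r * z].

Lemma adjoin_is_ideal I z : is_ideal I -> is_ideal (adjoin I z).
Proof.
move=> hI; split; first by exists 0, 0; split; [exact: ideal0 | rewrite mul0r addr0].
move=> c _ _ [a [r [ha ->]]] [a' [r' [ha' ->]]].
by exists (c * a + a'), (c * r + r'); split; [case: hI => _; apply | ring].
Qed.

Lemma adjoin_sub I z : I `<=` adjoin I z.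
Proof. by move=> u hu; exists u, 0; split=> //; rewrite mul0r addr0. Qed.

Lemma adjoin_mem I z : is_ideal I -> adjoin I z z.
Proof. by move=> hI; exists 0, 1; split; [exact: ideal0 | rewrite mul1r add0r]. Qed.

Lemma adjoin_min I z K : is_ideal K -> I `<=` K -> K z -> adjoin I z `<=` K.
Proof.
move=> hK hI hz _ [a [r [ha ->]]]; apply: idealD => //; first exact: hI.
exact: idealMl.
Qed.

Lemma ideal_pow_is_ideal I N : is_ideal (ideal_pow I N).
Proof. by case: N => [|N]; [exact: setT_is_ideal | exact: gen_ideal_is_ideal]. Qed.

Lemma ideal_powM I N a b : I a -> ideal_pow I N b -> ideal_pow I N.+1 (a * b).
Proof. by move=> ha hb; apply: gen_ideal_sub; exists a => //; exists b. Qed.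

Lemma ideal_powSP I N (K : set A) : is_ideal K ->
  (forall a b, I a -> ideal_pow I N b -> K (a * b)) -> ideal_pow I N.+1 `<=` K.
Proof.
by move=> hK h; apply: gen_ideal_min => // _ [a ha] [b hb] <-; apply: h.
Qed.

Lemma ideal_powS I N : ideal_pow I N.+1 `<=` ideal_pow I N.
Proof.
elim: N => [|N IH]; first by [].
apply: ideal_powSP; first exact: ideal_pow_is_ideal.
by move=> a b ha hb; apply: ideal_powM => //; apply: IH.
Qed.

Lemma ideal_pow_le I N M : (N <= M)%N -> ideal_pow I M `<=` ideal_pow I N.
Proof.
elim: M => [|M IH]; first by rewrite leqn0 => /eqP ->.
rewrite leq_eqVlt => /orP [/eqP -> //|]; rewrite ltnS => /IH h.
by move=> u /ideal_powS; apply: h.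
Qed.

Lemma ideal_powD I N M a b :
  ideal_pow I N a -> ideal_pow I M b -> ideal_pow I (N + M) (a * b).
Proof.
elim: N a b => [|N IH] a b ha hb.
  by apply: idealMl => //; exact: ideal_pow_is_ideal.
rewrite addSn.
suff : ideal_pow I N.+1 `<=` [set u | ideal_pow I (N + M).+1 (u * b)] by apply.
apply: ideal_powSP => [|u v hu hv] /=; last by rewrite -mulrA; apply: ideal_powM => //; apply: IH.
have hP := ideal_pow_is_ideal I (N + M).+1.
split=> [|c u v /= hu hv] /=; first by rewrite mul0r; exact: ideal0.
by rewrite mulrDl -mulrA; case: hP => _; apply.
Qed.

Lemma ideal_pow_exp I a N : I a -> ideal_pow I N (a ^+ N).
Proof.
by move=> ha; elim: N => [|N IH] //; rewrite exprS; apply: ideal_powM.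
Qed.

Lemma ideal_pow1 I : is_ideal I -> ideal_pow I 1 `<=` I.
Proof. by move=> hI; apply: ideal_powSP => // a b ha _; apply: idealMr. Qed.

Definition fg_ideal I := exists (N : nat) (g : 'I_N -> A), I = gen_ideal (range g).

Lemma noetherian_fg : noetherian A -> forall I, is_ideal I -> fg_ideal I.
Proof.
move=> hA I hI; case: (pselect (I 1)) => [h1|h1].
  exists 1%N, (fun=> 1); apply/seteqP; split=> u _.
    by exists 1%N, (fun=> u), (fun=> 1); split; [move=> j; exists ord0 | rewrite big_ord1 mulr1].
  by rewrite -[u]mulr1; apply: idealMl.
by apply: hA; apply/proper_idealPE.
Qed.

(* The empty set is added to the family ordered by inclusion because
   [Zorn_bigcup] asks for the union of the empty chain. *)
Lemma noetherian_maximal (P : set A -> Prop) : noetherian A ->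
  (exists I, is_ideal I /\ P I) ->
  exists I, [/\ is_ideal I, P I &
    forall K, is_ideal K -> P K -> I `<=` K -> K `<=` I].
Proof.
move=> hA [I0 [hI0 hP0]].
pose F : set (set A) := [set I | I = set0 \/ is_ideal I /\ P I].
have [|M [hM hmax]] := @Zorn_bigcup A F.
  move=> C hC htot; set U := \bigcup_(X in C) X.
  case: (pselect (exists X, C X /\ X !=set0)) => [[X [hX hX0]]|hno]; last first.
    left; apply/seteqP; split=> // u [X hX hu]; case: hno; exists X; split=> //.
    by exists u.
  have hCi Y : C Y -> Y !=set0 -> is_ideal Y /\ P Y.
    by move=> hY [y hy]; case: (hC _ hY) => // e; move: hy; rewrite e.
  have hU : is_ideal U.
    split; first by exists X => //; case: (hCi _ hX hX0) => /ideal0.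
    move=> a u v [Y hY hu] [Z hZ hv].
    have hYi : is_ideal Y by apply: (hCi _ hY _).1; exists u.
    have hZi : is_ideal Z by apply: (hCi _ hZ _).1; exists v.
    case: (htot _ _ hY hZ) => h.
      by exists Z => //; case: hZi => _; apply=> //; apply: h.
    by exists Y => //; case: hYi => _; apply=> //; apply: h.
  have [N [g eU]] := noetherian_fg hA hU.
  (* Finitely many generators of the union lie in one member of the chain, which is then the
     union. *)
  have [Y [hY hY0 hg]] : exists Y, [/\ C Y, Y !=set0 & forall j : 'I_N, Y (g j)].
    have hgU j : U (g j) by rewrite eU; apply: gen_ideal_sub; exists j.
    suff : forall s : seq 'I_N, exists Y, [/\ C Y, Y !=set0 & forall j, j \in s -> Y (g j)].
      by move/(_ (enum 'I_N)) => [Y [h1 h2 h]]; exists Y; split=> // j; apply: h; rewrite mem_enum.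
    elim=> [|j s [Y [h1 h2 h3]]]; first by exists X.
    have [Z hZ hj] := hgU j; case: (htot _ _ h1 hZ) => h.
      exists Z; split=> //; first by exists (g j).
      by move=> i; rewrite inE => /orP [/eqP -> //|/h3 /h].
    exists Y; split=> // i; rewrite inE => /orP [/eqP -> //|/h3 //]; exact: h.
  right; split=> //; suff -> : U = Y by case: (hCi _ hY hY0).
  apply/seteqP; split; last by move=> u hu; exists Y.
  rewrite eU; apply: gen_ideal_min; first by case: (hCi _ hY hY0).
  by move=> _ [j _ <-].
have hM' : is_ideal M /\ P M.
  case: hM => // e; exfalso; apply: (hmax I0); last by right.
  by rewrite e; split=> // h; have := h 0 (ideal0 hI0).
exists M; split; [by case: hM' | by case: hM' |].
move=> K hK hPK hMK; apply: contrapT => hn; apply: (hmax K); last by right.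
by split.
Qed.

Lemma gen_range_is_sum (N : nat) (t : 'I_N -> A) u :
  gen_ideal (range t) u <-> exists v, u = \sum_i v i * t i.
Proof.
split; last first.
  case=> v ->; apply: ideal_sum; first exact: gen_ideal_is_ideal.
  move=> i _; apply: idealMl; first exact: gen_ideal_is_ideal.
  by apply: gen_ideal_sub; exists i.
move: u; apply: gen_ideal_min; last first.
  move=> _ [j _ <-]; exists (fun i => (i == j)%:R).
  by rewrite (bigD1 j) //= eqxx mul1r big1 ?addr0 // => i /negbTE ->; rewrite mul0r.
split; first by exists (fun=> 0); rewrite big1 // => i _; rewrite mul0r.
move=> a _ _ [v ->] [w ->]; exists (fun i => a * v i + w i).
by rewrite mulr_sumr -big_split; apply: eq_bigr => i _ /=; ring.
Qed.

End IdealTheory.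

(** * Noetherian local rings and Krull's intersection theorem *)

Section Local.
Variables (A : comNzRingType) (m : set A).
Hypotheses (noethA : noetherian A) (locA : local_ring m).

Lemma max_is_ideal : is_ideal m.
Proof. by case: locA => /proper_idealPE []. Qed.

Lemma max_not1 : ~ m 1.
Proof. by case: locA => /proper_idealPE []. Qed.

Lemma local_unit a : ~ m a -> exists b, b * a = 1.
Proof.
move=> ha; apply: contrapT => hn.
have h1 : ~ principal a 1 by move=> [r e]; apply: hn; exists r.
have : proper_idealP (principal a).
  by apply/proper_idealPE; split=> //; exact: principal_is_ideal.
by move/locA.2; apply: contra_not ha; apply; exists 1; rewrite mul1r.
Qed.

Lemma max_is_prime : is_prime m.
Proof.
split; [exact: max_is_ideal | exact: max_not1 |].
move=> a b hab; case: (pselect (m a)) => ha; [by left | right].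
have [c e] := local_unit ha.
by rewrite -[b]mul1r -e -mulrA; apply: (idealMl max_is_ideal).
Qed.

Lemma local_unit1B a : m a -> exists b, b * (1 - a) = 1.
Proof.
move=> ha; apply: local_unit => h; apply: max_not1.
by have := idealD max_is_ideal h ha; rewrite subrK.
Qed.

(* A maximal ideal [L] with [L :&: (I + (u)) = I + m u] contains a power of
   [m], so [u] lies in [I + m u]. *)
Lemma krull_intersection (I : set A) u : is_ideal I ->
  (forall N, exists2 a, I a & ideal_pow m N (u - a)) -> I u.
Proof.
move=> hI hu.
have hm := max_is_ideal.
pose W : set A := [set v | exists a b, [/\ I a, m b & v = a + b * u]].
have hW : is_ideal W.
  split; first by exists 0, 0; split; rewrite ?mul0r ?addr0 //; exact: ideal0.
  move=> c _ _ [a [b [ha hb ->]]] [a' [b' [ha' hb' ->]]].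
  exists (c * a + a'), (c * b + b').
  by split; [case: hI => _; apply | case: hm => _; apply | ring].
have hIW : I `<=` W by move=> a ha; exists a, 0; split=> //; [exact: ideal0 | ring].
(* [W] is I + m u. From u = a + b u with b in m, the unit 1 - b puts u in [I]: Nakayama for one
   element. *)
suff : W u.
  move=> [a [b [ha hb e]]].
  have [c hc] := local_unit1B hb.
  have -> : u = c * a by rewrite -[u]mul1r -hc -mulrA mulrBl mul1r {1}e addrK.
  exact: idealMl.
pose P (L : set A) := W `<=` L /\ forall v, L v -> adjoin I u v -> W v.
have [L [hL [hWL hLW] hmax]] := @noetherian_maximal A P noethA
  (ex_intro _ W (conj hW (conj (fun v h => h) (fun v h _ => h)))).
have hIu := adjoin_is_ideal u hI.
(* The colons (L : a^N) stabilise at some N. If v = l + r a^N lies in I + (u), then a v lies in [W],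
   so r is in (L : a^(N+1)) = (L : a^N) and v is in L. Thus L + (a^N) meets the same condition as L,
   and maximality puts a^N in L. *)
have mL a : m a -> exists N, L (a ^+ N).
  move=> ha.
  pose Q (N : nat) : set A := [set v | L (a ^+ N * v)].
  have hQ N : is_ideal (Q N).
    split=> [|c v w]; rewrite /Q /=; first by rewrite mulr0; exact: ideal0.
    move=> hv hw; have -> : a ^+ N * (c * v + w) = c * (a ^+ N * v) + a ^+ N * w by ring.
    by case: hL => _; apply.
  have QS N M : (N <= M)%N -> Q N `<=` Q M.
    move=> hNM v; rewrite /Q /= -(subnKC hNM) exprD => hv.
    have -> : a ^+ N * a ^+ (M - N) * v = a ^+ (M - N) * (a ^+ N * v) by ring.
    exact: idealMl.
  have [K [hK [N eK] hKmax]] := @noetherian_maximal A (fun K => exists N, K = Q N) noethA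
    (ex_intro _ _ (conj (hQ 0%N) (ex_intro _ 0%N erefl))).
  have hst M : Q M `<=` Q N.
    move=> v hv; have := hKmax (Q (N + M)%N) (hQ _) (ex_intro _ _ erefl).
    by rewrite eK => h; apply: h; [apply: QS; exact: leq_addr | apply: QS hv; exact: leq_addl].
  exists N.
  pose L' := adjoin L (a ^+ N).
  suff : L' `<=` L by apply; apply: adjoin_mem.
  apply: hmax; [exact: adjoin_is_ideal | split | exact: adjoin_sub].
    by move=> v /hWL; exact: adjoin_sub.
  move=> v [l [r [hl ev]]] hv; apply: hLW => //; rewrite ev.
  have hav : L (a * v).
    apply: hWL; case: hv => b [s [hb ->]]; exists (a * b), (a * s).
    by split; [exact: idealMl | exact: idealMr | ring].
  have : L (a ^+ N.+1 * r).
    have -> : a ^+ N.+1 * r = a * v - a * l by rewrite ev exprS; ring.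
    by apply: idealB => //; apply: idealMl.
  move/hst; rewrite /Q /= mulrC => h; exact: idealD.
have [N hN] : exists N, ideal_pow m N `<=` L.
  have [s [g em]] := noetherian_fg noethA hm.
  have mg j : m (g j) by rewrite em; apply: gen_ideal_sub; exists j.
  have [e he] := choice (fun j => mL (g j) (mg j)).
  pose k : nat := (\sum_j e j)%N.
  (* Pigeonhole: factors from m are moved one at a time into the exponent vector [f]; once its total
     exceeds that of [e], some generator has reached a power lying in [L]. *)
  have key : forall M (f : 'I_s -> nat), (k < M + \sum_j f j)%N ->
      forall v, ideal_pow m M v -> L (\prod_j g j ^+ f j * v).
    elim=> [|M IH] f hf v.
      move=> _; have [j hj] : exists j, (e j <= f j)%N.
        apply: contrapT => hno; move: hf; rewrite add0n ltnNge => /negP; apply.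
        apply: leq_sum => j _; rewrite leqNgt; apply/negP => h; apply: hno; exists j; exact: ltnW.
      rewrite (bigD1 j) //= -(subnKC hj) exprD -!mulrA; apply: idealMr => //.
    have hQ : is_ideal [set v | L (\prod_j g j ^+ f j * v)].
      split=> /= [|c w w' h h']; first by rewrite mulr0; exact: ideal0.
      by rewrite mulrDr mulrCA; case: hL => _; apply.
    move: v; apply: ideal_powSP => // a b; rewrite em => /gen_range_is_sum [c ->] hb /=.
    rewrite mulr_suml mulr_sumr; apply: ideal_sum => // i _.
    have -> : \prod_j g j ^+ f j * (c i * g i * b)
       = c i * (\prod_j g j ^+ (f j + (j == i)) * b).
      rewrite [X in _ = c i * (X * b)](eq_bigr (fun j => g j ^+ f j * g j ^+ (j == i))); last by move=> j _; rewrite exprD.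
      rewrite big_split /= [X in _ = c i * (_ * X * b)](bigD1 i) //= eqxx expr1 [X in _ * (_ * X) * b]big1 ?mulr1; first by ring.
      by move=> j /negbTE ->; rewrite expr0.
    apply: idealMl => //; apply: IH => //; last by rewrite em.
    rewrite big_split /= (bigD1 i) //= [X in (_ + (_ + X))%N](bigD1 i) //= eqxx.
    rewrite [X in (_ + (_ + (_ + X)))%N]big1 ?addn0; last by move=> j /negbTE ->.
    by rewrite addn1 addnS -addSn (leq_trans hf) // (bigD1 i).
  exists k.+1; move=> v hv; rewrite -[v]mul1r.
  have -> : 1 = \prod_j g j ^+ 0 :> A by rewrite big1.
  by apply: (key k.+1 (fun=> 0%N)) => //; rewrite big1 ?addn0.
have [a ha hua] := hu N.
rewrite -[u](subrK a); apply: idealD => //; last exact: hIW.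
apply: hLW; first exact: hN.
by exists (- a), 1; split; [exact: idealN | ring].
Qed.

End Local.

(** * Regular sequences in a local ring: permutability and descent of primality *)

Section RegularSequences.
Variable A : comNzRingType.
Implicit Types (I K : set A) (s : seq A).

Definition nonzerodivisor I (a : A) : Prop := forall u, I (a * u) -> I u.

Lemma nonzerodivisorX I a N u : nonzerodivisor I a -> I (a ^+ N * u) -> I u.
Proof.
by move=> h; elim: N => [|N IH]; rewrite ?expr0 ?mul1r // exprS -mulrA => /h /IH.
Qed.

(** Relative to an ideal so that induction can absorb the head into it; weak, because the ideal
    reached at the end may be the whole ring. *)
Fixpoint weakly_regular I s : Prop :=
  if s is a :: s' then nonzerodivisor I a /\ weakly_regular (adjoin I a) s'
  else True.

Lemma adjoinC I a b : is_ideal I -> adjoin (adjoin I a) b = adjoin (adjoin I b) a.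
Proof.
move=> hI.
have h a' b' : adjoin (adjoin I a') b' `<=` adjoin (adjoin I b') a'.
  apply: adjoin_min; first by do 2 apply: adjoin_is_ideal.
    apply: adjoin_min; first by do 2 apply: adjoin_is_ideal.
      by move=> u hu; do 2 apply: adjoin_sub.
    by apply: adjoin_mem; exact: adjoin_is_ideal.
  by apply: adjoin_sub; exact: adjoin_mem.
by apply/seteqP; split; exact: h.
Qed.

Lemma foldl_adjoin_is_ideal I s : is_ideal I -> is_ideal (foldl (@adjoin A) I s).
Proof. by elim: s I => //= a s IH I hI; apply: IH; exact: adjoin_is_ideal. Qed.

Lemma foldl_adjoin_sub I s : I `<=` foldl (@adjoin A) I s.
Proof.
by elim: s I => [|a s IH] I u hu //=; apply: IH; exact: adjoin_sub.
Qed.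

Lemma foldl_adjoin_mem I s a : is_ideal I -> a \in s -> foldl (@adjoin A) I s a.
Proof.
elim: s I => //= b s IH I hI; rewrite inE => /orP [/eqP ->|].
  by apply: foldl_adjoin_sub; exact: adjoin_mem.
by apply: IH; exact: adjoin_is_ideal.
Qed.

Lemma foldl_adjoin_min I s K : is_ideal K -> I `<=` K ->
  (forall a, a \in s -> K a) -> foldl (@adjoin A) I s `<=` K.
Proof.
move=> hK; elim: s I => //= a s IH I hI hs; apply: IH.
  by apply: adjoin_min => //; apply: hs; rewrite inE eqxx.
by move=> b hb; apply: hs; rewrite inE hb orbT.
Qed.

Lemma weakly_regular_intro I s :
  (forall s1 a s2, s = s1 ++ a :: s2 ->
     nonzerodivisor (foldl (@adjoin A) I s1) a) -> weakly_regular I s.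
Proof.
elim: s I => //= a s IH I h; split; first exact: (h [::] a s erefl).
by apply: IH => s1 b s2 e; apply: (h (a :: s1) b s2); rewrite e.
Qed.

Lemma weakly_regular_elim I s1 a s2 : weakly_regular I (s1 ++ a :: s2) ->
  nonzerodivisor (foldl (@adjoin A) I s1) a.
Proof. by elim: s1 I => [|b s1 IH] I /= [h h'] //; exact: IH. Qed.

Section Local.
Variable m : set A.
Hypotheses (noethA : noetherian A) (locA : local_ring m).

(** If b u is in I, then u = i + a^N v with b v in I, for every N: regularity of b modulo I + (a)
    extracts one more factor a from v, and a cancels. So u is in I + m^N for all N, hence in I by
    Krull. Regularity of a modulo I + (b) is a finite cancellation. *)
Lemma weakly_regular_swap I a b s : is_ideal I -> m a -> m b ->
  weakly_regular I [:: a, b & s] -> weakly_regular I [:: b, a & s].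
Proof.
move=> hI ma mb /= [ha [hb hs]]; rewrite [adjoin (adjoin I b) a]adjoinC //.
split; last split=> //.
- move=> u hu; apply: (krull_intersection noethA locA hI) => N.
  suff [i [v [hi hv ->]]] : exists i v, [/\ I i, I (b * v) & u = i + a ^+ N * v].
    exists i => //; rewrite addrAC subrr add0r; apply: (idealMr (ideal_pow_is_ideal _ _)).
    exact: ideal_pow_exp.
  elim: N => [|N [i [v [hi hv ->]]]].
    by exists 0, u; split; rewrite ?expr0 ?mul1r ?add0r //; exact: ideal0.
  have [j [r [hj ev]]] : adjoin I a v by apply: hb; exact: adjoin_sub.
  exists (i + a ^+ N * j), r; split; last by rewrite ev exprS; ring.
    by apply: idealD => //; exact: idealMl.
  apply: ha; have -> : a * (b * r) = b * v - b * j by rewrite ev; ring.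
  by apply: idealB => //; exact: idealMl.
- move=> u [i [r [hi e]]].
  have [j [r' [hj er]]] : adjoin I a r.
    apply: hb; exists (- i), u; split; first exact: idealN.
    have -> : b * r = (i + r * b) - i by ring.
    by rewrite -e; ring.
  have hu : I (u - r' * b).
    apply: ha; have -> : a * (u - r' * b) = i + b * j.
      by rewrite mulrBr e er; ring.
    by apply: idealD => //; exact: idealMl.
  by exists (u - r' * b), r'; split=> //; rewrite subrK.
Qed.

Lemma weakly_regular_front I s a : is_ideal I -> (forall b, b \in s -> m b) ->
  a \in s -> weakly_regular I s -> weakly_regular I (a :: rem a s).
Proof.
elim: s I => //= b s IH I hI hs; rewrite inE; case: eqP => [->|ne] /=; first by rewrite eqxx.
move=> has [hb hw]; rewrite eq_sym; case: eqP => // _.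
apply: weakly_regular_swap => //; try by apply: hs; rewrite inE ?has ?eqxx ?orbT.
split=> //; apply: IH => //; first exact: adjoin_is_ideal.
by move=> c hc; apply: hs; rewrite inE hc orbT.
Qed.

Lemma weakly_regular_perm I s s' : is_ideal I -> (forall b, b \in s -> m b) ->
  perm_eq s s' -> weakly_regular I s -> weakly_regular I s'.
Proof.
elim: s' s I => // a s' IH s I hI hs hp hw.
have has : a \in s by rewrite (perm_mem hp) inE eqxx.
have [h1 h2] := weakly_regular_front hI hs has hw; split=> //.
apply: (IH (rem a s)) h2; first exact: adjoin_is_ideal.
  by move=> b /mem_rem; exact: hs.
by rewrite -(perm_cons a) (perm_trans _ hp) // perm_sym perm_to_rem.
Qed.

(** By Krull, an element outside I is, modulo I, a power of a times an element outside the prime I +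
    (a). In a product of two such elements the power of a cancels, and the rest stays outside I +
    (a). *)
Lemma weakly_regular_prime I s : is_ideal I -> (forall b, b \in s -> m b) ->
  weakly_regular I s -> is_prime (foldl (@adjoin A) I s) -> is_prime I.
Proof.
elim: s I => //= a s IH I hI hs [ha hw] hp.
have [hJ J1 Jp] : is_prime (adjoin I a).
  by apply: IH => //; [exact: adjoin_is_ideal | move=> b hb; apply: hs; rewrite inE hb orbT].
have ma : m a by apply: hs; rewrite inE eqxx.
have fac f : ~ I f -> exists N i f', [/\ I i, ~ adjoin I a f' & f = i + a ^+ N * f'].
  move=> nf; apply: contrapT => hno; apply: nf.
  apply: (krull_intersection noethA locA hI) => N.
  suff [i [v [hi ->]]] : exists i v, I i /\ f = i + a ^+ N * v.
    exists i => //; rewrite addrAC subrr add0r; apply: (idealMr (ideal_pow_is_ideal _ _)).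
    exact: ideal_pow_exp.
  elim: N => [|N [i [v [hi ev]]]].
    by exists 0, f; split; [exact: ideal0 | rewrite expr0; ring].
  have [j [r [hj e]]] : adjoin I a v.
    by apply: contrapT => nv; apply: hno; exists N, i, v.
  exists (i + a ^+ N * j), r; split; last by rewrite ev e exprS; ring.
  by apply: idealD => //; exact: idealMl.
split=> // [h|f g hfg]; first by apply: J1; exact: adjoin_sub.
apply: contrapT => /not_orP [/fac [N [i [f' [hi hf' ef]]]] /fac [M [j [g' [hj hg' eg]]]]].
have : I (f' * g').
  apply: (@nonzerodivisorX _ a (N + M)) => //.
  have -> : a ^+ (N + M) * (f' * g') = f * g - (i * g + f * j - i * j).
    by rewrite ef eg exprD; ring.
  apply: idealB => //; apply: idealB => //; last exact: idealMl.
  by apply: idealD => //; [exact: idealMr | exact: idealMl].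
by move/(@adjoin_sub A I a)/Jp => [].
Qed.

End Local.
End RegularSequences.

(** * Ideals generated by powers of a regular system of parameters *)

Section Spans.
Variables (A : comNzRingType) (n : nat).
Implicit Types (T : {set 'I_n}) (y : 'I_n -> A).

(** Indexed by a set, without an order: the parameters are regular in any order and get removed from
    arbitrary positions. *)
Definition span T y : set A := [set u | exists v, u = \sum_(a in T) v a * y a].

Lemma span_is_ideal T y : is_ideal (span T y).
Proof.
split; first by exists (fun=> 0); rewrite big1 // => a _; rewrite mul0r.
move=> c _ _ [v ->] [w ->]; exists (fun a => c * v a + w a).
by rewrite mulr_sumr -big_split; apply: eq_bigr => a _ /=; ring.
Qed.

Lemma span_mem T y a : a \in T -> span T y (y a).
Proof.
move=> ha; exists (fun b => (b == a)%:R); rewrite (bigD1 a) //= eqxx mul1r big1 ?addr0 //.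
by move=> b /andP [_ /negbTE ->]; rewrite mul0r.
Qed.

Lemma span_min T y (K : set A) : is_ideal K -> (forall a, a \in T -> K (y a)) ->
  span T y `<=` K.
Proof.
by move=> hK h _ [v ->]; apply: ideal_sum => // a ha; apply: idealMl => //; exact: h.
Qed.

Lemma span_sub T T' y : T \subset T' -> span T y `<=` span T' y.
Proof.
move=> h; apply: span_min; first exact: span_is_ideal.
by move=> a /(fintype.subsetP h); exact: span_mem.
Qed.

Lemma span_adjoin T y a : a \in T -> span T y = adjoin (span (T :\ a) y) (y a).
Proof.
move=> ha; apply/seteqP; split.
  apply: span_min; first exact: adjoin_is_ideal (span_is_ideal _ _).
  move=> b hb; have [->|ne] := eqVneq b a; first by apply: adjoin_mem; exact: span_is_ideal.
  by apply: adjoin_sub; apply: span_mem; rewrite !inE ne.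
apply: adjoin_min; [exact: span_is_ideal | | exact: span_mem].
by apply: span_sub; rewrite subsetDl.
Qed.

Lemma span_eq T y y' : {in T, y =1 y'} -> span T y = span T y'.
Proof.
move=> h; apply/seteqP; split=> _ [v ->]; exists v; apply: eq_bigr => a ha.
  by rewrite h.
by rewrite h.
Qed.

Variables (m : set A) (x : 'I_n -> A).
Hypotheses (noethA : noetherian A) (locA : local_ring m).
Hypotheses (x_regular : regular_sequence x) (x_gen : m = gen_ideal (range x)).

Let mx i : m (x i).
Proof. by rewrite x_gen; apply: gen_ideal_sub; exists i. Qed.

Let foldl_map_eq (s : seq 'I_n) :
  foldl (@adjoin A) [set 0] (map x s) = gen_ideal [set x j | j in [set j | j \in s]].
Proof.
apply/seteqP; split.
  apply: foldl_adjoin_min; first exact: gen_ideal_is_ideal.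
    by move=> _ ->; apply: ideal0; exact: gen_ideal_is_ideal.
  by move=> _ /mapP [j hj ->]; apply: gen_ideal_sub; exists j.
apply: gen_ideal_min; first exact: foldl_adjoin_is_ideal (set0_is_ideal A).
move=> _ [j hj <-]; apply: foldl_adjoin_mem; first exact: set0_is_ideal.
exact: map_f.
Qed.

Let wreg_x : weakly_regular [set 0] (map x (enum 'I_n)).
Proof.
apply: weakly_regular_intro => s1 a s2 e.
have [t1 [i [t2 [et -> ->]]]] : exists t1 i t2,
    [/\ enum 'I_n = t1 ++ i :: t2, s1 = map x t1 & a = x i].
  exists (take (size s1) (enum 'I_n)).
  have hs : (size s1 < size (enum 'I_n))%N.
    by rewrite -(size_map x) e size_cat /= addnS ltnS leq_addr.
  have [i0 _] : exists i : 'I_n, True by case: (enum 'I_n) hs => // i; exists i.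
  exists (nth i0 (enum 'I_n) (size s1)), (drop (size s1).+1 (enum 'I_n)).
  split; first by rewrite -drop_nth // cat_take_drop.
    by rewrite map_take e take_size_cat.
  by rewrite -(nth_map i0 0 x) // e nth_cat ltnn subnn.
have hlt : forall j, (j \in t1) = (j < i)%N.
  have : map val (enum 'I_n) = iota 0 n by exact: val_enum_ord.
  rewrite et map_cat /= => ei.
  have hlen : (size t1 < n)%N.
    have := congr1 size ei; rewrite size_cat size_map /= size_iota => e0.
    by rewrite -[X in (_ < X)%N]e0 addnS ltnS leq_addr.
  have hsz : (val i) = size t1.
    have : nth 0%N (iota 0 n) (size t1) = val i.
      by rewrite -ei nth_cat size_map ltnn subnn.
    by rewrite nth_iota ?add0n.
  move=> j; have et1 : map val t1 = iota 0 (size t1).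
    have := congr1 (take (size t1)) ei.
    rewrite take_size_cat ?size_map // => ->; rewrite take_iota; congr iota.
    by apply/minn_idPl; exact: ltnW.
  by rewrite -(mem_map val_inj) et1 mem_iota add0n /= hsz.
rewrite foldl_map_eq => u; have := x_regular.1 i u.
suff -> : [set j | j \in t1] = [set j : 'I_n | (j < i)%N] by [].
by apply/seteqP; split=> j /=; rewrite hlt.
Qed.

(** The whole sequence generates the prime [m], and primality descends along it to zero: a regular
    local ring is a domain. *)
Lemma regular_prime0 : is_prime [set 0 : A].
Proof.
apply: (weakly_regular_prime noethA locA (set0_is_ideal A) _ wreg_x).
  by move=> _ /mapP [i _ ->]; exact: mx.
rewrite foldl_map_eq.
have -> : [set x j | j in [set j | j \in enum 'I_n]] = range x.
  by apply/seteqP; split=> _ [j _ <-]; exists j => //=; rewrite mem_enum.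
by rewrite -x_gen; exact: (max_is_prime locA).
Qed.

Lemma span_nonzerodivisor1 T j : j \notin T -> nonzerodivisor (span T x) (x j).
Proof.
move=> hj.
have -> : span T x = foldl (@adjoin A) [set 0] (map x (enum T)).
  rewrite foldl_map_eq; apply/seteqP; split.
    apply: span_min; first exact: gen_ideal_is_ideal.
    by move=> a ha; apply: gen_ideal_sub; exists a => //=; rewrite mem_enum.
  apply: gen_ideal_min; first exact: span_is_ideal.
  by move=> _ [a ha <-]; apply: span_mem; rewrite -mem_enum.
(* With the parameters ordered as [T], then [j], then the rest, [span T x] is the ideal of the
   prefix before [x j]. *)
pose r := [seq i <- enum 'I_n | (i \notin T) && (i != j)].
apply: (@weakly_regular_elim _ _ _ _ (map x r)).
rewrite -map_cons -map_cat.
apply: (weakly_regular_perm noethA locA (set0_is_ideal A) _ _ wreg_x).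
  by move=> _ /mapP [i _ ->].
apply: perm_map; apply: uniq_perm; first exact: enum_uniq.
  rewrite cat_uniq /= !enum_uniq /= filter_uniq ?enum_uniq // andbT.
  rewrite negb_or mem_enum hj /= mem_filter eqxx andbF /= andbT.
  apply/hasPn => i; rewrite mem_filter => /andP [/andP [h _] _].
  by change (i \notin enum T); rewrite mem_enum.
move=> i; rewrite mem_cat inE [i \in r]mem_filter !fintype.mem_enum !inE.
by case: (i \in T) => //=; case: (i == j) => //=.
Qed.

(** Induction on the sum of the exponents. Let e > 1 be the exponent of a, and I the span over T
    minus a. If x_j u is in I + (x_a^e), then u = i' + u' x_a^(e-1) by induction. Cancelling
    x_a^(e-1), regular modulo I, puts x_j u' in I + (x_a), hence u' too, again by induction. *)
Lemma span_nonzerodivisor T j (e : 'I_n -> nat) : j \notin T ->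
  nonzerodivisor (span T (fun a => x a ^+ e a)) (x j).
Proof.
have [N] := ubnP (\sum_(a in T) e a)%N; elim: N => // N IH in T j e *.
rewrite ltnS => hN hj.
pose y e' a := x a ^+ (e' a : nat).
case: (pickP (fun a => (a \in T) && (e a == 0%N))) => [a /andP [ha /eqP e0]|n0].
  move=> u _; rewrite -[u]mulr1; apply: idealMl; first exact: span_is_ideal.
  by have := span_mem (y e) ha; rewrite /y e0.
case: (pickP (fun a => (a \in T) && (e a != 1%N))) => [a /andP [ha e1]|n1]; last first.
  rewrite (@span_eq T (y e) x); first exact: span_nonzerodivisor1.
  by move=> a ha; have := n1 a; rewrite ha /y /= => /negbFE/eqP ->.
have e2 : (1 < e a)%N by move: (n0 a) e1; rewrite ha /=; case: (e a) => [|[]].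
pose sub c b := if b == a then c else e b : nat.
have hT' c : span (T :\ a) (y (sub c)) = span (T :\ a) (y e).
  by apply: span_eq => b; rewrite !inE /y /sub => /andP [/negbTE ->].
have hT c : span T (y (sub c)) = adjoin (span (T :\ a) (y e)) (x a ^+ c).
  by rewrite (span_adjoin _ ha) hT' /y /sub eqxx.
have hs c : (\sum_(b in T) sub c b)%N = (c + \sum_(b in T :\ a) e b)%N.
  rewrite (big_setD1 a ha) /= /sub eqxx; congr (_ + _)%N.
  by apply: eq_bigr => b; rewrite !inE => /andP [/negbTE ->].
have hI := span_is_ideal (T :\ a) (y e).
have he : span T (y e) = adjoin (span (T :\ a) (y e)) (x a ^+ e a) by rewrite -span_adjoin.
have hse : (\sum_(b in T) e b = e a + \sum_(b in T :\ a) e b)%N by rewrite (big_setD1 a ha).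
have lt c : (c < e a)%N -> (\sum_(b in T) sub c b < N)%N.
  by move=> hc; rewrite hs (leq_trans _ hN) // hse ltn_add2r.
have IH1 c : (c < e a)%N -> nonzerodivisor (adjoin (span (T :\ a) (y e)) (x a ^+ c)) (x j).
  by move=> hc; rewrite -hT; apply: IH => //; exact: lt.
rewrite [X in nonzerodivisor X](_ : _ = span T (y e)) // he => u [i [r [hi eu]]].
have ee : (e a = (e a).-1.+1)%N by rewrite prednK // ltnW.
have [i' [u' [hi' eu']]] : adjoin (span (T :\ a) (y e)) (x a ^+ (e a).-1) u.
  apply: (IH1 (e a).-1); first by rewrite -ee.
  by exists i, (r * x a); split=> //; rewrite eu {1}ee exprS; ring.
have hz : span (T :\ a) (y e) (x j * u' - r * x a).
  apply: (@nonzerodivisorX _ _ (x a) (e a).-1).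
    apply: IH; last by rewrite !inE eqxx.
    by rewrite (leq_trans _ hN) // hse -[X in (X <= _)%N]add1n leq_add2r ltnW.
  have -> : x a ^+ (e a).-1 * (x j * u' - r * x a) = i - x j * i'.
    have -> : i = x j * u - r * x a ^+ e a by rewrite eu addrK.
    by rewrite eu' {3}ee exprS; ring.
  by apply: idealB => //; exact: idealMl.
have [i2 [u2 [hi2 eu2]]] : adjoin (span (T :\ a) (y e)) (x a ^+ 1) u'.
  apply: (IH1 1%N) => //; exists (x j * u' - r * x a), r; split=> //.
  by rewrite expr1 subrK.
exists (i' + i2 * x a ^+ (e a).-1), u2; split.
  by apply: idealD => //; exact: idealMr.
have -> : x a ^+ e a = x a * x a ^+ (e a).-1 by rewrite -exprS prednK // ltnW.
by rewrite eu' eu2; ring.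
Qed.

End Spans.

(** * Taylor coefficients in the parameters, residues and differentials *)

Section Coefficients.
Variables (k : fieldType) (R : comAlgType k) (m : set R) (n : nat).
Variable x : 'I_n -> R.
Hypotheses (noethR : noetherian R) (locR : local_ring m) (augR : augmented m).
Hypotheses (x_regular : regular_sequence x) (x_gen : m = gen_ideal (range x)).

Local Notation mono := 'X_{1..n}.
Local Notation mpol := {mpoly k[n]}.
Implicit Types (b c : mono) (p q : mpol) (f g : R).

Let m_ideal : is_ideal m := max_is_ideal locR.
Let pow_ideal N : is_ideal (ideal_pow m N) := ideal_pow_is_ideal m N.

Lemma regular_param_mem i : m (x i).
Proof. by rewrite x_gen; apply: gen_ideal_sub; exists i. Qed.

Definition mon b : R := \prod_i x i ^+ b i.

Definition ev p : R := mmap (in_alg R) x p.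

Lemma evX b : ev (mpolyX k b) = mon b.
Proof. by rewrite /ev mmapX. Qed.

Lemma evD p q : ev (p + q) = ev p + ev q. Proof. exact: mmapD. Qed.
Lemma evB p q : ev (p - q) = ev p - ev q. Proof. exact: mmapB. Qed.
Lemma evM p q : ev (p * q) = ev p * ev q. Proof. by rewrite /ev rmorphM. Qed.
Lemma evZ (c : k) p : ev (c *: p) = c%:A * ev p. Proof. exact: mmapZ. Qed.
Lemma evE p : ev p = \sum_(b <- msupp p) (mcoeff b p)%:A * mon b.
Proof. by []. Qed.
Lemma ev_sum (T : Type) (r : seq T) (P : pred T) (F : T -> mpol) :
  ev (\sum_(i <- r | P i) F i) = \sum_(i <- r | P i) ev (F i).
Proof. exact: raddf_sum. Qed.

Lemma mon_pow b : ideal_pow m (mdeg b) (mon b).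
Proof.
rewrite mdegE /mon.
elim/big_rec2: _ => [|i y N _ hy] //.
by rewrite mulrC addnC; apply: ideal_powD => //; apply: ideal_pow_exp; exact: regular_param_mem.
Qed.

Lemma monD b c : mon (mnm_add b c) = mon b * mon c.
Proof.
by rewrite /mon -big_split; apply: eq_bigr => i _; rewrite mnmDE exprD.
Qed.

Lemma mon1 i : mon (mnm1 i) = x i.
Proof.
rewrite /mon (bigD1 i) //= big1 ?mulr1 => [|j ne]; rewrite mnm1E.
  by rewrite eqxx expr1.
by rewrite eq_sym (negbTE ne) expr0.
Qed.

Lemma pow_mon_gen N :
  ideal_pow m N `<=` gen_ideal [set mon b | b in [set b | mdeg b = N]].
Proof.
elim: N => [|N IH].
  move=> u _; rewrite -[u]mulr1; apply: idealMl; first exact: gen_ideal_is_ideal.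
  apply: gen_ideal_sub; exists (mnm0 (n := n)); first by rewrite /= mdeg0.
  by rewrite /mon big1 // => i _; rewrite mnm0E expr0.
set G := gen_ideal _; have hG : is_ideal G := gen_ideal_is_ideal _.
apply: ideal_powSP => // a u; rewrite {1}x_gen => /gen_range_is_sum [al ->] /IH [s [v [w [hw ->]]]].
rewrite mulr_suml; apply: ideal_sum => // i _; rewrite mulr_sumr; apply: ideal_sum => // j _.
have [b hb eb] := hw j.
have -> : al i * x i * (v j * w j) = (al i * v j) * mon (mnm_add (mnm1 i) b).
  by rewrite monD mon1 eb; ring.
apply: idealMl => //; apply: gen_ideal_sub; exists (mnm_add (mnm1 i) b) => //=.
by rewrite mdegD mdeg1 hb.
Qed.

Lemma pow_sub_mon N (I : set R) : is_ideal I ->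
  (forall b, mdeg b = N -> I (mon b)) -> ideal_pow m N `<=` I.
Proof.
move=> hI h u /pow_mon_gen; move: u; apply: gen_ideal_min => // _ [b hb <-].
exact: h.
Qed.

(** The degree N error is a form whose coefficients may be replaced by their residue classes,
    constants because the algebra is augmented. *)
Lemma approx f N : exists p, ideal_pow m N (f - ev p).
Proof.
elim: N => [|N [p hp]]; first by exists 0.
suff [q hq] : exists q, ideal_pow m N.+1 (f - ev p - ev q).
  by exists (p + q); rewrite evD opprD addrA.
move: (f - ev p) hp => u /pow_mon_gen [s [v [w [hw ->]]]].
have /choice [c hc] : forall j, exists c : k, m (v j - c%:A).
  by move=> j; have [c [hc _]] := augR (v j); exists c.
have /choice [b hb] : forall j, exists b, mdeg b = N /\ mon b = w j.
  by move=> j; have [b hb eb] := hw j; exists b.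
exists (\sum_j c j *: mpolyX k (b j)).
rewrite ev_sum -sumrB; apply: ideal_sum => // j _; rewrite evZ evX (hb j).2 -mulrBl.
apply: ideal_powM; first exact: hc.
by rewrite -(hb j).1 -(hb j).2; exact: mon_pow.
Qed.

Lemma mon_exceed b c : (mdeg b <= mdeg c)%N -> b <> c ->
  exists j, (b j < c j)%N.
Proof.
move=> h ne; apply: contrapT => hno; apply: ne; apply/mnmP.
have hle i : (c i <= b i)%N by rewrite leqNgt; apply/negP => hi; apply: hno; exists i.
have heq : (\sum_i c i == \sum_i b i)%N.
  by rewrite eqn_leq leq_sum //= -!mdegE.
have [_ hiff] := @leqif_sum _ predT (fun i => c i == b i) c b
  (fun i _ => leqif_eq (hle i)).
by move: heq; rewrite hiff => /forallP h' i; apply/esym/eqP/h'.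
Qed.

(** Dividing by x_i^(b_i), one variable at a time, lowers the exponent of x_i in the ideal from b_i
    + 1 to 1; after the last variable, 1 would lie in m. *)
Lemma mon_notin b (c : k) :
  span [set: 'I_n] (fun j => x j ^+ (b j).+1) (c%:A * mon b) -> c = 0.
Proof.
move=> h; apply/eqP/negPn/negP => c0; move: h.
have hS e := @span_is_ideal R n [set: 'I_n] e.
move=> /(idealMl (hS _) (c^-1)%:A).
have -> : (c^-1)%:A * (c%:A * mon b) = mon b.
  by rewrite mulrA -scalerAl mul1r scalerA mulVf // scale1r mul1r.
rewrite /mon -big_enum /=.
(* Exponents of the ideal while the variables in [s] are still to be divided out. *)
pose e (s : seq 'I_n) j := if j \in s then (b j).+1 else 1%N.
have -> : (fun j => x j ^+ (b j).+1) = (fun j => x j ^+ e (enum 'I_n) j).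
  by apply/funext => j; rewrite /e fintype.mem_enum.
have : uniq (enum 'I_n) by exact: enum_uniq.
elim: (enum 'I_n) => [_|i s IH] /=.
  rewrite big_nil => h; apply: (max_not1 locR); move: h.
  apply: (span_min m_ideal) => j _; rewrite expr1; exact: regular_param_mem.
move=> /andP [hi hs]; rewrite big_cons; set P := \prod_(j <- s) _ => h; apply: IH => //.
rewrite -/P.
have hz : span [set~ i] (fun j => x j ^+ e (i :: s) j) =
          span [set~ i] (fun j => x j ^+ e s j).
  by apply: span_eq => j; rewrite !inE /e inE => /negbTE ->.
move: h; rewrite (@span_adjoin _ _ _ _ i) ?inE // finset.setTD hz => -[a [r [ha]]].
rewrite /e inE eqxx /= exprS => eP.
have hP : span [set~ i] (fun j => x j ^+ e s j) (P - r * x i).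
  apply: (@nonzerodivisorX _ _ (x i) (b i)).
    by apply: (span_nonzerodivisor noethR locR x_regular x_gen); rewrite !inE eqxx.
  have -> : x i ^+ b i * (P - r * x i) = a by rewrite mulrBr eP; ring.
  exact: ha.
rewrite (@span_adjoin _ _ _ _ i) ?inE // finset.setTD; exists (P - r * x i), r; split=> //.
by rewrite /e (negbTE hi) expr1 subrK.
Qed.

(** Induction on the degree of b, modulo the ideal of the x_j^(b_j + 1). It contains m^N and every
    other monomial of degree at least that of b; smaller monomials have coefficient zero by
    induction. Only the term at b is left, for [mon_notin]. *)
Lemma ev_indep p N b : ideal_pow m N (ev p) -> (mdeg b < N)%N ->
  mcoeff b p = 0.
Proof.
have [d] := ubnP (mdeg b); elim: d => // d IH in b *.
rewrite ltnS => hd hp hb; apply: (@mon_notin b).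
set I := span _ _; have hI : is_ideal I := span_is_ideal _ _.
have hex c : (mdeg b <= mdeg c)%N -> b <> c -> I (mon c).
  move=> /mon_exceed h /h [j hj]; rewrite /mon (bigD1 j) //= -(subnKC hj) exprD -mulrA.
  by apply: idealMr => //; apply: (span_mem (fun j => x j ^+ (b j).+1)); rewrite inE.
have hev : I (ev p).
  apply: (pow_sub_mon hI _ (ideal_pow_le hb hp)) => c hc; apply: hex.
    by rewrite hc.
  by move=> e; move: hc; rewrite e => hc; exact: (n_Sn _ hc).
have : I (ev (p - mcoeff b p *: mpolyX k b)).
  rewrite evE; apply: ideal_sum => // c _.
  have [->|ne] := eqVneq c b.
    by rewrite mcoeffB mcoeffZ mcoeffX eqxx mulr1 subrr scale0r mul0r; exact: ideal0.
  rewrite mcoeffB mcoeffZ mcoeffX eq_sym (negbTE ne) mulr0 subr0.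
  case: (leqP (mdeg b) (mdeg c)) => hbc.
    by apply: idealMl => //; apply: hex => // e; rewrite e eqxx in ne.
  rewrite IH ?scale0r ?mul0r; first exact: ideal0.
  - exact: leq_trans hbc _.
  - by [].
  - exact: ltn_trans hbc hb.
rewrite evB evZ evX => h.
by have -> : (mcoeff b p)%:A * mon b = ev p - (ev p - (mcoeff b p)%:A * mon b);
  [ring | apply: idealB].
Qed.

(** Read off a chosen polynomial; by [coefE] any approximation modulo m^N with N above the degree of
    b gives the same value. *)
Definition coef b f : k := mcoeff b (projT1 (cid (approx f (mdeg b).+1))).

Lemma coefE b f N p : (mdeg b < N)%N -> ideal_pow m N (f - ev p) ->
  coef b f = mcoeff b p.
Proof.
move=> hN hp; rewrite /coef; case: cid => q hq /=.
apply/eqP; rewrite -subr_eq0 -mcoeffB; apply/eqP.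
apply: (@ev_indep _ (mdeg b).+1) => //.
have -> : ev (q - p) = (f - ev p) - (f - ev q) by rewrite evB; ring.
by apply: idealB => //; apply: (ideal_pow_le hN).
Qed.

Lemma coef_linear b : scalar (coef b).
Proof.
move=> a f g; pose N := (mdeg b).+1.
have [p hp] := approx f N; have [q hq] := approx g N.
rewrite (coefE _ hp) // (coefE _ hq) // (@coefE _ _ N (a *: p + q)) //.
  by rewrite mcoeffD mcoeffZ.
rewrite evD evZ -(mulr_algl a f).
have -> : a%:A * f + g - (a%:A * ev p + ev q) = a%:A * (f - ev p) + (g - ev q) by ring.
by case: (pow_ideal N) => _; apply.
Qed.

HB.instance Definition _ b := GRing.isLinear.Build k R k^o _ (coef b) (coef_linear b).

Lemma coefD b f g : coef b (f + g) = coef b f + coef b g.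
Proof. exact: raddfD. Qed.

Lemma coefB b f g : coef b (f - g) = coef b f - coef b g.
Proof. exact: raddfB. Qed.

Lemma coef_pow b f N : (mdeg b < N)%N -> ideal_pow m N f -> coef b f = 0.
Proof.
move=> hN hf; rewrite (@coefE _ _ N 0) // ?mcoeff0 //.
by rewrite /ev raddf0 subr0.
Qed.

Lemma coef_ev b p : coef b (ev p) = mcoeff b p.
Proof.
apply: (@coefE _ _ (mdeg b).+1) => //; rewrite subrr; exact: ideal0.
Qed.

Lemma coef_mon b c : coef b (mon c) = (c == b)%:R.
Proof. by rewrite -evX coef_ev mcoeffX. Qed.

Lemma coef_monD b c f : coef (mnm_add b c) (mon b * f) = coef c f.
Proof.
have [p hp] := approx f (mdeg (mnm_add b c)).+1.
rewrite (@coefE _ _ (mdeg (mnm_add b c)).+1 (p * mpolyX k b)) //.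
  rewrite mcoeffMX (coefE _ hp) //.
  by rewrite mdegD ltnS leq_addl.
rewrite evM evX [ev p * _]mulrC -mulrBr; exact: idealMl.
Qed.

Lemma coef_mon_small b c f j : (b j < c j)%N -> coef b (mon c * f) = 0.
Proof.
move=> hj; pose N := (mdeg b).+1.
have [p hp] := approx f N.
rewrite (@coefE _ _ N (mpolyX k c * p)) //; last first.
  by rewrite evM evX -mulrBr; exact: idealMl.
rewrite [p]mpolyE mulr_sumr raddf_sum /= big1 // => d _.
rewrite -scalerAr mcoeffZ -mpolyXD mcoeffX.
case: eqP => [e|_]; last by rewrite mulr0.
by move: hj; rewrite -e mnmDE ltnNge leq_addr.
Qed.

(** Krull's theorem makes [I] closed in the m-adic topology, so the monomials of the expansion
    decide membership. *)
Lemma coef_ideal (I : set R) f : is_ideal I ->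
  (forall b, coef b f != 0 -> I (mon b)) -> I f.
Proof.
move=> hI hb; apply: (krull_intersection noethR locR hI) => N.
have [p hp] := approx f N.
pose P b := (mdeg b < N)%N.
exists (\sum_(b <- msupp p | P b) (mcoeff b p)%:A * mon b).
  apply: ideal_sum => // b hPb; have [->|h0] := eqVneq (mcoeff b p) 0.
    by rewrite scale0r mul0r; exact: ideal0.
  by apply: idealMl => //; apply: hb; rewrite (coefE _ hp).
set S := \sum_(_ <- _ | _) _.
have -> : f - S = (f - ev p) + (ev p - S) by ring.
apply: idealD => //; rewrite evE (bigID P) /= -/S addrAC subrr add0r.
apply: ideal_sum => // b; rewrite /P -leqNgt => h; apply: idealMl => //.
exact: (ideal_pow_le h (mon_pow b)).
Qed.

Lemma coef_inj f : (forall b, coef b f = 0) -> f = 0.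
Proof.
move=> h; apply: (@coef_ideal [set 0]); first exact: set0_is_ideal.
by move=> b; rewrite h eqxx.
Qed.

Lemma approx_coef f N :
  ideal_pow m N (f - \sum_(b : 'X_{1..n < N}) (coef b f)%:A * mon b).
Proof.
have [p hp] := approx f N.
pose q : mpol := \sum_(b : 'X_{1..n < N}) coef b f *: 'X_[b].
have hq b : q@_b = if (mdeg b < N)%N then coef b f else 0.
  case: ifP => hb; first by rewrite /q (mcoeff_mpoly (fun b => coef b f)).
  rewrite /q raddf_sum /= big1 // => c _; rewrite mcoeffZ mcoeffX.
  case: eqP => [e|_]; last by rewrite mulr0.
  by move: hb; rewrite -e bmdeg.
have -> : \sum_(b : 'X_{1..n < N}) (coef b f)%:A * mon b = ev q.
  by rewrite ev_sum; apply: eq_bigr => b _; rewrite evZ evX.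
have -> : f - ev q = (f - ev p) + ev (p - q) by rewrite evB; ring.
apply: idealD => //; rewrite evE; apply: ideal_sum => // b _.
rewrite mcoeffB hq; case: ifP => hb.
  by rewrite (coefE hb hp) subrr scale0r mul0r; exact: ideal0.
apply: idealMl => //; apply: (ideal_pow_le _ (mon_pow b)).
by rewrite leqNgt hb.
Qed.

Definition top_mono i : mono := Multinom [tuple i | _ < n].

Lemma top_monoE i j : top_mono i j = i.
Proof. by rewrite mnmE. Qed.

(** The residue of f at x_1^(i+1), ..., x_n^(i+1). The index is one less than the exponent, which
    builds in the positivity asked by [is_residue]. *)
Definition theta i f : k := coef (top_mono i) f.

Lemma thetaM i (c : k) f : theta i (c%:A * f) = c * theta i f.
Proof. by rewrite mulr_algl /theta linearZ. Qed.

Local Notation xpow i := (span [set: 'I_n] (fun j => x j ^+ i)).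

Lemma theta_span i f : xpow i.+1 f -> theta i f = 0.
Proof.
move=> [v ->]; rewrite /theta raddf_sum /= big1 // => j _.
have -> : v j * x j ^+ i.+1 = mon (mnm_muln (mnm1 j) i.+1) * v j.
  rewrite mulrC; congr (_ * _); rewrite /mon (bigD1 j) //= big1 ?mulr1.
    by rewrite mulmnE mnm1E eqxx mul1n.
  by move=> l ne; rewrite mulmnE mnm1E eq_sym (negbTE ne) mul0n.
by apply: (@coef_mon_small _ _ _ j); rewrite top_monoE mulmnE mnm1E eqxx mul1n.
Qed.

Lemma xpow_mon i b j : (i <= b j)%N -> xpow i (mon b).
Proof.
move=> h; rewrite /mon (bigD1 j) //= -(subnKC h) exprD -mulrA.
by apply: (idealMr (span_is_ideal _ _)); apply: (span_mem (fun j => x j ^+ i)); rewrite inE.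
Qed.

(** Multiplication by the complementary monomial moves the coefficient at b to the top, so all
    coefficients of f with exponents at most i vanish. *)
Lemma theta_nondegenerate i f : (forall r, theta i (r * f) = 0) -> xpow i.+1 f.
Proof.
move=> h; apply: coef_ideal => [|b]; first exact: span_is_ideal.
case: (pselect (exists j, (i < b j)%N)) => [[j hj] _|hno]; first exact: xpow_mon hj.
pose c := mnm_sub (top_mono i) b.
have e : mnm_add c b = top_mono i.
  apply/mnmP => j; rewrite mnmDE mnmBE top_monoE subnK //.
  by rewrite leqNgt; apply/negP => hj; apply: hno; exists j.
by rewrite -(coef_monD c) e -/(theta i _) h eqxx.
Qed.

Lemma theta_represents i (g : R -> k) : scalar g ->
  (forall f, xpow i.+1 f -> g f = 0) -> exists c : R, forall r, g r = theta i (r * c).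
Proof.
move=> lg hg.
have hg0 : g 0 = 0 by apply: hg; apply: ideal0; exact: span_is_ideal.
have gD f h : g (f + h) = g f + g h by have := lg 1 f h; rewrite scale1r mul1r.
(* Dual basis: the coefficient of [c] at b is the value of g at the complementary monomial. The
   degree bound n i + 1 admits every exponent vector with entries at most i. *)
pose cb (b : bmultinom n (n * i).+1) := mnm_sub (top_mono i) (bmnm b).
pose P (b : bmultinom n (n * i).+1) := [forall j, bmnm b j <= i]%N.
pose c : R := \sum_(b | P b) (g (mon (cb b)))%:A * mon (bmnm b).
exists c => r.
pose d r := g r - theta i (r * c).
suff : d r = 0 by move/eqP; rewrite subr_eq0 => /eqP.
have dD f h : d (f + h) = d f + d h.
  by rewrite /d gD mulrDl /theta raddfD /=; ring.
have dZ (a : k) f : d (a%:A * f) = a * d f.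
  rewrite /d -mulrA thetaM mulrBr mulr_algl; have := lg a f 0.
  by rewrite addr0 hg0 addr0 => ->.
have dS f : xpow i.+1 f -> d f = 0.
  move=> hf; rewrite /d hg // theta_span ?subrr //.
  by apply: idealMr => //; exact: span_is_ideal.
have dmon b : d (mon b) = 0.
  case: (pselect (exists j, (i < b j)%N)) => [[j hj]|hno].
    by apply: dS; exact: xpow_mon hj.
  have hb j : (b j <= i)%N by rewrite leqNgt; apply/negP => hj; apply: hno; exists j.
  have hdeg (b' : mono) : (forall j, b' j <= i)%N -> (mdeg b' < (n * i).+1)%N.
    move=> h; have h2 : (\sum_j b' j <= \sum_(j < n) i)%N by apply: leq_sum => j _; exact: h.
    by rewrite ltnS mdegE (leq_trans h2) // sum_nat_const card_ord.
  pose b' := mnm_sub (top_mono i) b.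
  have hb' j : (b' j <= i)%N by rewrite mnmBE top_monoE leq_subr.
  pose B := BMultinom (hdeg b' hb').
  rewrite /d /c mulr_sumr (bigD1 B) /=; last by apply/forallP.
  rewrite /theta raddfD /= raddf_sum /= big1; last first.
    move=> b2 /andP [hP2 ne].
    rewrite mulrCA -/(theta _ _) thetaM /theta -monD coef_mon.
    case: eqP => [e|_]; last by rewrite mulr0.
    case/negP: ne; apply/eqP/val_inj => /=; apply/mnmP => j.
    have ej : (b j + bmnm b2 j)%N = i.
      by have := congr1 (fun z : mono => z j) e; rewrite mnmDE top_monoE.
    by apply: (@addnI (b j)); rewrite ej mnmBE top_monoE subnKC.
  rewrite mulrCA -/(theta _ _) thetaM /theta -monD coef_mon.
  have -> : mnm_add b b' = top_mono i.
    by apply/mnmP => j; rewrite mnmDE mnmBE top_monoE subnKC.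
  have -> : cb B = b.
    apply/mnmP => j; rewrite /cb /= mnmBE mnmBE top_monoE.
    by rewrite subKn.
  by rewrite eqxx mulr1 addr0 subrr.
have hp := approx_coef r (n * i).+1; set S := \sum_(b : _) _ in hp.
rewrite -(subrK S r) dD.
have -> : d (r - S) = 0.
  apply: dS; apply: pow_sub_mon hp; first exact: span_is_ideal.
  move=> b hb; have [j hj] : exists j, (i < b j)%N.
    apply: contrapT => hno; have : (mdeg b <= n * i)%N.
      have h2 : (\sum_j b j <= \sum_(j < n) i)%N.
        by apply: leq_sum => j _; rewrite leqNgt; apply/negP => hj; apply: hno; exists j.
      by rewrite mdegE (leq_trans h2) // sum_nat_const card_ord.
    by rewrite hb ltnn.
  exact: xpow_mon hj.
rewrite add0r /S.
elim/big_rec: _ => [|b y _ hy]; first by rewrite /d hg0 mul0r /theta raddf0 subrr.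
by rewrite dD dZ dmon hy mulr0 addr0.
Qed.

Definition mnm_of (b : 'I_n -> nat) : mono := [multinom b i | i < n].

Lemma mnm_of_val b : mnm_of b = b.
Proof. by apply/mnmP => i; rewrite mnmE. Qed.

Definition series_poly (s : ('I_n -> nat) -> k) N : mpol :=
  \sum_(b : {ffun 'I_n -> 'I_N} | (\sum_i b i < N)%N)
     s (fun i => b i) *: 'X_[mnm_of (fun i => b i)].

Lemma ev_series_poly s N : ev (series_poly s N) =
  \sum_(b : {ffun 'I_n -> 'I_N} | (\sum_i b i < N)%N)
     s (fun i => b i) *: \prod_i x i ^+ b i.
Proof.
rewrite ev_sum; apply: eq_bigr => b _; rewrite evZ evX mulr_algl; congr (_ *: _).
by apply: eq_bigr => i _; rewrite mnmE.
Qed.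

Lemma series_polyE s N b : (series_poly s N)@_b = if (mdeg b < N)%N then s b else 0.
Proof.
rewrite /series_poly raddf_sum /=; case: ifP => hb.
  have hlt i : (b i < N)%N.
    by apply: leq_ltn_trans hb; rewrite mdegE (bigD1 i) //= leq_addr.
  pose B : {ffun 'I_n -> 'I_N} := [ffun i => Ordinal (hlt i)].
  have eB : (fun i => nat_of_ord (B i)) = b by apply/funext => i; rewrite ffunE.
  rewrite (bigD1 B) /=; last first.
    by rewrite [X in (X < _)%N](_ : _ = mdeg b) // mdegE; apply: eq_bigr => i _; rewrite ffunE.
  rewrite eB mcoeffZ mcoeffX mnm_of_val eqxx mulr1 big1 ?addr0 // => c /andP [_ ne].
  rewrite mcoeffZ mcoeffX; case: eqP => [e|_]; last by rewrite mulr0.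
  case/eqP: ne; apply/ffunP => i; apply: val_inj; rewrite ffunE /= -e.
  by rewrite mnmE.
rewrite big1 // => c hc; rewrite mcoeffZ mcoeffX; case: eqP => [e|_]; last by rewrite mulr0.
move: hb; rewrite -e mdegE [X in (X < _)%N](_ : _ = \sum_i c i)%N ?hc //.
by apply: eq_bigr => i _; rewrite mnmE.
Qed.

Lemma power_series_exists f : power_series_of m x f (fun b : 'I_n -> nat => coef (mnm_of b) f).
Proof.
move=> N; rewrite -(ev_series_poly (fun b : 'I_n -> nat => coef (mnm_of b) f)).
have := approx_coef f N.
suff -> : \sum_(b : 'X_{1..n < N}) (coef b f)%:A * mon b =
    ev (series_poly (fun b : 'I_n -> nat => coef (mnm_of b) f) N) by [].
pose q : mpol := \sum_(b : 'X_{1..n < N}) coef b f *: 'X_[b].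
have -> : series_poly (fun b : 'I_n -> nat => coef (mnm_of b) f) N = q.
  apply/mpolyP => b; rewrite series_polyE; case: ifP => hb.
    by rewrite /q (mcoeff_mpoly (fun b => coef b f)) // mnm_of_val.
  rewrite /q raddf_sum /= big1 // => c _; rewrite mcoeffZ mcoeffX.
  case: eqP => [e|_]; last by rewrite mulr0.
  by move: hb; rewrite -e bmdeg.
by rewrite ev_sum; apply: eq_bigr => b _; rewrite evZ evX.
Qed.

Lemma power_series_coef f s (b : 'I_n -> nat) : power_series_of m x f s -> s b = coef (mnm_of b) f.
Proof.
move=> /(_ (mdeg (mnm_of b)).+1); rewrite -ev_series_poly => /(coefE (ltnSn _)) ->.
rewrite series_polyE ltnSn; congr s; apply/funext => i; exact/esym/mnmE.
Qed.

Section Residue.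
Variable t : 'I_n -> R.

Definition expresses i (C : 'M[R]_n) := forall j, x j ^+ i = \sum_l C j l * t l.

Lemma is_residueE f (c : k) : is_residue m x t f c <->
  exists i C, [/\ ideal_pow m i.+1 `<=` gen_ideal (range t), expresses i.+1 C &
    c = theta i (\det C * f)].
Proof.
split.
  case=> i [C [s [[i0 hi] hC hs ->]]]; exists i.-1, C; rewrite prednK //; split=> //=.
  by rewrite (power_series_coef _ hs) /theta; congr coef; apply/mnmP => j; rewrite !mnmE.
case=> i [C [hi hC ->]]; exists i.+1, C, (fun b : 'I_n -> nat => coef (mnm_of b) (\det C * f)).
split=> //; first exact: power_series_exists.
Qed.

(** By Cramer's rule, det D times each t_l is a combination of the row sums, hence in the ideal I of
    the x_a^i with a other than j. As x_j^M is a combination of the t_l, x_j^M det D is in I, and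
    x_j is regular modulo I. *)
Lemma det_zero_row i j M (D : 'M[R]_n) : ideal_pow m M `<=` gen_ideal (range t) ->
  (forall a, a != j -> x a ^+ i = \sum_l D a l * t l) ->
  \sum_l D j l * t l = 0 -> xpow i (\det D).
Proof.
move=> hM hD hj.
pose I := span [set~ j] (fun a => x a ^+ i).
have hI : is_ideal I := span_is_ideal _ _.
suff : I (\det D) by apply: span_sub; rewrite finset.subsetT.
have hl l : I (\det D * t l).
  have /matrixP /(_ l) hadj := mul_adj_mx D.
  have -> : \det D * t l = \sum_a (\adj D) l a * \sum_l' D a l' * t l'.
    rewrite (eq_bigr (fun a => \sum_l' (\adj D) l a * D a l' * t l')); last first.
      by move=> a _; rewrite mulr_sumr; apply: eq_bigr => l' _; rewrite mulrA.
    rewrite exchange_big /= (eq_bigr (fun l' => (\det D *+ (l == l')) * t l')).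
      rewrite (bigD1 l) //= eqxx mulr1n big1 ?addr0 // => l' ne.
      by rewrite eq_sym (negbTE ne) mulr0n mul0r.
    by move=> l' _; rewrite -mulr_suml; have := hadj l'; rewrite !mxE => ->.
  apply: ideal_sum => // a _; have [->|ne] := eqVneq a j.
    by rewrite hj mulr0; exact: ideal0.
  rewrite -hD //; apply: idealMl => //; apply: (span_mem (fun a => x a ^+ i)).
  by rewrite !inE.
have [v ev] : exists v, x j ^+ M = \sum_l v l * t l.
  by apply/gen_range_is_sum/hM; apply: ideal_pow_exp; exact: regular_param_mem.
apply: (@nonzerodivisorX _ _ (x j) M).
  by apply: (span_nonzerodivisor noethR locR x_regular x_gen); rewrite !inE eqxx.
rewrite ev mulr_suml; apply: ideal_sum => // l _.
by rewrite -mulrA [t l * _]mulrC; apply: idealMl.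
Qed.

(** Rows are exchanged one at a time. Consecutive determinants differ by one whose changed row is
    the difference of two expressions of the same x_j^i, so that [det_zero_row] applies. *)
Lemma det_expresses_unique i M (C C' : 'M[R]_n) :
  ideal_pow m M `<=` gen_ideal (range t) -> expresses i C -> expresses i C' ->
  xpow i (\det C - \det C').
Proof.
move=> hM hC hC'.
pose H r : 'M[R]_n := \matrix_(a, l) if (a < r)%N then C a l else C' a l.
have hH r : expresses i (H r).
  move=> a; case: (ltnP a r) => h.
    by rewrite hC; apply: eq_bigr => l _; rewrite mxE h.
  by rewrite hC'; apply: eq_bigr => l _; rewrite mxE ltnNge h.
have hI := span_is_ideal [set: 'I_n] (fun j => x j ^+ i).
suff hr r : (r <= n)%N -> xpow i (\det (H r) - \det C').
  have -> : C = H n by apply/matrixP => a l; rewrite mxE ltn_ord.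
  exact: hr.
elim: r => [_|r IH hr].
  have -> : H 0%N = C' by apply/matrixP => a l; rewrite mxE.
  by rewrite subrr; exact: ideal0.
have -> : \det (H r.+1) - \det C' =
  (\det (H r.+1) - \det (H r)) + (\det (H r) - \det C') by ring.
apply: idealD => //; last by apply: IH; exact: ltnW.
pose j := Ordinal hr.
pose D : 'M[R]_n := \matrix_(a, l) if a == j then C j l - C' j l else H r a l.
have eH a l : a != j -> H r.+1 a l = H r a l.
  by move=> ne; rewrite !mxE ltnS leq_eqVlt -[(a == r :> nat)]/(a == j) (negbTE ne).
have hl (a : 'I_n.-1) : lift j a != j by rewrite eq_sym neq_lift.
have -> : \det (H r.+1) - \det (H r) = \det D.
  rewrite (@determinant_multilinear _ _ D (H r.+1) (H r) j 1 (-1)).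
  - by rewrite mul1r mulN1r.
  - by apply/rowP => l; rewrite !mxE eqxx /= ltnSn ltnn mul1r mulN1r.
  - by apply/matrixP => a l; rewrite [LHS]mxE [RHS]mxE (eH _ _ (hl a)) [D _ _]mxE (negbTE (hl a)).
  - by apply/matrixP => a l; rewrite [LHS]mxE [RHS]mxE [D _ _]mxE (negbTE (hl a)).
apply: (det_zero_row hM (j := j)).
  move=> a ne; rewrite (hH r a); apply: eq_bigr => l _.
  by rewrite [D _ _]mxE (negbTE ne).
rewrite (eq_bigr (fun l => C j l * t l - C' j l * t l)).
  by rewrite sumrB -hC -hC' subrr.
by move=> l _; rewrite mxE eqxx mulrBl.
Qed.

(** Multiplying row j by x_j, for every j, multiplies the determinant by x_1 ... x_n, which the
    shift of the coefficient read by [theta] undoes. *)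
Lemma expresses_raise i d C f : expresses i.+1 C -> exists C',
  expresses (i + d).+1 C' /\ theta (i + d) (\det C' * f) = theta i (\det C * f).
Proof.
move=> hC; elim: d => [|d [C' [hC' e]]]; first by exists C; rewrite addn0.
exists (diag_mx (\row_j x j) *m C'); split.
  move=> j; rewrite addnS exprS hC' mulr_sumr; apply: eq_bigr => l _.
  by rewrite mul_diag_mx !mxE mulrA.
rewrite det_mulmx det_diag -e addnS /theta -mulrA.
have -> : \prod_i0 (\row_j x j) 0 i0 = mon (top_mono 1).
  by apply: eq_bigr => j _; rewrite mxE top_monoE expr1.
have -> : top_mono (i + d).+1 = mnm_add (top_mono 1) (top_mono (i + d)).
  by apply/mnmP => j; rewrite mnmDE !top_monoE add1n.
by rewrite coef_monD.
Qed.

(** Two admissible choices are compared at the common exponent i1 + i2 + 1, so [xget] has only one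
    value to pick. *)
Lemma residueE i C f : ideal_pow m i.+1 `<=` gen_ideal (range t) ->
  expresses i.+1 C -> residue m x t f = theta i (\det C * f).
Proof.
move=> hi hC; apply: xget_subset1.
  by rewrite /=; apply/is_residueE; exists i, C.
move=> c c' /is_residueE [i1 [C1 [h1 hC1 ->]]] /is_residueE [i2 [C2 [h2 hC2 ->]]].
have [D1 [hD1 <-]] := expresses_raise i2 f hC1.
have [D2 [hD2 <-]] := expresses_raise i1 f hC2.
rewrite [(i2 + i1)%N]addnC in hD2 *.
have hu := det_expresses_unique h1 hD1 hD2.
apply/eqP; rewrite -subr_eq0 -[X in X == 0]/(theta _ _ - theta _ _).
rewrite /theta -raddfB /= -mulrBl -/(theta _ _) theta_span //.
by apply: idealMr => //; exact: span_is_ideal.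
Qed.

End Residue.

Section DualModule.
Variable M : nat.

(* The dual of R / m^M, a finitely generated module that receives the
   derivations to which the universal property is applied. *)
Record dual_mod := DualMod {
  dual_fun :> R -> k;
  dual_scalar : scalar dual_fun;
  dual_pow : forall a, ideal_pow m M a -> dual_fun a = 0 }.

HB.instance Definition _ := gen_eqMixin dual_mod.
HB.instance Definition _ := gen_choiceMixin dual_mod.

Lemma dual_ext (u v : dual_mod) : u =1 v -> u = v.
Proof.
case: u v => [u lu hu] [v lv hv] /= /funext e; case: _ / e in lv hv *.
by congr DualMod; exact: Prop_irrelevance.
Qed.

Lemma dual0 (u : dual_mod) : u 0 = 0.
Proof. by apply: dual_pow; exact: ideal0. Qed.

Lemma dualD (u : dual_mod) (a b : R) : u (a + b) = u a + u b.
Proof. by have := dual_scalar u 1 a b; rewrite scale1r mul1r. Qed.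

Lemma dualZ (u : dual_mod) (c : k) a : u (c%:A * a) = c * u a.
Proof. by have := dual_scalar u c a 0; rewrite !addr0 dual0 addr0 mulr_algl. Qed.

Fact dual_zero_scalar : scalar (fun _ : R => 0 : k).
Proof. by move=> a u v; rewrite mulr0 addr0. Qed.
Definition dual_zero := DualMod dual_zero_scalar (fun _ _ => erefl).

Fact dual_opp_scalar (u : dual_mod) : scalar (fun a => - u a).
Proof. by move=> c a b; rewrite dual_scalar opprD mulrN. Qed.
Fact dual_opp_pow (u : dual_mod) a : ideal_pow m M a -> - u a = 0.
Proof. by move/(dual_pow u) => ->; rewrite oppr0. Qed.
Definition dual_opp u := DualMod (dual_opp_scalar u) (@dual_opp_pow u).

Fact dual_add_scalar (u v : dual_mod) : scalar (fun a => u a + v a).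
Proof. by move=> c a b; rewrite !dual_scalar /= mulrDr addrACA. Qed.
Fact dual_add_pow (u v : dual_mod) a : ideal_pow m M a -> u a + v a = 0.
Proof. by move=> h; rewrite !dual_pow // addr0. Qed.
Definition dual_add u v := DualMod (dual_add_scalar u v) (@dual_add_pow u v).

Fact dual_addA : associative dual_add.
Proof. by move=> u v w; apply: dual_ext => a; rewrite /= addrA. Qed.
Fact dual_addC : commutative dual_add.
Proof. by move=> u v; apply: dual_ext => a; rewrite /= addrC. Qed.
Fact dual_add0 : left_id dual_zero dual_add.
Proof. by move=> u; apply: dual_ext => a; rewrite /= add0r. Qed.
Fact dual_addN : left_inverse dual_zero dual_opp dual_add.
Proof. by move=> u; apply: dual_ext => a; rewrite /= addNr. Qed.
HB.instance Definition _ :=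
  GRing.isZmodule.Build dual_mod dual_addA dual_addC dual_add0 dual_addN.

Fact dual_scale_scalar (r : R) (u : dual_mod) : scalar (fun a => u (r * a)).
Proof. by move=> c a b; rewrite mulrDr -scalerAr dual_scalar. Qed.
Fact dual_scale_pow (r : R) (u : dual_mod) a : ideal_pow m M a -> u (r * a) = 0.
Proof. by move=> h; apply: dual_pow; exact: idealMl. Qed.
Definition dual_scale r u := DualMod (dual_scale_scalar r u) (@dual_scale_pow r u).

Fact dual_scaleA r s u : dual_scale r (dual_scale s u) = dual_scale (r * s) u.
Proof. by apply: dual_ext => a; rewrite /= mulrCA mulrA. Qed.
Fact dual_scale1 : left_id 1 dual_scale.
Proof. by move=> u; apply: dual_ext => a; rewrite /= mul1r. Qed.
Fact dual_scaleDr : right_distributive dual_scale +%R.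
Proof. by move=> r u v; apply: dual_ext. Qed.
Fact dual_scaleDl u : {morph dual_scale^~ u : r s / r + s}.
Proof. by move=> r s; apply: dual_ext => a; rewrite /= mulrDl dualD. Qed.
HB.instance Definition _ := GRing.Zmodule_isLmodule.Build R dual_mod
  dual_scaleA dual_scale1 dual_scaleDr dual_scaleDl.

Lemma dual_sumE (T : Type) (r : seq T) (P : pred T) (F : T -> dual_mod) a :
  (\sum_(i <- r | P i) F i) a = \sum_(i <- r | P i) F i a.
Proof. by elim/big_ind2: _ => // u c v d <- <-. Qed.

(** By Taylor expansion modulo m^M, the coefficient functionals of degree below M span the dual
    already over k. *)
Lemma dual_mod_fg : finitely_generated dual_mod.
Proof.
have hc (b : 'X_{1..n < M}) a : ideal_pow m M a -> coef b a = 0.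
  by apply: coef_pow; exact: bmdeg.
pose G (b : 'X_{1..n < M}) : dual_mod := DualMod (coef_linear b) (@hc b).
exists #|{: 'X_{1..n < M}}|, (fun i => G (enum_val i)) => u.
exists (fun i => (u (mon (bmnm (enum_val i))))%:A); apply: dual_ext => a.
rewrite dual_sumE -(big_enum_val (fun b : 'X_{1..n < M} => ((u (mon (bmnm b)))%:A *: G b) a)) /=.
have := dual_pow u (approx_coef a M).
set S := \sum_(_ | _) _ => hS.
have -> : u a = u S by rewrite -[in LHS](subrK S a) dualD hS add0r.
rewrite /S; under [RHS]eq_bigr => b _ do rewrite mulr_algl linearZ /=.
elim/big_rec2: _ => [|b y1 y2 _ <-]; first exact: dual0.
by rewrite dualD dualZ mulrC.
Qed.

End DualModule.

Section Differentials.
Variables (Omega : lmodType R) (d : R -> Omega).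
Hypothesis d_univ : universally_finite d.

(* These are the derivations into [dual_mod M]. *)
Definition biderivation M (tau : R -> R -> k) :=
  [/\ forall f, scalar (tau^~ f), forall a, scalar (tau a),
      forall a f, ideal_pow m M a -> tau a f = 0 &
      forall a f g, tau a (f * g) = tau (a * f) g + tau (a * g) f].

(** Sending f to the functional [tau^~ f] is a derivation into the finitely generated [dual_mod M];
    [h] is the induced linear map, uncurried. *)
Lemma biderivation_extends M tau : biderivation M tau ->
  exists h : Omega -> R -> k,
    [/\ forall u v a, h (u + v) a = h u a + h v a,
        forall r u a, h (r *: u) a = h u (r * a) &
        forall f a, h (d f) a = tau a f].
Proof.
case=> t1 t2 t3 t4; pose D f : dual_mod M := DualMod (t1 f) (fun a => t3 a f).
have hD : is_derivation D.
  split=> [c f g|f g]; apply: dual_ext => a /=.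
    by rewrite t2 /=; congr (_ + _); apply/esym/(dualZ (D f)).
  by rewrite t4 mulrC [g * a]mulrC.
have [_ _ /(_ (dual_mod M) D (dual_mod_fg M) hD) [h [[hl hh] _]]] := d_univ.
exists (fun u a => h u a); split=> [u v a|r u a|f a].
- by have := hl 1 u v; rewrite !scale1r => ->.
- have h0 : h 0 = 0.
    have := hl 1 0 0; rewrite !scale1r addr0 => /eqP.
    by rewrite -subr_eq0 opprD addNKr oppr_eq0 => /eqP.
  by have := hl r u 0; rewrite !addr0 h0 addr0 => ->.
- by rewrite hh.
Qed.

Variable del : 'I_n -> R -> R.
Hypothesis del_partial : partial_derivatives d x del.

Lemma biderivation_partial M tau w : biderivation M tau ->
  forall a, tau a w = \sum_i tau (a * del i w) (x i).
Proof.
move=> /biderivation_extends [h [hD hZ hd]] a.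
have h0 (b : R) : h 0 b = 0.
  by apply: (@addrI _ (h 0 b)); rewrite -hD !addr0.
rewrite -hd del_partial.
elim/big_rec2: _ => [|i y u _ <-]; first exact: h0.
by rewrite hD hZ hd mulrC.
Qed.

Lemma ev_mderiv_pow j N p : ideal_pow m N.+1 (ev p) -> ideal_pow m N (ev (mderiv j p)).
Proof.
move=> hp; rewrite evE; apply: ideal_sum => // b _.
case: (ltnP (mdeg b) N) => hb; last first.
  by apply: idealMl => //; apply: (ideal_pow_le hb); exact: mon_pow.
rewrite mcoeff_deriv (ev_indep (N := N.+1) hp) ?mul0rn ?scale0r ?mul0r; first exact: ideal0.
by rewrite mdegD mdeg1 addn1.
Qed.

(** The formal j-th partial is taken on polynomial approximations. It is well defined only modulo
    m^M, which suffices once a single Taylor coefficient is read off; the resulting biderivation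
    extracts that coefficient of a_j. *)
Lemma differentials_free (a : 'I_n -> R) :
  \sum_i a i *: d (x i) = 0 -> forall j, a j = 0.
Proof.
move=> ha j; apply: coef_inj => c; pose M := (mdeg c).+1.
pose ap f := projT1 (cid (approx f M.+1)).
have hap f : ideal_pow m M.+1 (f - ev (ap f)) by rewrite /ap; case: cid.
pose D f := ev (mderiv j (ap f)).
have hD f p : ideal_pow m M.+1 (f - ev p) -> ideal_pow m M (D f - ev (mderiv j p)).
  move=> hp; rewrite /D -evB -mderivB; apply: ev_mderiv_pow; rewrite evB.
  have -> : ev (ap f) - ev p = (f - ev p) - (f - ev (ap f)) by ring.
  exact: idealB.
have hcM (u v b : R) : ideal_pow m M (u - v) -> coef c (b * u) = coef c (b * v).
  move=> h; apply/eqP; rewrite -subr_eq0 -coefB -mulrBr.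
  by rewrite (coef_pow (N := M)) //; exact: idealMl.
pose tau (b f : R) := coef c (b * D f).
have htau : biderivation M tau.
  split.
  - by move=> f e b b'; rewrite /tau mulrDl -scalerAl coef_linear.
  - move=> b e f g.
    have -> : tau b (e *: f + g) = coef c (b * (e%:A * D f + D g)).
      apply: hcM; rewrite /D -evZ -evD -mderivZ -mderivD; apply: hD.
      rewrite evD evZ -(mulr_algl e f).
      have -> : e%:A * f + g - (e%:A * ev (ap f) + ev (ap g)) =
        e%:A * (f - ev (ap f)) + (g - ev (ap g)) by ring.
      by apply: idealD => //; exact: idealMl.
    by rewrite mulrDr mulrCA mulr_algl coef_linear.
  - by move=> b f hb; rewrite /tau (coef_pow (N := M)) //; exact: idealMr.
  - move=> b f g.
    have -> : tau b (f * g) = coef c (b * (f * D g + g * D f)).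
      apply: hcM.
      have h1 : ideal_pow m M.+1 (f * g - ev (ap f * ap g)).
        have -> : f * g - ev (ap f * ap g) =
          f * (g - ev (ap g)) + (f - ev (ap f)) * ev (ap g) by rewrite evM; ring.
        by apply: idealD => //; [exact: idealMl | exact: idealMr].
      have := hD _ _ h1; rewrite mderivM evD !evM -!/(D _).
      set E := D (f * g) => h2.
      have -> : E - (f * D g + g * D f) = (E - (D f * ev (ap g) + ev (ap f) * D g))
        - ((g - ev (ap g)) * D f + (f - ev (ap f)) * D g) by ring.
      apply: idealB => //; apply: idealD => //; apply: idealMr => //;
        by apply: (ideal_pow_le (leqnSn M)).
    by rewrite /tau mulrDr !mulrA coefD.
have [h [hA hZ hd]] := biderivation_extends htau.
have h0 (b : R) : h 0 b = 0 by apply: (@addrI _ (h 0 b)); rewrite -hA !addr0.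
have : \sum_i tau (a i) (x i) = 0.
  have e : h (\sum_i a i *: d (x i)) 1 = \sum_i tau (a i) (x i).
    elim/big_rec2: _ => [|i y u _ <-]; first exact: h0.
    by rewrite hA hZ hd mulr1.
  by rewrite -e ha.
have hx i : tau (a i) (x i) = coef c (a i * (i == j)%:R).
  have -> : (i == j)%:R = ev (mderiv j 'X_i).
    rewrite mderivX evZ evX mnm1E; case: eqP => [->|_].
      rewrite scale1r mul1r /mon big1 // => l _.
      by rewrite mnmBE subnn expr0.
    by rewrite scale0r mul0r.
  by apply: hcM; apply: hD; rewrite evX mon1 subrr; exact: ideal0.
rewrite (bigD1 j) //= big1 ?addr0 => [|i ne]; rewrite hx.
  by rewrite eqxx mulr1.
by rewrite (negbTE ne) mulr0 (raddf0 (coef c)).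
Qed.

Lemma del_unique (a b : 'I_n -> R) :
  \sum_i a i *: d (x i) = \sum_i b i *: d (x i) -> a =1 b.
Proof.
move=> h i; apply/eqP; rewrite -subr_eq0; apply/eqP.
apply: (@differentials_free (fun i => a i - b i)).
under eq_bigr => l _ do rewrite scalerBl.
by rewrite sumrB h subrr.
Qed.

(** [partial_derivatives] only names coefficients; their linearity and Leibniz rule follow from
    those of [d] by freeness of the d x_i. *)
Lemma del_linear i (c : k) f g : del i (c *: f + g) = c *: del i f + del i g.
Proof.
move: i; apply: del_unique; rewrite -del_partial.
have [_ [hl _] _] := d_univ; rewrite hl !del_partial scaler_sumr -big_split /=.
by apply: eq_bigr => i _; rewrite scalerDl scalerA mulr_algl.
Qed.

Lemma del_mul i f g : del i (f * g) = f * del i g + g * del i f.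
Proof.
move: i; apply: del_unique; rewrite -del_partial.
have [_ [_ hm] _] := d_univ; rewrite hm !del_partial !scaler_sumr -big_split /=.
by apply: eq_bigr => i _; rewrite scalerDl !scalerA.
Qed.

End Differentials.

End Coefficients.

(** * Krull's principal ideal theorem and height theorem *)

Section KrullHeight.
Variable A : comNzRingType.
Hypothesis noethA : noetherian A.
Implicit Types (I K p q : set A).

(** For a prime [q], saturated ideals correspond to ideals of the localization at [q] and stand in
    for them throughout. *)
Definition saturated q I := forall s a, ~ q s -> I (s * a) -> I a.

Definition saturation q I : set A := [set a | exists s, ~ q s /\ I (s * a)].

Definition minimal_over q I := forall p, is_prime p -> I `<=` p -> p `<=` q -> q `<=` p.

Lemma prime_not_mul q a b : is_prime q -> ~ q a -> ~ q b -> ~ q (a * b).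
Proof. by move=> [_ _ hq] ha hb /hq []. Qed.

Lemma saturation_is_ideal q I : is_prime q -> is_ideal I -> is_ideal (saturation q I).
Proof.
move=> hq hI; have [_ q1 _] := hq; split.
  by exists 1; split=> //; rewrite mulr0; exact: ideal0.
move=> c u v [s [hs hu]] [t [ht hv]]; exists (s * t); split; first exact: prime_not_mul.
have -> : s * t * (c * u + v) = (t * c) * (s * u) + s * (t * v) by ring.
by apply: idealD => //; apply: idealMl.
Qed.

Lemma saturation_saturated q I : is_prime q -> saturated q (saturation q I).
Proof.
move=> hq s a hs [t [ht h]]; exists (t * s); split; first exact: prime_not_mul.
by rewrite -mulrA.
Qed.

Lemma saturation_sub q I : is_prime q -> I `<=` saturation q I.
Proof. by move=> [_ q1 _] u hu; exists 1; rewrite mul1r. Qed.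

Lemma saturation_min q I K : saturated q K -> I `<=` K -> saturation q I `<=` K.
Proof. by move=> hK h u [s [hs /h]]; apply: hK. Qed.

Lemma prime_saturated q p : is_prime p -> p `<=` q -> saturated q p.
Proof. by move=> [_ _ hp] h s a hs /hp [/h|]. Qed.

(** An ideal maximal among those over I avoiding all s c^N with s outside q is prime and contained
    in q; minimality would put c in it. Locally: the maximal ideal at q is nil modulo I. *)
Lemma minimal_over_power q I c : is_prime q -> is_ideal I -> I `<=` q ->
  minimal_over q I -> q c -> exists s N, ~ q s /\ I (s * c ^+ N).
Proof.
move=> hq hI hIq hmin hc; apply: contrapT => hno.
have [qi q1 qp] := hq.
pose P (K : set A) := I `<=` K /\ forall s N, ~ q s -> ~ K (s * c ^+ N).
have hPI : P I by split=> // s N hs h; apply: hno; exists s, N.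
have [K [hK [hIK hKP] hmax]] := @noetherian_maximal A P noethA (ex_intro _ I (conj hI hPI)).
have grow a : ~ K a -> exists s N, ~ q s /\ adjoin K a (s * c ^+ N).
  move=> ha; apply: contrapT => hn; apply: ha.
  apply: (hmax (adjoin K a)); [exact: adjoin_is_ideal | | exact: adjoin_sub | exact: adjoin_mem].
  split; first by move=> u /hIK; exact: adjoin_sub.
  by move=> s N hs h; apply: hn; exists s, N.
have hKprime : is_prime K.
  split=> // [h1|a b hab].
    by apply: (hKP 1 0%N q1); rewrite expr0 mulr1.
  apply: contrapT => /not_orP [/grow [s [N [hs [u [r [hu e]]]]]] /grow [t [M [ht [v [r' [hv e']]]]]]].
  apply: (hKP (s * t) (N + M)%N); first exact: prime_not_mul.
  have -> : s * t * c ^+ (N + M) = (s * c ^+ N) * (t * c ^+ M) by rewrite exprD; ring.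
  rewrite e e'.
  have -> : (u + r * a) * (v + r' * b) = (v + r' * b) * u + r * a * v + r * r' * (a * b) by ring.
  by apply: idealD => //; [apply: idealD => // |]; apply: idealMl.
have hKq : K `<=` q.
  move=> a ha; apply: contrapT => hn; apply: (hKP a 0%N hn).
  by rewrite expr0 mulr1.
apply: (hKP 1 1%N q1); rewrite mul1r expr1; exact: (hmin K).
Qed.

(* Noetherian induction on [K]: if [a * b] lies in [K] but [a] and [b] do not,
   a chain above [K] is controlled by the chains [I N + (a)] and [I N : a]. *)
Lemma saturated_chain_stabilizes q J : is_prime q -> is_ideal J -> minimal_over q J ->
  forall I : nat -> set A,
    (forall N, is_ideal (I N) /\ saturated q (I N)) ->
    (forall N, I N.+1 `<=` I N) -> (forall N, J `<=` I N) ->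
    exists N, forall M, (N <= M)%N -> I N `<=` I M.
Proof.
move=> hq hJ hmin; have [qi q1 qp] := hq.
pose chain K (I : nat -> set A) := [/\ forall N, is_ideal (I N) /\ saturated q (I N),
  forall N, I N.+1 `<=` I N & forall N, K `<=` I N].
pose stable (I : nat -> set A) := exists N, forall M, (N <= M)%N -> I N `<=` I M.
have mono (I : nat -> set A) : (forall N, I N.+1 `<=` I N) -> forall N M, (N <= M)%N -> I M `<=` I N.
  move=> h N M; elim: M => [|M IH]; first by rewrite leqn0 => /eqP ->.
  by rewrite leq_eqVlt => /orP [/eqP -> //|]; rewrite ltnS => /IH h' u /h /h'.
suff key : forall I : nat -> set A, chain J I -> stable I.
  by move=> I h1 h2 h3; apply: key.
move=> I0 hI0; apply: contrapT => bad0.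
pose P (K : set A) := [/\ saturated q K, J `<=` K & exists I : nat -> set A, chain K I /\ ~ stable I].
have satJ : saturation q J `<=` saturation q J by [].
have hP0 : P (saturation q J).
  split; [exact: saturation_saturated | exact: saturation_sub |].
  exists I0; split=> //; have [h1 h2 h3] := hI0; split=> // N.
  by apply: saturation_min => //; case: (h1 N).
have [K [hK [satK hJK [I [[hI Idec KI] bad]]] hmax]] := @noetherian_maximal A P noethA
  (ex_intro _ _ (conj (saturation_is_ideal hq hJ) hP0)).
have good K' (I' : nat -> set A) : is_ideal K' -> saturated q K' -> K `<=` K' ->
    ~ K' `<=` K -> chain K' I' -> stable I'.
  move=> hK' sK' hsub hns hc; apply: contrapT => hb; apply: hns.
  apply: hmax => //; split=> //; first by move=> u /hJK /hsub.
  by exists I'.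
have K1 : ~ K 1.
  move=> h1; apply: bad; exists 0%N => M _ u _.
  by rewrite -[u]mulr1; apply: idealMl; [case: (hI M) | exact: KI].
have Kq : K `<=` q.
  move=> a ha; apply: contrapT => hn; apply: K1; apply: (satK a) => //.
  by rewrite mulr1.
(* If [K] is prime it equals q by minimality. A saturated ideal is contained in q or is the whole
   ring, so a chain above q takes at most two values. *)
case: (pselect (is_prime K)) => [hKp|nKp].
  have qK := hmin _ hKp hJK Kq.
  case: (pselect (exists N, ~ I N 1)) => [[N hN]|hno].
    apply: bad; exists N => M hNM u hu; apply: KI; apply: qK.
    apply: contrapT => hn; apply: hN; apply: (hI N).2 hn _.
    by rewrite mulr1.
  apply: bad; exists 0%N => M _ u _; rewrite -[u]mulr1.
  apply: idealMl; first by case: (hI M).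
  by apply: contrapT => h; apply: hno; exists M.
have [a [b [na nb hab]]] : exists a b, [/\ ~ K a, ~ K b & K (a * b)].
  apply: contrapT => hno; apply: nKp; split=> // a b hab.
  by apply: contrapT => /not_orP [ha hb]; apply: hno; exists a, b.
have Ii N := (hI N).1.
have [N1 hN1] : stable (fun N => saturation q (adjoin (I N) a)).
  apply: (good (saturation q (adjoin K a))).
  - by apply: saturation_is_ideal => //; exact: adjoin_is_ideal.
  - exact: saturation_saturated.
  - by move=> u hu; apply: saturation_sub => //; exact: adjoin_sub.
  - move=> h; apply: na; apply: h; apply: saturation_sub => //; exact: adjoin_mem.
  have hsub I1 I2 : is_ideal I2 -> I1 `<=` I2 ->
      saturation q (adjoin I1 a) `<=` saturation q (adjoin I2 a).
    move=> h2 h u [s [hs [i [r [hi e]]]]]; exists s; split=> //.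
    by exists i, r; split=> //; apply: h.
  split=> [N|N|N]; [split | |].
  + by apply: saturation_is_ideal => //; exact: adjoin_is_ideal.
  + exact: saturation_saturated.
  + exact: hsub.
  + exact: hsub.
have [N2 hN2] : stable (fun N => [set r | I N (r * a)]).
  have col L : is_ideal L -> saturated q L ->
      is_ideal [set r | L (r * a)] /\ saturated q [set r | L (r * a)].
    move=> hL sL; split; first split=> /=.
    - by rewrite mul0r; exact: ideal0.
    - by move=> c u v hu hv; rewrite mulrDl -mulrA; case: hL => _; apply.
    - by move=> s r hs /=; rewrite -mulrA; apply: sL.
  have [c1 c2] := col _ hK satK.
  apply: (good [set r | K (r * a)]) => //.
  - by move=> u hu /=; apply: idealMr.
  - by move=> h; apply: nb; apply: h; rewrite /= mulrC.
  split=> [N|N u|N u]; first by apply: col; case: (hI N).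
  + exact: Idec.
  + exact: KI.
(* Modular law: s v = i + r a with i in I_M, so r a is in I_N2, hence in I_M because the colons by a
   agree; saturation then removes s. *)
apply: bad; exists (maxn N1 N2) => M hM v hv.
have hMN1 := leq_trans (leq_maxl _ _) hM; have hMN2 := leq_trans (leq_maxr _ _) hM.
have h1 : saturation q (adjoin (I M) a) v.
  apply: (hN1 M hMN1); apply: saturation_sub => //; apply: adjoin_sub.
  exact: (mono I Idec _ _ (leq_maxl N1 N2)).
have [s [hs [i [r [hi e]]]]] := h1.
have hra : I N2 (r * a).
  have -> : r * a = s * v - i by rewrite e; ring.
  apply: idealB => //; first by apply: idealMl => //; exact: (mono I Idec _ _ (leq_maxr N1 N2)).
  exact: (mono I Idec _ _ hMN2).
apply: (hI M).2 hs _; rewrite e; apply: idealD => //; exact: (hN2 M hMN2).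
Qed.

(** Let S_N be the p1-saturation of p0 + (u^N) for a u in p1 outside p0; it plays the part of a
    symbolic power. The chain S_N + (y) stabilises, and Nakayama gives S_N = S_(N+1). Then u^N (s -
    r u) is in p0 with s outside p1, which forces u in p0 or s in p1. *)
Theorem principal_ideal_theorem p0 p1 q y : is_prime p0 -> is_prime p1 -> is_prime q ->
  p0 `<=` p1 -> ~ p1 `<=` p0 -> p1 `<=` q -> ~ q `<=` p1 -> q y ->
  ~ minimal_over q (adjoin p0 y).
Proof.
move=> hp0 hp1 hq h01 n10 h1q nq1 qy hmin.
have [q_i q1 _] := hq; have [p0_i _ p0p] := hp0; have [p1_i p11 p1p] := hp1.
have ny : ~ p1 y.
  move=> hy; apply: nq1; apply: hmin => //; exact: adjoin_min.
have [u [hu1 hu0]] : exists u, p1 u /\ ~ p0 u.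
  by apply: contrapT => hno; apply: n10 => u hu; apply: contrapT => h; apply: hno; exists u.
pose S N := saturation p1 (adjoin p0 (u ^+ N)).
have Si N : is_ideal (S N) by apply: saturation_is_ideal => //; exact: adjoin_is_ideal.
have Ssat N : saturated q (S N).
  move=> s a hs; apply: saturation_saturated => //; by move/h1q.
have Sdec N : S N.+1 `<=` S N.
  move=> a [s [hs [b [r [hb e]]]]]; exists s; split=> //; exists b, (r * u); split=> //.
  by rewrite e exprS; ring.
have Sp0 N : p0 `<=` S N by move=> a ha; apply: saturation_sub => //; exact: adjoin_sub.
pose I N := saturation q (adjoin (S N) y).
have hJ : is_ideal (adjoin p0 y) := adjoin_is_ideal y p0_i.
have [|||N hN] := @saturated_chain_stabilizes q (adjoin p0 y) hq hJ hmin I.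
- move=> N; split; last exact: saturation_saturated.
  by apply: saturation_is_ideal => //; exact: adjoin_is_ideal.
- move=> N a [s [hs [b [r [hb e]]]]]; exists s; split=> //; exists b, r; split=> //; exact: Sdec.
- move=> N a [b [r [hb ->]]]; apply: saturation_sub => //; exists b, r; split=> //; exact: Sp0.
(* In s a = b + r y the product y r lies in S_N, which is saturated at p1, and y is outside p1. So r
   itself is in S_N, as Nakayama requires. *)
have step a : S N a -> exists s b r, [/\ ~ q s, S N.+1 b, S N r & s * a = b + r * y].
  move=> ha; have [s [hs [b [r [hb e]]]]] : I N.+1 a.
    by apply: (hN N.+1 (leqnSn N)); apply: saturation_sub => //; exact: adjoin_sub.
  exists s, b, r; split=> //.
  apply: (saturation_saturated hp1 (s := y)) => //.
  have -> : y * r = s * a - b by rewrite e; ring.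
  by apply: (idealB (Si N)); [exact: (idealMl (Si N)) | exact: Sdec].
(* Nakayama: a maximal counterexample absorbs any missing element. *)
have SNN : S N `<=` S N.+1.
  apply: contrapT => nS.
  pose P (K : set A) := [/\ saturated q K, S N.+1 `<=` K & ~ S N `<=` K].
  have hP : P (S N.+1) by split; [exact: Ssat | move=> v | exact: nS].
  have [K [hK [satK hSK nK] hmax]] := @noetherian_maximal A P noethA
    (ex_intro _ _ (conj (Si N.+1) hP)).
  have [g [hg ng]] : exists g, S N g /\ ~ K g.
    by apply: contrapT => hno; apply: nK => g hg; apply: contrapT => h; apply: hno; exists g.
  have hall : S N `<=` saturation q (adjoin K g).
    apply: contrapT => hn; apply: ng.
    apply: (hmax (saturation q (adjoin K g))).
    - by apply: saturation_is_ideal => //; exact: adjoin_is_ideal.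
    - split=> //; first exact: saturation_saturated.
      by move=> a /hSK ha; apply: saturation_sub => //; exact: adjoin_sub.
    - by move=> a ha; apply: saturation_sub => //; exact: adjoin_sub.
    - by apply: saturation_sub => //; exact: adjoin_mem.
  have [s [b [r [hs hb hr e]]]] := step g hg.
  have [t [ht [c [r' [hc e']]]]] := hall r hr.
  apply: ng; apply: (satK (t * s - r' * y)).
    move=> h; apply: (prime_not_mul hq ht hs).
    have -> : t * s = (t * s - r' * y) + r' * y by ring.
    by apply: idealD => //; exact: idealMl.
  have -> : (t * s - r' * y) * g = t * b + y * c.
    have -> : (t * s - r' * y) * g = t * (s * g) - y * (r' * g) by ring.
    have -> : r' * g = t * r - c by rewrite e'; ring.
    by rewrite e; ring.
  by apply: idealD => //; apply: idealMl => //; exact: hSK.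
have [s [hs [b [r [hb e]]]]] : S N.+1 (u ^+ N).
  by apply: SNN; apply: saturation_sub => //; exact: adjoin_mem.
have hz : p0 (u ^+ N * (s - r * u)).
  have -> : u ^+ N * (s - r * u) = b by rewrite mulrBr mulrC e exprS; ring.
  by [].
case: (p0p _ _ hz) => [/(prime_exp hp0) //|/h01 h].
apply: hs; have -> : s = (s - r * u) + r * u by ring.
by apply: idealD => //; exact: idealMl.
Qed.

(** Induction on the number of generators. Take a prime p strictly below q, maximal among those over
    the last member but one of the chain, and a generator y outside p. Since q is minimal over p +
    (y), a power of each other generator, times a factor outside q, is a multiple of y modulo p. The
    differences lie in p, which is minimal over them by the principal ideal theorem, and p ends the
    shortened chain. *)
Theorem krull_height (s : seq A) q (c : nat -> set A) l : is_prime q -> (forall a, a \in s -> q a) ->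
  minimal_over q (foldl (@adjoin A) [set 0] s) ->
  (forall i, (i <= l)%N -> is_prime (c i)) -> (forall i, (i < l)%N -> c i `<` c i.+1) ->
  c l `<=` q -> (l <= size s)%N.
Proof.
have z_i := set0_is_ideal A.
have sub_mem p (s' : seq A) : is_prime p -> (forall a, a \in s' -> p a) ->
    foldl (@adjoin A) [set 0] s' `<=` p.
  by case=> hp _ _ hs'; apply: foldl_adjoin_min => // _ ->; exact: ideal0.
have [d] := ubnP (size s); elim: d => // d IH in s q c l *.
rewrite ltnS => hd hq hs hmin hc hlt hcl.
case: l => // l in hc hlt hcl *.
have [q_i q1 qp] := hq.
have hcl' : c l `<=` q by move=> u hu; apply: hcl; apply: (hlt l (ltnSn l)).1.
have hclp : is_prime (c l) by apply: hc.
pose P (K : set A) := [/\ is_prime K, c l `<=` K, K `<=` q & ~ q `<=` K].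
have hPc : P (c l).
  split=> // h; apply: (hlt l (ltnSn l)).2 => u /hcl; exact: h.
have [p [hp [hpp hcp hpq nqp] hmax]] := @noetherian_maximal A P noethA
  (ex_intro _ _ (conj (let: And3 x _ _ := hclp in x) hPc)).
have [y [hy ny]] : exists y, y \in s /\ ~ p y.
  apply: contrapT => hno; apply: nqp; apply: hmin => //; apply: sub_mem => // a ha.
  by apply: contrapT => h; apply: hno; exists a.
have [_ p1 _] := hpp.
have hminp : minimal_over q (adjoin p y).
  move=> K hK hpK hKq; apply: contrapT => nqK.
  apply: ny; apply: (hmax K); first by case: hK.
  - split=> // u /hcp hu; apply: hpK; exact: adjoin_sub.
  - by move=> u hu; apply: hpK; exact: adjoin_sub.
  - by apply: hpK; exact: adjoin_mem.
have qy : q y by apply: hs.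
have /choice [f hf] : forall a, exists f : A * nat * A, a \in s ->
    ~ q f.1.1 /\ p (f.1.1 * a ^+ f.1.2 - f.2 * y).
  move=> a; case: (boolP (a \in s)) => ha; last by exists (0, 0%N, 0).
  have [|t [N [ht [b [r [hb e]]]]]] := @minimal_over_power q (adjoin p y) a hq
    (adjoin_is_ideal y hp) _ hminp (hs _ ha); first exact: adjoin_min.
  by exists (t, N, r); split=> //=; rewrite e addrK.
pose s' := [seq (f a).1.1 * a ^+ (f a).1.2 - (f a).2 * y | a <- rem y s].
have hs' : forall a, a \in s' -> p a.
  by move=> _ /mapP [a /mem_rem ha ->]; case: (hf a ha).
have hsz : size s = (size s').+1.
  by rewrite size_map size_rem // prednK //; case: (s) hy.
have hminp' : minimal_over p (foldl (@adjoin A) [set 0] s').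
  move=> p' hp' hsub hp'p; apply: contrapT => npp'.
  apply: (principal_ideal_theorem hp' hpp hq hp'p npp' hpq nqp qy).
  move=> K hK hKsub hKq; apply: hmin => //; apply: sub_mem => // a ha.
  have [K_i K1 Kp] := hK.
  have Ky : K y by apply: hKsub; apply: adjoin_mem; case: hp'.
  have [->|ne] := eqVneq a y; first by [].
  have har : a \in rem y s.
    have : a \in y :: rem y s by rewrite -(perm_mem (perm_to_rem hy)).
    by rewrite inE (negbTE ne).
  have hpa : K ((f a).1.1 * a ^+ (f a).1.2 - (f a).2 * y).
    apply: hKsub; apply: adjoin_sub; apply: hsub; apply: foldl_adjoin_mem => //.
    by apply/mapP; exists a.
  have [hfa _] := hf a ha.
  have : K ((f a).1.1 * a ^+ (f a).1.2).
    have -> : (f a).1.1 * a ^+ (f a).1.2 =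
      ((f a).1.1 * a ^+ (f a).1.2 - (f a).2 * y) + (f a).2 * y by ring.
    by apply: idealD => //; exact: idealMl.
  by case/Kp => [/hKq //|/(prime_exp hK)].
rewrite hsz ltnS.
pose c' i := if i == l then p else c i.
apply: (IH s' p c') => //.
- by rewrite -ltnS -hsz.
- by move=> i hi; rewrite /c'; case: eqP => // _; apply: hc; exact: leqW.
- move=> i hi; rewrite /c' (ltn_eqF hi); case: eqP => [e|_]; last by apply: hlt; exact: leqW.
  have [h1 h2] := hlt i (leqW hi); rewrite e in h1 h2; split.
    by move=> u /h1 /hcp.
  by move=> h; apply: h2 => u /hcp /h.
- by rewrite /c' eqxx.
Qed.

End KrullHeight.

Lemma scalar_mulA (k : fieldType) (R : comAlgType k) (a c : k) (u : R) :
  a%:A * (c%:A * u) = (a * c)%:A * u.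
Proof. by rewrite mulrA -scalerAl mul1r scalerA. Qed.

(** * Traces over k[z]/(z^N) along a prime of dimension one *)

Section OneDimensionalPrime.
Variables (k : fieldType) (R : comAlgType k) (m : set R) (n : nat).
Variable x : 'I_n -> R.
Hypotheses (noethR : noetherian R) (locR : local_ring m) (augR : augmented m).
Hypotheses (x_regular : regular_sequence x) (x_gen : m = gen_ideal (range x)).
Hypothesis char0 : [pchar k] =i pred0.
Variables (Omega : lmodType R) (d : R -> Omega).
Hypothesis d_univ : universally_finite d.
Variable del : 'I_n -> R -> R.
Hypothesis del_partial : partial_derivatives d x del.
Variable q : set R.
Hypothesis q_prime : is_prime q.
Hypothesis q_dim1 : forall a, ~ q a -> exists N, ideal_pow m N `<=` adjoin q a.
Variable z : R.
Hypotheses (mz : m z) (nqz : ~ q z).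

Let q_ideal : is_ideal q. Proof. by case: q_prime. Qed.

Let q_cancel a : q (a * z) -> q a.
Proof. by case: q_prime => _ _ h /h []. Qed.

Let N0 : nat := projT1 (cid (q_dim1 nqz)).
Let N0P : ideal_pow m N0 `<=` adjoin q z := projT2 (cid (q_dim1 nqz)).
Local Notation I := 'X_{1..n < N0}.
Let b (i : I) : R := mon x (bmnm i).

Let spanning (T : {set I}) : bool :=
  `[< forall f, exists c : I -> k, adjoin q z (f - \sum_(i in T) (c i)%:A * b i) >].

Let spanning_setT : exists T, spanning T.
Proof.
exists [set: I]%SET; apply/asboolP => f.
exists (fun i => coef augR x_gen (bmnm i) f); apply: N0P.
have := approx_coef noethR locR augR x_regular x_gen f N0.
by rewrite [X in _ -> _ (_ - X)](eq_bigl xpredT) // => i; rewrite inE.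
Qed.

(* The monomials in [T] lift a k-basis of R / (q + (z)). *)
Let T : {set I} := projT1 (cid (let: exist A h := ex_minset spanning_setT in
  ex_intro (fun A => minset spanning A) A h)).

Let T_min : minset spanning T.
Proof. by rewrite /T; case: cid. Qed.

Let K_ideal : is_ideal (adjoin q z) := adjoin_is_ideal z q_ideal.

Let T_span f : exists c : I -> k, adjoin q z (f - \sum_(i in T) (c i)%:A * b i).
Proof. by have /minsetP [/asboolP] := T_min. Qed.

Let T_indep (c : I -> k) : adjoin q z (\sum_(i in T) (c i)%:A * b i) ->
  forall i, i \in T -> c i = 0.
Proof.
move=> hc i0 hi0; apply/eqP/negPn/negP => c0.
have /minsetP [_ hmin] := T_min.
suff : T :\ i0 = T by move/setP/(_ i0); rewrite !inE eqxx hi0.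
apply: hmin; last exact: subsetDl.
apply/asboolP => f; have [a ha] := T_span f.
pose e := a i0 / c i0.
exists (fun i => a i - e * c i).
have -> : f - \sum_(i in T :\ i0) (a i - e * c i)%:A * b i =
  (f - \sum_(i in T) (a i)%:A * b i) + e%:A * (\sum_(i in T) (c i)%:A * b i).
  under eq_bigr => i _ do rewrite scalerBl mulrBl -scalar_mulA.
  rewrite sumrB -mulr_sumr !(big_setD1 i0 hi0) /= mulrDr scalar_mulA divfK //; ring.
by apply: idealD => //; apply: idealMl.
Qed.

Let T_gt0 : (0 < #|T|)%N.
Proof.
rewrite lt0n; apply/negP => /eqP/cards0_eq T0.
have [c] := T_span 1; rewrite T0 big_set0 subr0 => h.
apply: (max_not1 locR); apply: (adjoin_min _ _ mz h).
  exact: max_is_ideal.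
by apply: locR.2; apply/proper_idealPE; case: q_prime.
Qed.

Let digits f : exists cr : (I -> k) * R,
  q (f - \sum_(i in T) (cr.1 i)%:A * b i - cr.2 * z).
Proof.
have [c [a [r [ha e]]]] := T_span f; exists (c, r) => /=.
by rewrite e addrK.
Qed.

(** Arbitrary choices: on [T] the digits [cc f] are determined, but [nx f] only modulo q, so [nx] is
    linear only modulo q. *)
Let cc f : I -> k := (projT1 (cid (digits f))).1.
Let nx f : R := (projT1 (cid (digits f))).2.

Let digitsP f : q (f - \sum_(i in T) (cc f i)%:A * b i - nx f * z).
Proof. by rewrite /cc /nx; case: cid. Qed.

Let digits_unique (c : I -> k) r : q (\sum_(i in T) (c i)%:A * b i + r * z) ->
  (forall i, i \in T -> c i = 0) /\ q r.
Proof.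
move=> h; have hc : forall i, i \in T -> c i = 0.
  apply: T_indep; exists (\sum_(i in T) (c i)%:A * b i + r * z), (- r); split=> //.
  by ring.
split=> //; apply: q_cancel; move: h; rewrite big1 ?add0r // => i hi.
by rewrite hc // scale0r mul0r.
Qed.

Let digits_eq f (c : I -> k) r : q (f - \sum_(i in T) (c i)%:A * b i - r * z) ->
  (forall i, i \in T -> cc f i = c i) /\ q (nx f - r).
Proof.
move=> h; have [|h1 h2] := @digits_unique (fun i => cc f i - c i) (nx f - r).
  have -> : \sum_(i in T) (cc f i - c i)%:A * b i + (nx f - r) * z =
    (f - \sum_(i in T) (c i)%:A * b i - r * z) -
    (f - \sum_(i in T) (cc f i)%:A * b i - nx f * z).
    under eq_bigr => i _ do rewrite scalerBl mulrBl.
    by rewrite sumrB; ring.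
  by apply: idealB.
by split=> // i hi; apply/eqP; rewrite -subr_eq0 h1.
Qed.

Let digits_linear (c : k) f g :
  (forall i, i \in T -> cc (c%:A * f + g) i = c * cc f i + cc g i) /\
  q (nx (c%:A * f + g) - (c%:A * nx f + nx g)).
Proof.
apply: digits_eq.
have -> : c%:A * f + g - \sum_(i in T) (c * cc f i + cc g i)%:A * b i -
    (c%:A * nx f + nx g) * z =
    c%:A * (f - \sum_(i in T) (cc f i)%:A * b i - nx f * z) +
    (g - \sum_(i in T) (cc g i)%:A * b i - nx g * z).
  under eq_bigr => i _ do rewrite scalerDl mulrDl -scalar_mulA.
  by rewrite big_split /= -mulr_sumr; ring.
by apply: idealD => //; apply: idealMl.
Qed.

Let digits_cong f g : q (f - g) ->
  (forall i, i \in T -> cc f i = cc g i) /\ q (nx f - nx g).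
Proof.
move=> h; apply: digits_eq.
have -> : f - \sum_(i in T) (cc g i)%:A * b i - nx g * z =
  (f - g) + (g - \sum_(i in T) (cc g i)%:A * b i - nx g * z) by ring.
exact: idealD.
Qed.

Let digits_shift f : (forall i, i \in T -> cc (z * f) i = 0) /\ q (nx (z * f) - f).
Proof.
apply: digits_eq; rewrite big1 => [|i _]; last by rewrite scale0r mul0r.
by rewrite subr0 mulrC subrr; exact: ideal0.
Qed.

Let digits_basis j : j \in T ->
  (forall i, i \in T -> cc (b j) i = (i == j)%:R) /\ q (nx (b j)).
Proof.
move=> hj; rewrite -[X in q X]subr0; apply: digits_eq.
rewrite (bigD1 j) //= eqxx scale1r mul1r big1 => [|i /andP [_ /negbTE ->]].
  by rewrite addr0 mul0r subrr subr0; exact: ideal0.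
by rewrite scale0r mul0r.
Qed.

(** Repeated division by z: [co l f i] below is the coefficient of z^l b_i in the z-adic expansion
    of f modulo q. *)
Let nxi l f := iter l nx f.
Let co l f i := cc (nxi l f) i.

Let nxi_cong l f g : q (f - g) -> q (nxi l f - nxi l g).
Proof. by move=> h; elim: l => //= l IH; case: (digits_cong IH). Qed.

Let nxi_linear l (c : k) f g : q (nxi l (c%:A * f + g) - (c%:A * nxi l f + nxi l g)).
Proof.
elim: l => [|l IH] /=; first by rewrite subrr; exact: ideal0.
have [_ h1] := digits_cong IH; have [_ h2] := digits_linear c (nxi l f) (nxi l g).
by have := idealD q_ideal h1 h2; rewrite addrA subrK.
Qed.

Let nxi_q l f : q f -> q (nxi l f).
Proof.
move=> hf; elim: l => //= l IH; have [|_ h] := @digits_eq (nxi l f) (fun=> 0) 0.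
  rewrite big1 => [|i _]; last by rewrite scale0r mul0r.
  by rewrite mul0r !subr0.
by rewrite subr0 in h.
Qed.

Let co_cong l f g i : i \in T -> q (f - g) -> co l f i = co l g i.
Proof. by move=> hi /(nxi_cong l) /digits_cong [h _]; exact: h. Qed.

Let co_linear l (c : k) f g i : i \in T ->
  co l (c%:A * f + g) i = c * co l f i + co l g i.
Proof.
move=> hi; have [h _] := digits_cong (nxi_linear l c f g).
by rewrite /co h //; have [-> ] := digits_linear c (nxi l f) (nxi l g).
Qed.

Let co0 l i : i \in T -> co l 0 i = 0.
Proof.
by move=> hi; have := co_linear l (-1) 0 0 hi; rewrite mulr0 addr0 mulN1r addNr.
Qed.

Let coD l f g i : i \in T -> co l (f + g) i = co l f i + co l g i.
Proof. by move=> hi; rewrite -[f]mul1r -(scale1r (1 : R)) co_linear // scale1r !mul1r. Qed.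

Let coZ l (c : k) f i : i \in T -> co l (c%:A * f) i = c * co l f i.
Proof. by move=> hi; rewrite -[_ * f]addr0 co_linear // co0 // addr0. Qed.

Let co_sum l (J : Type) (r : seq J) (P : pred J) (F : J -> R) i : i \in T ->
  co l (\sum_(j <- r | P j) F j) i = \sum_(j <- r | P j) co l (F j) i.
Proof.
by move=> hi; elim/big_rec2: _ => [|j u v _ <-]; rewrite ?co0 ?coD.
Qed.

Let nxi_shift l f : q (nxi l.+1 (z * f) - nxi l f).
Proof.
rewrite /nxi iterSr; apply: nxi_cong; by case: (digits_shift f).
Qed.

Let co_shift l f i : i \in T -> co l.+1 (z * f) i = co l f i.
Proof. by move=> hi; have [h _] := digits_cong (nxi_shift l f); exact: h. Qed.

Let co_shift0 f i : i \in T -> co 0 (z * f) i = 0.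
Proof. by move=> hi; have [h _] := digits_shift f; exact: h. Qed.

Let co_shiftX a l f i : i \in T ->
  co l (z ^+ a * f) i = if (a <= l)%N then co (l - a) f i else 0.
Proof.
move=> hi; elim: a l => [|a IH] l; first by rewrite expr0 mul1r subn0.
rewrite exprS -mulrA; case: l => [|l]; first by rewrite co_shift0.
by rewrite co_shift // IH ltnS subSS.
Qed.

Let co_basis l i j : i \in T -> j \in T -> co l (b j) i = ((l == 0%N) && (i == j))%:R.
Proof.
move=> hi hj; have [h1 h2] := digits_basis hj; case: l => [|l]; first exact: h1.
rewrite /co /nxi iterSr -/(nxi l _) -[RHS](co0 0 hi).
by apply: (co_cong 0 hi); rewrite subr0; exact: nxi_q.
Qed.

Let Q N : set R := adjoin q (z ^+ N).
Let Q_ideal N : is_ideal (Q N) := adjoin_is_ideal _ q_ideal.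
Let Q_sub N : q `<=` Q N := @adjoin_sub _ q (z ^+ N).

Let co_Q N l f i : i \in T -> (l < N)%N -> Q N f -> co l f i = 0.
Proof.
move=> hi hl [a [r [ha ->]]]; rewrite coD // mulrC co_shiftX // leqNgt hl /= addr0.
by rewrite -(co0 l hi); apply: co_cong => //; rewrite subr0.
Qed.

Let co_congQ N l f g i : i \in T -> (l < N)%N -> Q N (f - g) -> co l f i = co l g i.
Proof.
move=> hi hl h; rewrite -[f](subrK g) coD // (co_Q hi hl h) add0r //.
Qed.

(** [trunc N f] is the normal form of f modulo q + (z^N), and [rho N f] the error in q of the
    expansion with remainder. Modulo z^N q, [rho N] is a k-linear projection onto q; its failure to
    be R-linear is exploited when w is in q. *)
Let trunc N f : R := \sum_(l < N) \sum_(i in T) (co l f i)%:A * (z ^+ l * b i).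
Let rho N f : R := f - trunc N f - z ^+ N * nxi N f.

Let rho_q N f : q (rho N f).
Proof.
elim: N => [|N IH].
  by rewrite /rho /trunc big_ord0 expr0 mul1r subr0 subrr; exact: ideal0.
have -> : rho N.+1 f = rho N f +
   z ^+ N * (nxi N f - \sum_(i in T) (cc (nxi N f) i)%:A * b i - nx (nxi N f) * z).
  rewrite /rho /trunc big_ord_recr /=.
  have -> : \sum_(i in T) (co N f i)%:A * (z ^+ N * b i) =
     z ^+ N * \sum_(i in T) (cc (nxi N f) i)%:A * b i.
    by rewrite mulr_sumr; apply: eq_bigr => i _; rewrite /co; ring.
  by rewrite exprS; ring.
by apply: idealD => //; apply: idealMl.
Qed.

Let trunc_Q N f : Q N (f - trunc N f).
Proof.
exists (rho N f), (nxi N f); split; first exact: rho_q.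
by rewrite /rho; ring.
Qed.

(* mult N g i j is the (i, j) entry, truncated at z^N, of the matrix of
   multiplication by g in the basis b over k[z]. *)
Let mult N g i j : R := \sum_(l < N) (co l (g * b j) i)%:A * z ^+ l.

(** With u read as the map b_i to u_i, both sides are the z^N coefficient of the trace of u composed
    with multiplication by g, in the two orders. *)
Let trace_mulC N g (u : I -> R) :
  \sum_(j in T) \sum_(i in T) co N (mult N.+1 g i j * u i) j =
  \sum_(i in T) co N (g * u i) i.
Proof.
have e1 i j : i \in T -> j \in T -> co N (mult N.+1 g i j * u i) j =
    \sum_(l < N.+1) co l (g * b j) i * co (N - l) (u i) j.
  move=> hi hj; rewrite /mult mulr_suml co_sum //; apply: eq_bigr => l _.
  by rewrite -mulrA coZ // co_shiftX // -ltnS ltn_ord.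
have e2 i : i \in T -> co N (g * u i) i =
    \sum_(j in T) \sum_(l < N.+1) co l (g * b j) i * co (N - l) (u i) j.
  move=> hi; rewrite (@co_congQ N.+1 N _ (g * trunc N.+1 (u i))) //; last first.
    by rewrite -mulrBr; apply: idealMl => //; exact: trunc_Q.
  rewrite /trunc mulr_sumr co_sum //.
  under eq_bigr => l _ do rewrite mulr_sumr co_sum //.
  rewrite exchange_big /=; apply: eq_bigr => j hj.
  rewrite (reindex_inj rev_ord_inj) /=; apply: eq_bigr => l _.
  rewrite mulrCA coZ // mulrCA co_shiftX // subSS leq_subr subKn; last by rewrite -ltnS.
  by rewrite mulrC.
rewrite exchange_big /=; apply: eq_bigr => i hi.
by rewrite e2 //; apply: eq_bigr => j hj; rewrite e1.
Qed.

Section TraceDerivation.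
Variables (N : nat) (h : I -> R -> R).
Hypothesis h_linear : forall j (c : k) f g, j \in T ->
  Q N.+1 (h j (c%:A * f + g) - (c%:A * h j f + h j g)).
Hypothesis h_leibniz : forall j f g, j \in T ->
  Q N.+1 (h j (f * g) - (\sum_(i in T) mult N.+1 g i j * h i f + f * h j g)).

(** Each f gives the endomorphism b_j to h_j(f), and this is a derivation of R into a bimodule of
    endomorphisms. Left and right multiplication agree only after the trace, which turns it into a
    biderivation. *)
Let tau a f := \sum_(j in T) co N (a * h j f) j.

Let tau_biderivation : exists M, biderivation m M tau.
Proof.
have [M hM] : exists M, ideal_pow m M `<=` Q N.+1.
  by apply: q_dim1 => /(prime_exp q_prime).
have cQ j u v a : j \in T -> Q N.+1 (u - v) -> co N (a * u) j = co N (a * v) j.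
  move=> hj huv; apply: (@co_congQ N.+1) => //; rewrite -mulrBr; exact: idealMl.
exists M; split.
- move=> f c a a'; rewrite /tau -mulr_algl mulr_sumr -big_split; apply: eq_bigr => j hj /=.
  by rewrite mulrDl -mulrA co_linear // mulr_algl.
- move=> a c f g; rewrite /tau -(mulr_algl c f) mulr_sumr -big_split; apply: eq_bigr => j hj /=.
  by rewrite (cQ _ _ _ _ hj (h_linear c f g hj)) mulrDr mulrCA co_linear.
- move=> a f ha; rewrite /tau big1 // => j hj; apply: (@co_Q N.+1) => //.
  by apply: idealMr => //; apply: hM.
- move=> a f g; rewrite /tau.
  have -> : \sum_(j in T) co N (a * h j (f * g)) j =
    \sum_(j in T) \sum_(i in T) co N (mult N.+1 g i j * (a * h i f)) j +
    \sum_(j in T) co N (a * f * h j g) j.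
    rewrite -big_split; apply: eq_bigr => j hj /=.
    rewrite (cQ _ _ _ _ hj (h_leibniz f g hj)) mulrDr coD // mulr_sumr co_sum // mulrA.
    by congr (_ + _); apply: eq_bigr => i _; rewrite mulrCA.
  rewrite trace_mulC addrC; congr (_ + _); apply: eq_bigr => i _.
  by rewrite mulrA [g * a]mulrC.
Qed.

Lemma trace_derivation_vanishes w a : (forall i, q (del i w)) ->
  \sum_(j in T) co N (a * h j w) j = 0.
Proof.
move=> hw; have [M hM] := tau_biderivation.
rewrite -[LHS]/(tau a w).
rewrite (biderivation_partial noethR locR augR x_regular x_gen d_univ del_partial w hM).
rewrite big1 // => i _; rewrite /tau big1 // => j hj.
rewrite -(co0 N hj); apply: co_cong => //; rewrite subr0.
by apply: idealMr => //; apply: idealMl.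
Qed.

End TraceDerivation.

Let card_neq0 : (#|T|%:R : k) != 0.
Proof. by rewrite ((pcharf0P k).1 char0) -lt0n. Qed.

(** [h] is the z-derivative at z = 0 of the matrix of multiplication. Its value at z is the
    identity, of trace [#|T|], nonzero in characteristic zero. *)
Lemma parameter_not_critical : ~ forall i, q (del i z).
Proof.
move=> hz.
pose h j f := \sum_(i in T) (co 1 (f * b j) i)%:A * b i.
have m1 g i j : mult 1 g i j = (co 0 (g * b j) i)%:A.
  by rewrite /mult big_ord1 expr0 mulr1.
have t1 f : trunc 1 f = \sum_(i in T) (co 0 f i)%:A * b i.
  by rewrite /trunc big_ord1; apply: eq_bigr => i _; rewrite expr0 mul1r.
have := @trace_derivation_vanishes 0 h _ _ z 1 hz.
have -> : \sum_(j in T) co 0 (1 * h j z) j = #|T|%:R.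
  rewrite -sumr_const; apply: eq_bigr => j hj; rewrite mul1r /h co_sum //.
  rewrite (bigD1 j) //= coZ // co_shift // co_basis //= [j == j]eqxx mulr1.
  rewrite big1 ?addr0 // => i /andP [hi ne].
  by rewrite coZ // co_shift // co_basis // (negbTE ne) mul0r.
move=> H; move: card_neq0; rewrite H ?eqxx // => [j c f g hj|j f g hj].
- have -> : h j (c%:A * f + g) = c%:A * h j f + h j g.
    rewrite /h mulr_sumr -big_split; apply: eq_bigr => i hi /=.
    by rewrite mulrDl -mulrA co_linear // scalerDl mulrDl -scalar_mulA.
  by rewrite subrr; exact: ideal0.
have e : forall i, i \in T -> co 1 (f * g * b j) i =
    \sum_(l in T) co 0 (g * b j) l * co 1 (f * b l) i +
    \sum_(l in T) co 1 (g * b j) l * co 0 (f * b l) i.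
  move=> i hi; rewrite -mulrA (@co_congQ 2 1 _ (f * trunc 2 (g * b j))) //; last first.
    by rewrite -mulrBr; apply: idealMl => //; exact: trunc_Q.
  rewrite /trunc big_ord_recl big_ord1 /= mulrDr coD // !mulr_sumr !co_sum //.
  congr (_ + _); apply: eq_bigr => l hl; rewrite mulrCA coZ //.
    by rewrite expr0 mul1r.
  by rewrite expr1 mulrCA co_shift.
have -> : h j (f * g) = \sum_(l in T) mult 1 g l j * h l f +
    \sum_(l in T) (co 1 (g * b j) l)%:A * trunc 1 (f * b l).
  under eq_bigr => l hl do rewrite m1 /h mulr_sumr.
  under [X in _ = _ + X]eq_bigr => l hl do rewrite t1 mulr_sumr.
  rewrite exchange_big [X in _ = _ + X]exchange_big -big_split; apply: eq_bigr => i hi /=.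
  rewrite e // scalerDl mulrDl !scaler_suml !mulr_suml; congr (_ + _);
    by apply: eq_bigr => l hl; rewrite -scalar_mulA.
set S := \sum_(l in T) mult _ _ _ _ * _; set B := \sum_(l in T) _ * trunc _ _.
have -> : S + B - (S + f * h j g) = B - f * h j g by ring.
rewrite /B /h mulr_sumr -sumrB.
rewrite (_ : \sum_(i in T) _ = - \sum_(l in T) (co 1 (g * b j) l)%:A * (f * b l - trunc 1 (f * b l))).
  apply: idealN => //; apply: ideal_sum => // l hl; apply: idealMl => //.
by rewrite -sumrN; apply: eq_bigr => l _; ring.
Qed.

(** Here h_j(f) is [lambda] of the error of f b_j, which measures how far the lifted basis is from
    being stable under f. For w in q this error is w b_j itself, so a h(w) is multiplication by a
    lambda(w), and a is chosen to make this z^M modulo q. *)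
Lemma linear_form_not_critical (lambda : R -> R) w :
  (forall c u v, q u -> q v -> q (lambda (c * u + v) - (c * lambda u + lambda v))) ->
  q w -> ~ q (lambda w) -> ~ forall i, q (del i w).
Proof.
move=> lamL qw nlw hw.
have lamD u v : q u -> q v -> q (lambda (u + v) - (lambda u + lambda v)).
  by move=> hu hv; have := lamL 1 u v hu hv; rewrite !mul1r.
have lam0 : q (lambda 0).
  have h0 : q (0 : R) by exact: ideal0.
  have := lamD 0 0 h0 h0; rewrite addr0 opprD addrA subrr sub0r => /(idealN q_ideal).
  by rewrite opprK.
have lamZ c u : q u -> q (lambda (c * u) - c * lambda u).
  move=> hu; have h0 : q (0 : R) by exact: ideal0.
  have := lamL c u 0 hu h0; rewrite addr0 => h.
  have -> : lambda (c * u) - c * lambda u =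
    (lambda (c * u) - (c * lambda u + lambda 0)) + lambda 0 by ring.
  exact: idealD.
have [M hM] := q_dim1 nlw.
have [a0 [a [ha0 ea]]] := hM _ (ideal_pow_exp M mz).
(* One above M, so that the coefficient of z^M survives modulo q + (z^N). *)
pose N := M.+1.
(* Errors in q matter only modulo z^N q, which [lambda] maps into q + (z^N). *)
pose Z : set R := [set u | exists v, q v /\ u = z ^+ N * v].
have hZ : is_ideal Z.
  split; first by exists 0; rewrite mulr0; split=> //; exact: ideal0.
  move=> c _ _ [u [hu ->]] [v [hv ->]]; exists (c * u + v); split; last by ring.
  by apply: idealD => //; apply: idealMl.
have Zq : Z `<=` q by move=> _ [v [hv ->]]; apply: idealMl.
have lamZZ u : Z u -> Q N (lambda u).
  move=> [v [hv ->]]; exists (lambda (z ^+ N * v) - z ^+ N * lambda v), (lambda v).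
  by split; [exact: lamZ | ring].
have lam_cong u v : q u -> Z (u - v) -> Q N (lambda u - lambda v).
  move=> hu huv; have hv : q v.
    by have -> : v = u - (u - v) by [ring]; apply: idealB => //; exact: Zq.
  have -> : lambda u - lambda v = (lambda (u - v + v) - (lambda (u - v) + lambda v))
    + lambda (u - v) by rewrite subrK; ring.
  apply: idealD => //; last exact: lamZZ.
  by apply: Q_sub; apply: lamD => //; exact: Zq.
have trunc_linear (c : k) f g : trunc N (c%:A * f + g) = c%:A * trunc N f + trunc N g.
  rewrite /trunc mulr_sumr -big_split; apply: eq_bigr => l _ /=.
  rewrite mulr_sumr -big_split; apply: eq_bigr => i hi /=.
  by rewrite co_linear // scalerDl mulrDl -scalar_mulA.
have rho_linear (c : k) f g : Z (rho N (c%:A * f + g) - (c%:A * rho N f + rho N g)).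
  exists (- (nxi N (c%:A * f + g) - (c%:A * nxi N f + nxi N g))); split.
    by apply: idealN => //; exact: nxi_linear.
  by rewrite /rho trunc_linear; ring.
have rhoD f g : Z (rho N (f + g) - (rho N f + rho N g)).
  by have := rho_linear 1 f g; rewrite scale1r !mul1r.
have rho_id u : q u -> Z (rho N u - u).
  move=> hu; exists (- nxi N u); split; first by apply: idealN => //; exact: nxi_q.
  have -> : rho N u = u - trunc N u - z ^+ N * nxi N u by [].
  rewrite /trunc big1; first by ring.
  move=> l _; rewrite big1 // => i hi.
  rewrite (_ : co l u i = 0) ?scale0r ?mul0r // -(co0 l hi).
  by apply: co_cong => //; rewrite subr0.
have rho0 : Z (rho N 0).
  have h0 : q (0 : R) by exact: ideal0.
  by have := rho_id 0 h0; rewrite subr0.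
have rhoZ (c : k) f : Z (rho N (c%:A * f) - c%:A * rho N f).
  have := rho_linear c f 0; rewrite addr0 => h.
  have -> : rho N (c%:A * f) - c%:A * rho N f =
    (rho N (c%:A * f) - (c%:A * rho N f + rho N 0)) + rho N 0 by ring.
  exact: idealD.
have rho_zN r : Z (rho N (z ^+ N * r)).
  exists (r - nxi N (z ^+ N * r)); split.
    apply: idealBC => //; elim: (N) => [|l IH].
      by rewrite expr0 mul1r subrr; exact: ideal0.
    have := idealD q_ideal (nxi_shift l (z ^+ l * r)) IH.
    by rewrite mulrA -exprS addrA subrK.
  rewrite /rho /trunc big1; first by ring.
  move=> l _; rewrite big1 // => i hi.
  by rewrite co_shiftX // leqNgt ltn_ord scale0r mul0r.
have rho_basis l j : j \in T -> Z (rho N (z ^+ l * b j)).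
  move=> hj; case: (leqP N l) => hl.
    by rewrite -(subnKC hl) exprD -mulrA; exact: rho_zN.
  exists (- nxi N (z ^+ l * b j)); split.
    apply: idealN => //.
    suff key : forall l N', (l < N')%N -> q (nxi N' (z ^+ l * b j)) by exact: key.
    elim=> [|l' IH] N' hN'.
      rewrite expr0 mul1r; case: N' hN' => // N' _; rewrite /nxi iterSr -/(nxi N' _).
      by apply: nxi_q; case: (digits_basis hj).
    case: N' hN' => // N' hN'; rewrite exprS -mulrA.
    by have := idealD q_ideal (nxi_shift N' (z ^+ l' * b j)) (IH N' hN'); rewrite subrK.
  rewrite /rho /trunc (bigD1 (Ordinal hl)) //= (bigD1 j) //=.
  rewrite co_shiftX // leqnn subnn co_basis //= [j == j]eqxx scale1r mul1r.
  rewrite big1 => [|i /andP [hi ne]]; last first.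
    by rewrite co_shiftX // leqnn subnn co_basis //= (negbTE ne) scale0r mul0r.
  rewrite big1 ?addr0; first by ring.
  move=> l' ne; rewrite big1 // => i hi; rewrite co_shiftX //.
  case: ifP => hle; last by rewrite scale0r mul0r.
  rewrite co_basis // subn_eq0 leqNgt ltn_neqAle hle andbT.
  by rewrite eq_sym -[(l' == l :> nat)]/(l' == Ordinal hl) ne /= scale0r mul0r.
have rho_sum (J : Type) (r : seq J) (P : pred J) (F : J -> R) :
    Z (rho N (\sum_(i <- r | P i) F i) - \sum_(i <- r | P i) rho N (F i)).
  elim/big_rec2: _ => [|i u v _ huv]; first by rewrite subr0.
  have -> : rho N (F i + v) - (rho N (F i) + u) =
    (rho N (F i + v) - (rho N (F i) + rho N v)) + (rho N v - u) by ring.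
  exact: idealD.
have rho_trunc f : Z (rho N (trunc N f)).
  apply: (ideal_eqmod hZ (rho_sum _ _ _ _)).2; apply: ideal_sum => // l _.
  apply: (ideal_eqmod hZ (rho_sum _ _ _ _)).2; apply: ideal_sum => // i hi.
  apply: (ideal_eqmod hZ (rhoZ _ _)).2; apply: idealMl => //; exact: rho_basis.
have rho_z l f : Z (rho N (z ^+ l * f) - z ^+ l * rho N f).
  have ef : z ^+ l * f = z ^+ l * trunc N f + (z ^+ N * (z ^+ l * nxi N f) + z ^+ l * rho N f).
    by rewrite /rho; ring.
  set t1 := z ^+ l * trunc N f in ef; set t2 := z ^+ N * _ in ef; set t3 := z ^+ l * rho N f in ef *.
  have h1 : Z (rho N t1).
    rewrite /t1 /trunc mulr_sumr; apply: (ideal_eqmod hZ (rho_sum _ _ _ _)).2.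
    apply: ideal_sum => // l' _; rewrite mulr_sumr.
    apply: (ideal_eqmod hZ (rho_sum _ _ _ _)).2; apply: ideal_sum => // i hi.
    rewrite mulrCA; apply: (ideal_eqmod hZ (rhoZ _ _)).2; apply: idealMl => //.
    by rewrite mulrA -exprD; exact: rho_basis.
  have h3 : Z (rho N t3 - t3) by apply: rho_id; apply: idealMl.
  have -> : rho N (z ^+ l * f) - t3 = (rho N (t1 + (t2 + t3)) - (rho N t1 + rho N (t2 + t3)))
     + (rho N (t2 + t3) - (rho N t2 + rho N t3)) + rho N t1 + rho N t2 + (rho N t3 - t3).
    by rewrite ef; ring.
  apply: idealD => //; apply: idealD => //; last exact: rho_zN.
  by apply: idealD => //; apply: idealD => //; exact: rhoD.
pose h j f := lambda (rho N (f * b j)).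
have hl1 j (c : k) f g : j \in T -> Q N (h j (c%:A * f + g) - (c%:A * h j f + h j g)).
  move=> hj; rewrite /h mulrDl -mulrA.
  set u := rho N (f * b j); set v := rho N (g * b j).
  have -> : lambda (rho N (c%:A * (f * b j) + g * b j)) - (c%:A * lambda u + lambda v) =
    (lambda (rho N (c%:A * (f * b j) + g * b j)) - lambda (c%:A * u + v)) +
    (lambda (c%:A * u + v) - (c%:A * lambda u + lambda v)) by ring.
  apply: idealD => //; last by apply: Q_sub; apply: lamL; exact: rho_q.
  by apply: lam_cong; [exact: rho_q | exact: rho_linear].
have lam_sum (P : pred I) (c F : I -> R) : (forall i, q (F i)) ->
    q (lambda (\sum_(i | P i) c i * F i) - \sum_(i | P i) c i * lambda (F i)).
  move=> hF; suff [h1 h2] : q (\sum_(i | P i) c i * F i) /\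
    q (lambda (\sum_(i | P i) c i * F i) - \sum_(i | P i) c i * lambda (F i)) by [].
  elim/big_rec2: _ => [|i u v _ [h1 h2]]; first by rewrite subr0; split=> //; exact: ideal0.
  split; first by apply: idealD => //; apply: idealMl.
  have -> : lambda (c i * F i + v) - (c i * lambda (F i) + u) =
    (lambda (c i * F i + v) - (c i * lambda (F i) + lambda v)) + (lambda v - u) by ring.
  by apply: idealD => //; apply: lamL.
(* Expanding g b_j writes the error of f g b_j as the errors of the f b_i weighted by the matrix of
   g, plus f times the error of g b_j; [lambda] turns this into the Leibniz rule. *)
have hl2 j f g : j \in T ->
    Q N (h j (f * g) - (\sum_(i in T) mult N g i j * h i f + f * h j g)).
  move=> hj; rewrite /h -mulrA; set G := g * b j.
  pose S := \sum_(i in T) mult N g i j * rho N (f * b i).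
  have hS : q S by apply: ideal_sum => // i _; apply: idealMl => //; exact: rho_q.
  have hfr : q (f * rho N G) by apply: idealMl => //; exact: rho_q.
  have hft : Z (rho N (f * trunc N G) - S).
    rewrite /trunc exchange_big /= mulr_sumr.
    pose F2 i (l : 'I_N) := f * ((co l G i)%:A * (z ^+ l * b i)).
    pose F i := \sum_l F2 i l.
    rewrite (eq_bigr F); last by move=> i _; rewrite mulr_sumr.
    have -> : rho N (\sum_(i in T) F i) - S = (rho N (\sum_(i in T) F i) - \sum_(i in T) rho N (F i))
      + (\sum_(i in T) (rho N (F i) - mult N g i j * rho N (f * b i))).
      by rewrite [X in _ = _ + X]sumrB -/S addrA subrK.
    apply: idealD => //; apply: ideal_sum => // i hi; rewrite /F /mult mulr_suml.
    set Y := \sum_(l < N) _ * rho N _.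
    have -> : rho N (\sum_l F2 i l) - Y = (rho N (\sum_l F2 i l) - \sum_l rho N (F2 i l))
      + (\sum_l (rho N (F2 i l) - (co l (g * b j) i)%:A * z ^+ l * rho N (f * b i))).
      by rewrite [X in _ = _ + X]sumrB -/Y addrA subrK.
    apply: idealD => //; apply: ideal_sum => // l _; rewrite /F2 -/G.
    have -> : f * ((co l G i)%:A * (z ^+ l * b i)) = (co l G i)%:A * (z ^+ l * (f * b i)) by ring.
    set c := co l G i.
    have -> : rho N (c%:A * (z ^+ l * (f * b i))) - c%:A * z ^+ l * rho N (f * b i) =
      (rho N (c%:A * (z ^+ l * (f * b i))) - c%:A * rho N (z ^+ l * (f * b i))) +
      c%:A * (rho N (z ^+ l * (f * b i)) - z ^+ l * rho N (f * b i)) by ring.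
    by apply: idealD => //; apply: idealMl.
  have hmain : Z (rho N (f * G) - (S + f * rho N G)).
    have eG : f * G = f * trunc N G + (z ^+ N * (f * nxi N G) + f * rho N G).
      by rewrite /rho; ring.
    set t1 := f * trunc N G in eG hft; set t2 := z ^+ N * _ in eG; set t3 := f * rho N G in eG hfr *.
    have -> : rho N (f * G) - (S + t3) = (rho N (t1 + (t2 + t3)) - (rho N t1 + rho N (t2 + t3)))
      + (rho N (t2 + t3) - (rho N t2 + rho N t3)) + (rho N t1 - S) + rho N t2 + (rho N t3 - t3).
      by rewrite eG; ring.
    apply: idealD => //; last exact: rho_id.
    apply: idealD => //; last exact: rho_zN.
    by apply: idealD => //; apply: idealD => //; exact: rhoD.
  set L := \sum_(i in T) _.
  have -> : lambda (rho N (f * G)) - (L + f * lambda (rho N G)) =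
    (lambda (rho N (f * G)) - lambda (S + f * rho N G)) +
    (lambda (S + f * rho N G) - (lambda S + lambda (f * rho N G))) +
    (lambda S - L) + (lambda (f * rho N G) - f * lambda (rho N G)) by ring.
  apply: idealD => //; last by apply: Q_sub; apply: lamZ; exact: rho_q.
  apply: idealD => //; last first.
    by apply: Q_sub; apply: lam_sum => i; exact: rho_q.
  apply: idealD => //; last by apply: Q_sub; exact: lamD.
  by apply: lam_cong => //; exact: rho_q.
have := @trace_derivation_vanishes M h hl1 hl2 w a hw.
have -> : \sum_(j in T) co M (a * h j w) j = #|T|%:R.
  rewrite -sumr_const; apply: eq_bigr => j hj.
  rewrite (@co_congQ N M _ (z ^+ M * b j)) //.
    by rewrite co_shiftX // leqnn subnn co_basis //= [j == j]eqxx.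
  rewrite ea /h.
  have -> : a * lambda (rho N (w * b j)) - (a0 + a * lambda w) * b j =
    a * (lambda (rho N (w * b j)) - lambda (b j * w)) +
    a * (lambda (b j * w) - b j * lambda w) - a0 * b j by ring.
  apply: idealB => //; last by apply: Q_sub; apply: idealMr.
  apply: idealD => //; apply: idealMl => //; last by apply: Q_sub; exact: lamZ.
  apply: lam_cong; first exact: rho_q.
  by rewrite [b j * w]mulrC; apply: rho_id; apply: idealMr.
by move/eqP; apply/negP.
Qed.

End OneDimensionalPrime.

(** [w] is nonzero in the cotangent space of the localization at q. A maximal saturated L between
    q^2 and q avoiding w acts as a complementary hyperplane: elements of q are fractional multiples
    of w modulo L. With r a common denominator for finitely many generators of q, lambda is r times
    the resulting form, so lambda(w) = r modulo q. *)
Lemma linear_form_exists (A : comNzRingType) (q : set A) (w : A) :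
  noetherian A -> is_prime q -> q w ->
  (forall s, ~ q s -> ~ ideal_pow q 2 (s * w)) ->
  exists lambda : A -> A, ~ q (lambda w) /\
    forall c u v, q u -> q v -> q (lambda (c * u + v) - (c * lambda u + lambda v)).
Proof.
move=> noethA hq qw hw; have [q_i q1 qp] := hq.
have q2_i := ideal_pow_is_ideal q 2.
have q2q : ideal_pow q 2 `<=` q by move=> u /ideal_powS; exact: ideal_pow1.
pose P (L : set A) := [/\ saturated q L, ideal_pow q 2 `<=` L, L `<=` q & ~ L w].
have hP0 : P (saturation q (ideal_pow q 2)).
  split.
  - exact: saturation_saturated.
  - exact: saturation_sub.
  - by apply: saturation_min q2q; exact: prime_saturated.
  - by move=> [s [hs h]]; apply: (hw s).
have [L [hL [satL q2L Lq nLw] hmax]] := @noetherian_maximal A P noethA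
  (ex_intro _ _ (conj (saturation_is_ideal hq q2_i) hP0)).
have Lw s : L (s * w) -> q s.
  by move=> h; apply: contrapT => hs; apply: nLw; exact: (satL s).
have frac a : q a -> exists r s, ~ q r /\ L (r * a - s * w).
  move=> ha; case: (pselect (L a)) => hLa.
    by exists 1, 0; split=> //; rewrite mul1r mul0r subr0.
  have : saturation q (adjoin L a) w.
    apply: contrapT => hn; apply: hLa.
    apply: (hmax (saturation q (adjoin L a))).
    - by apply: saturation_is_ideal => //; exact: adjoin_is_ideal.
    - split=> //; first exact: saturation_saturated.
        by move=> u /q2L hu; apply: saturation_sub => //; exact: adjoin_sub.
      apply: saturation_min; first exact: prime_saturated.
      exact: adjoin_min.
    - by move=> u hu; apply: saturation_sub => //; exact: adjoin_sub.
    - by apply: saturation_sub => //; exact: adjoin_mem.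
  move=> [s [hs [l [r [hl e]]]]]; exists r, s; split.
    move=> hr; apply: hs; apply: Lw; rewrite e; apply: idealD => //; apply: q2L.
    by apply: ideal_powM => //; rewrite -[a]mulr1; apply: ideal_powM.
  have -> : r * a - s * w = - l by rewrite e; ring.
  exact: idealN.
have [N [g eq]] := noetherian_fg noethA q_i.
have qg j : q (g j) by rewrite eq; apply: gen_ideal_sub; exists j.
have /choice [rs hrs] : forall j, exists rs : A * A, ~ q rs.1 /\ L (rs.1 * g j - rs.2 * w).
  by move=> j; have [r [s h]] := frac _ (qg j); exists (r, s).
pose r := \prod_j (rs j).1.
have nqr : ~ q r.
  rewrite /r; elim/big_rec: _ => // j u _ hu; apply: prime_not_mul => //.
  by case: (hrs j).
have /choice [lambda hlam] : forall a, exists s, q a -> L (r * a - s * w).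
  move=> a; case: (pselect (q a)) => ha; last by exists 0.
  move: ha; rewrite {1}eq => /gen_range_is_sum [c ->].
  exists (\sum_j c j * (\prod_(i | i != j) (rs i).1) * (rs j).2) => _.
  rewrite mulr_sumr mulr_suml -sumrB; apply: ideal_sum => // j _.
  have -> : r = (rs j).1 * \prod_(i | i != j) (rs i).1 by rewrite /r (bigD1 j).
  set t := \prod_(i | _) _.
  have -> : (rs j).1 * t * (c j * g j) - c j * t * (rs j).2 * w =
     (c j * t) * ((rs j).1 * g j - (rs j).2 * w) by ring.
  by apply: idealMl => //; case: (hrs j).
exists lambda; split=> [h|c u v hu hv].
  apply: nqr; have := hlam w qw; rewrite -mulrBl => /Lw h'.
  have -> : r = (r - lambda w) + lambda w by ring.
  exact: idealD.
apply: Lw.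
have hcuv : q (c * u + v) by apply: idealD => //; apply: idealMl.
have -> : (lambda (c * u + v) - (c * lambda u + lambda v)) * w =
  (c * (r * u - lambda u * w) + (r * v - lambda v * w)) -
  (r * (c * u + v) - lambda (c * u + v) * w) by ring.
apply: idealB => //; last exact: hlam.
by apply: idealD => //; [apply: idealMl => //; exact: hlam | exact: hlam].
Qed.

Lemma ideal_pow_split (A : comNzRingType) (I L : set A) N M : is_ideal L ->
  (forall u v, ideal_pow I N u -> ideal_pow I M v -> L (u * v)) ->
  ideal_pow I (N + M) `<=` L.
Proof.
elim: N L => [|N IH] L hL h; first by move=> v hv; rewrite -[v]mul1r; apply: h.
rewrite addSn; apply: ideal_powSP => // c u hc.
apply: (IH [set u | L (c * u)]) => [|u' v hu' hv] /=.
  split=> [|a u1 u2] /=; first by rewrite mulr0; exact: ideal0.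
  by move=> h1 h2; rewrite mulrDr mulrCA; case: hL => _; apply.
by rewrite mulrA; apply: h => //; apply: ideal_powM.
Qed.

(** * Regularity of R/w at q keeps w out of the square of q locally *)

Section RegularQuotient.
Variables (R A B : comNzRingType) (pi : {rmorphism R -> A}) (f : {rmorphism A -> B}).
Variables (q : set R) (w : R) (M : set B) (dim : nat).
Hypotheses (noethR : noetherian R) (R_domain : is_prime [set 0 : R]) (w_neq0 : w <> 0).
Hypothesis pi_quotient : is_quotient pi (gen_ideal [set w]).
Hypotheses (q_prime : is_prime q) (qw : q w).
Hypothesis f_localization : is_localization f (pi @` q).
Hypothesis B_regular : regular_local_ring M dim.

Let q_ideal : is_ideal q. Proof. by case: q_prime. Qed.

Let wq : gen_ideal [set w] `<=` q.
Proof. by apply: gen_ideal_min => // _ ->. Qed.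

Let image_q a : (pi @` q) (pi a) -> q a.
Proof.
move=> [c hc e]; have : gen_ideal [set w] (a - c).
  by apply/pi_quotient.2; rewrite rmorphB e subrr.
by move/wq => h; rewrite -(subrK c a); apply: idealD.
Qed.

Let g (a : R) : B := f (pi a).

Let gB a b : g (a - b) = g a - g b. Proof. by rewrite /g !rmorphB. Qed.
Let gD a b : g (a + b) = g a + g b. Proof. by rewrite /g !rmorphD. Qed.
Let gM a b : g (a * b) = g a * g b. Proof. by rewrite /g !rmorphM. Qed.
Let g0 : g 0 = 0. Proof. by rewrite /g !rmorph0. Qed.
Let g1 : g 1 = 1. Proof. by rewrite /g !rmorph1. Qed.

Let g_sum (I : finType) (F : I -> R) : g (\sum_i F i) = \sum_i g (F i).
Proof. by rewrite /g !rmorph_sum. Qed.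

Let g_unit s : ~ q s -> exists b, g s * b = 1.
Proof.
have [h _ _] := f_localization; move=> hs; apply: h => hi; apply: hs; exact: image_q.
Qed.

Let g_frac b : exists s a, ~ q s /\ g s * b = g a.
Proof.
have [_ /(_ b) [a [s [hs e]]] _] := f_localization.
have [a' ea] := pi_quotient.1 a; have [s' es] := pi_quotient.1 s.
exists s', a'; rewrite /g ea es; split=> // h; apply: hs; exists s' => //.
Qed.

Let g_ker a : g a = 0 -> exists s, ~ q s /\ gen_ideal [set w] (s * a).
Proof.
have [_ _ h] := f_localization; move=> /h [s [hs e]].
have [s' es] := pi_quotient.1 s.
exists s'; split; first by move=> hq; apply: hs; exists s'.
by apply/pi_quotient.2; rewrite rmorphM es.
Qed.

Let g_kerq a : g a = 0 -> q a.
Proof.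
by move/g_ker => [s [hs /wq]]; case: q_prime => _ _ hp /hp [].
Qed.

Let B_local : local_ring M. Proof. by case: B_regular. Qed.

Let M_ideal : is_ideal M := max_is_ideal B_local.

Let gw : g w = 0.
Proof.
have : pi w = 0 by apply/pi_quotient.2; apply: gen_ideal_sub.
by rewrite /g => ->; rewrite rmorph0.
Qed.

Let g_max a : M (g a) -> q a.
Proof.
move=> h; apply: contrapT => /g_unit [b e]; apply: (max_not1 B_local).
by rewrite -e; apply: idealMr.
Qed.

(** The [dim] generators of the maximal ideal of [B], lifted with denominators cleared; w joins them
    because it generates the kernel of R -> R/w. *)
Let q_gens : exists s : seq R, [/\ size s = dim, forall a, a \in s -> q a &
  forall c, q c -> exists t, ~ q t /\ adjoin (foldl (@adjoin R) [set 0] s) w (t * c)].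
Proof.
have [_ _ _ [y ey]] := B_regular.
have yM i : M (y i) by rewrite ey; apply: gen_ideal_sub; exists i.
have /choice [sa hsa] : forall i, exists sa : R * R, ~ q sa.1 /\ g sa.1 * y i = g sa.2.
  by move=> i; have [s [a h]] := g_frac (y i); exists (s, a).
pose s := [seq (sa i).2 | i <- enum 'I_dim].
have hs : is_ideal (foldl (@adjoin R) [set 0] s).
  exact: foldl_adjoin_is_ideal (set0_is_ideal R).
exists s; split.
- by rewrite size_map size_enum_ord.
- move=> _ /mapP [i _ ->]; apply: g_max; case: (hsa i) => _ <-.
  by apply: idealMl.
move=> c hc.
have : M (g c).
  apply: contrapT => /(local_unit B_local) [b e]; have [t [a [ht ea]]] := g_frac b.
  have h0 : g (a * c - t) = 0 by rewrite gB gM -ea -mulrA e mulr1 subrr.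
  apply: ht; have -> : t = a * c - (a * c - t) by ring.
  by apply: idealB => //; [apply: idealMl | exact: g_kerq].
rewrite ey => /gen_range_is_sum [v ev].
have /choice [ta hta] : forall i, exists ta : R * R, ~ q ta.1 /\ g ta.1 * v i = g ta.2.
  by move=> i; have [t [a h]] := g_frac (v i); exists (t, a).
pose den i := (ta i).1 * (sa i).1.
pose D := \prod_i den i.
have nden i : ~ q (den i).
  by apply: prime_not_mul => //; [case: (hta i) | case: (hsa i)].
have nD : ~ q D.
  rewrite /D; elim/big_rec: _ => [|i u _ hu]; first by case: q_prime.
  exact: prime_not_mul.
pose num := \sum_i (\prod_(j | j != i) den j) * ((ta i).2 * (sa i).2).
have h0 : g (D * c - num) = 0.
  rewrite gB gM ev mulr_sumr /num g_sum -sumrB big1 // => i _.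
  have [_ e1] := hta i; have [_ e2] := hsa i.
  rewrite /D (bigD1 i) //= /den !gM -e1 -e2; ring.
have [t [ht /gen_ideal_min hmin]] := g_ker h0.
have : adjoin (foldl (@adjoin R) [set 0] s) w (t * (D * c - num)).
  apply: hmin; first exact: adjoin_is_ideal.
  by move=> _ ->; exact: adjoin_mem.
move=> h; exists (t * D); split; first exact: prime_not_mul.
have -> : t * D * c = t * (D * c - num) + t * num by ring.
apply: idealD; [exact: adjoin_is_ideal | exact: h |].
apply: adjoin_sub; apply: idealMl => //; apply: ideal_sum => // i _; apply: idealMl => //.
apply: idealMl => //; apply: foldl_adjoin_mem; first exact: set0_is_ideal.
by apply/mapP; exists i => //; rewrite fintype.mem_enum.
Qed.

(* If [s * w] were in [q ^ 2], the localization of R at q would have its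
   maximal ideal minimal over [dim] elements while containing, thanks to the
   prime 0, a chain of primes of length [dim.+1]. *)
Lemma regular_quotient_order s : ~ q s -> ~ ideal_pow q 2 (s * w).
Proof.
move=> hs hsw; have [r [hsz hr hgen]] := q_gens.
have r_i : is_ideal (foldl (@adjoin R) [set 0] r).
  exact: foldl_adjoin_is_ideal (set0_is_ideal R).
have hmin : minimal_over q (foldl (@adjoin R) [set 0] r).
  move=> p hp hrp hpq; have [p_i _ pp] := hp.
  case: (pselect (p w)) => hpw.
    move=> c /hgen [t [ht h]].
    have : p (t * c) by apply: adjoin_min h.
    by case/pp => // /hpq.
  (* If w is not in p, then q is locally inside p + (w), so q^2 is locally inside p + (w^2). For s w
     in q^2, cancelling w modulo p puts an element outside q into q. *)
  exfalso.
  have [N [y ey]] := noetherian_fg noethR q_ideal.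
  have qy j : q (y j) by rewrite ey; apply: gen_ideal_sub; exists j.
  have /choice [t ht] : forall j, exists t, ~ q t /\ adjoin p w (t * y j).
    move=> j; have [t [ht h]] := hgen _ (qy j); exists t; split=> //.
    apply: adjoin_min h; [exact: adjoin_is_ideal | | exact: adjoin_mem].
    by move=> u /hrp; exact: adjoin_sub.
  pose S := \prod_j t j.
  have nS : ~ q S.
    rewrite /S; elim/big_rec: _ => [|j u _ hu]; first by case: q_prime.
    by apply: prime_not_mul => //; case: (ht j).
  have hSq c : q c -> adjoin p w (S * c).
    rewrite ey => /gen_range_is_sum [v ->]; rewrite mulr_sumr.
    apply: ideal_sum; first exact: adjoin_is_ideal.
    move=> j _; have -> : S * (v j * y j) = (v j * \prod_(i | i != j) t i) * (t j * y j).
      by rewrite /S (bigD1 j) //=; ring.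
    by apply: idealMl; [exact: adjoin_is_ideal | case: (ht j)].
  have pw2_i := adjoin_is_ideal (w ^+ 2) p_i.
  have hS2 : adjoin p (w ^+ 2) (S ^+ 2 * (s * w)).
    suff : ideal_pow q 2 `<=` [set u | adjoin p (w ^+ 2) (S ^+ 2 * u)] by apply.
    apply: ideal_powSP => [|a b ha hb] /=.
      split=> [|c u v /= hu hv] /=; first by rewrite mulr0; exact: ideal0.
      rewrite mulrDr mulrCA; by case: pw2_i => _; apply.
    have [pa [ra [hpa ea]]] := hSq a ha.
    have [pb [rb [hpb eb]]] := hSq b (ideal_pow1 q_ideal hb).
    exists (pa * (S * b) + ra * w * pb), (ra * rb); split.
      by apply: idealD => //; [apply: idealMr | apply: idealMl].
    have -> : S ^+ 2 * (a * b) = (S * a) * (S * b) by ring.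
    by rewrite ea mulrDl {2}eb; ring.
  have [pi0 [r0 [hpi0 e0]]] := hS2.
  have : p (w * (S ^+ 2 * s - r0 * w)).
    have -> : w * (S ^+ 2 * s - r0 * w) = pi0.
      have -> : pi0 = S ^+ 2 * (s * w) - r0 * w ^+ 2 by rewrite e0; ring.
      by ring.
    by [].
  case/pp => // /hpq h.
  have : q (S ^+ 2 * s).
    have -> : S ^+ 2 * s = (S ^+ 2 * s - r0 * w) + r0 * w by ring.
    by apply: idealD => //; apply: idealMl.
  have [_ _ qp] := q_prime; case/qp => [/(prime_exp q_prime)|] //.
have [_ _ [[P [hP hlt]] _] _] := B_regular.
have Pp i : (i <= dim)%N -> is_prime (P i) by move=> /hP /prime_idealPE.
(* Preimages of the chain of [B], preceded by the zero prime; the first step is strict because every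
   preimage contains the nonzero w. *)
pose c i : set R := if i is i'.+1 then [set a | P i' (g a)] else [set 0].
have nP i s' : (i <= dim)%N -> ~ q s' -> ~ P i (g s').
  move=> hi /g_unit [b e] h; have [Pi P1 _] := Pp i hi; apply: P1.
  by rewrite -e; apply: idealMr.
have : (dim.+1 <= size r)%N.
  apply: (krull_height noethR q_prime hr hmin (c := c)).
  - case=> [_|i] //; rewrite ltnS => hi /=; have [Pi P1 Pm] := Pp i hi.
    split; first split=> /=.
    + by rewrite g0; exact: ideal0.
    + by move=> a u v hu hv; rewrite gD gM; case: Pi => _; apply.
    + by rewrite /= g1.
    + by move=> a b /=; rewrite gM; exact: Pm.
  - case=> [_|i]; last rewrite ltnS => hi; rewrite /=.
      have [P0 _ _] := Pp 0%N (leq0n _); split=> [_ ->|h] /=; first by rewrite g0; exact: ideal0.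
      by apply: w_neq0; apply: h; rewrite /= gw; exact: ideal0.
    have [h1 h2] := hlt i hi; split=> [a /h1 //|h].
    apply: h2 => b hb; have [s' [a [hs' e]]] := g_frac b.
    have [Pi _ Pm] := Pp i (ltnW hi); have [Pi' _ _] := Pp i.+1 hi.
    have : P i (g a) by apply: h; rewrite /= -e; apply: idealMl.
    by rewrite -e => /Pm [/(nP _ _ (ltnW hi) hs')|].
  - move=> a /= ha; apply: contrapT => hn; exact: (nP _ _ (leqnn _) hn).
by rewrite hsz ltnn.
Qed.

End RegularQuotient.

(** * The Jacobian ideal of an isolated singularity is m-primary *)

Section Isolated.
Variables (k : fieldType) (R : comAlgType k) (m : set R) (n : nat).
Variable x : 'I_n -> R.
Hypotheses (R_regular : regular_local_ring m n) (augR : augmented m).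
Hypotheses (x_regular : regular_sequence x) (x_gen : m = gen_ideal (range x)).
Hypothesis char0 : [pchar k] =i pred0.
Variables (Omega : lmodType R) (d : R -> Omega).
Hypothesis d_univ : universally_finite d.
Variable del : 'I_n -> R -> R.
Hypothesis del_partial : partial_derivatives d x del.
Variable w : R.
Hypotheses (mw : m w) (w_isolated : isolated_singularity m w).

Let noethR : noetherian R. Proof. by case: R_regular. Qed.
Let locR : local_ring m. Proof. by case: R_regular. Qed.

Let image_prime (A : comNzRingType) (pi : {rmorphism R -> A}) (q : set R) :
  is_quotient pi (gen_ideal [set w]) -> is_prime q -> q w ->
  is_prime (pi @` q) /\ (forall a, (pi @` q) (pi a) -> q a).
Proof.
move=> [hs hk] [q_i q1 qp] qw.
have hinj a : (pi @` q) (pi a) -> q a.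
  move=> [c hc e]; have : gen_ideal [set w] (a - c).
    by apply/hk; rewrite rmorphB e subrr.
  move/(gen_ideal_min q_i (_ : [set w] `<=` q)) => h.
  by rewrite -(subrK c a); apply: idealD => //; apply: h => _ ->.
split=> //; split.
- split; first by exists 0; [exact: ideal0 | rewrite rmorph0].
  move=> a _ _ [u hu <-] [v hv <-]; have [a' <-] := hs a.
  by exists (a' * u + v); [case: q_i => _; apply | rewrite rmorphD rmorphM].
- by rewrite -(rmorph1 pi) => /hinj.
- move=> a b; have [a' <-] := hs a; have [b' <-] := hs b.
  by rewrite -rmorphM => /hinj /qp [h|h]; [left; exists a' | right; exists b'].
Qed.

(** If w were 0, the inverse of the quotient map would be a localization at the closed point, making
    it regular although it is the singular point. *)
Lemma isolated_neq0 : w <> 0.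
Proof.
move=> w0; have [A [pi [hpi hiso]]] := w_isolated.
have hm := max_is_prime locR.
have [hpm minj] := image_prime hpi hm mw.
have /prime_idealPE/hiso [_ /(_ erefl)] := hpm; apply.
have pi_inj a : pi a = 0 -> a = 0.
  move/hpi.2; rewrite w0; exact: (gen_ideal_min (set0_is_ideal R) (fun u hu => hu)).
have /choice [inv hinv] := hpi.1.
have invK a : inv (pi a) = a.
  by apply/eqP; rewrite -subr_eq0; apply/eqP/pi_inj; rewrite rmorphB hinv subrr.
have inv_add : {morph inv : a b / a - b}.
  by move=> a b; rewrite -{1}(hinv a) -{1}(hinv b) -rmorphB invK.
have inv_mul : GRing.monoid_morphism inv.
  split; first by rewrite -(rmorph1 pi) invK.
  by move=> a b; rewrite -{1}(hinv a) -{1}(hinv b) -rmorphM invK.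
pose fA := GRing.isZmodMorphism.Build A R inv inv_add.
pose fM := GRing.isMonoidMorphism.Build A R inv inv_mul.
pose f : {rmorphism A -> R} := HB.pack inv fA fM.
exists R, f, m, n; split=> //; split.
- move=> s hs; have [b e] : exists b, b * inv s = 1.
    by apply: (local_unit locR) => h; apply: hs; exists (inv s).
  by exists b; rewrite mulrC.
- move=> b; exists (pi b), 1; split; first by case: hpm.
  by rewrite /= -(rmorph1 pi) !invK mul1r.
- move=> a; split=> [/= e|[s [hs e]]] /=.
    by exists 1; split; [case: hpm | rewrite mul1r -(hinv a) e rmorph0].
  have [b eb] : exists b, b * inv s = 1.
    by apply: (local_unit locR) => h; apply: hs; exists (inv s).
  by rewrite -[inv a]mul1r -eb -mulrA -inv_mul.2 e -(rmorph0 pi) invK mulr0.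
Qed.

Theorem jacobian_primary :
  exists N, ideal_pow m N `<=` gen_ideal (range (fun i => del i w)).
Proof.
apply: contrapT => hno.
set J := gen_ideal _ in hno; have hJ : is_ideal J := gen_ideal_is_ideal _.
(* Maximality among the ideals over [J] containing no power of m yields both primality of q and
   [q_dim1]. *)
pose P (q : set R) := J `<=` q /\ forall N, ~ ideal_pow m N `<=` q.
have hPJ : P J by split=> // N h; apply: hno; exists N.
have [q [q_i [Jq hqm] hmax]] := @noetherian_maximal R P noethR (ex_intro _ J (conj hJ hPJ)).
have q_dim1 a : ~ q a -> exists N, ideal_pow m N `<=` adjoin q a.
  move=> ha; apply: contrapT => hn; apply: ha.
  apply: (hmax (adjoin q a)); [exact: adjoin_is_ideal | | exact: adjoin_sub | exact: adjoin_mem].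
  split=> [u /Jq hu|N h]; first exact: adjoin_sub.
  by apply: hn; exists N.
have q1 : ~ q 1.
  by move=> h; apply: (hqm 0%N) => u _; rewrite -[u]mulr1; apply: idealMl.
have hq : is_prime q.
  split=> // a b hab; apply: contrapT => /not_orP [/q_dim1 [N hN] /q_dim1 [M hM]].
  apply: (hqm (N + M)%N).
  have hNM u v : adjoin q a u -> adjoin q b v -> q (u * v).
    move=> [u' [r [hu ->]]] [v' [s [hv ->]]].
    have -> : (u' + r * a) * (v' + s * b) = (v' + s * b) * u' + r * a * v' + r * s * (a * b) by ring.
    by apply: idealD => //; [apply: idealD => // |]; apply: idealMl.
  by apply: ideal_pow_split => // u v /hN hu /hM hv; exact: hNM.
have [z [mz nqz]] : exists z, m z /\ ~ q z.
  apply: contrapT => hn; apply: (hqm 1%N) => u /(ideal_pow1 (max_is_ideal locR)) hu.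
  by apply: contrapT => h; apply: hn; exists u.
have Jdel i : q (del i w) by apply: Jq; apply: gen_ideal_sub; exists i.
case: (pselect (q w)) => qw; last first.
  exact: (parameter_not_critical noethR locR augR x_regular x_gen char0 d_univ
    del_partial hq q_dim1 mw qw Jdel).
have [A [pi [hpi hiso]]] := w_isolated.
have [hqp qinj] := image_prime hpi hq qw.
(* As z is in m but not in q, the image of q is not the closed point, so R/w is regular there. *)
have /contrapT [B [f [M [dim [hf hB]]]]] : ~ ~ regular_at (pi @` q).
  move=> h; have /prime_idealPE/hiso [/(_ h) e _] := hqp.
  apply: nqz; apply: qinj; rewrite e; by exists z.
have hord := regular_quotient_order noethR
  (regular_prime0 noethR locR x_regular x_gen) isolated_neq0 hpi hq qw hf hB.
have [lambda [nlam lamL]] := linear_form_exists noethR hq qw hord.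
exact: (linear_form_not_critical noethR locR augR x_regular x_gen char0 d_univ
    del_partial hq q_dim1 mz nqz lamL qw nlam Jdel).
Qed.

End Isolated.

(** * Extension of linear functionals on arbitrary vector spaces *)

Section FunctionalExtension.
Variables (k : fieldType) (W : lmodType k).

Definition subspace (S : set W) := S 0 /\ forall (c : k) u v, S u -> S v -> S (c *: u + v).

(** Partially defined functionals are handled through their graphs, subspaces of W x k that meet the
    fibre over 0 only in 0. *)
Definition linear_relation (G : set (W * k)) :=
  G (0, 0) /\ forall c u a v b, G (u, a) -> G (v, b) -> G (c *: u + v, c * a + b).

Lemma linear_relation_extends (G : set (W * k)) : linear_relation G ->
  (forall a, G (0, a) -> a = 0) ->
  exists f : W -> k, scalar f /\ forall w a, G (w, a) -> f w = a.
Proof.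
move=> hG hG0.
pose good (B : set (W * k)) :=
  [/\ linear_relation B, forall a, B (0, a) -> a = 0 & G `<=` B].
have [|M [hM hmax]] := @Zorn_bigcup _ [set B | B = set0 \/ good B].
  move=> C hC htot; set U := \bigcup_(X in C) X.
  case: (pselect (exists X, C X /\ X !=set0)) => [[X [hX hX0]]|hno]; last first.
    left; apply/seteqP; split=> // u [X hX hu]; case: hno; exists X; split=> //.
    by exists u.
  have hCg Y u : C Y -> Y u -> good Y.
    by move=> hY hu; case: (hC _ hY) => // e; move: hu; rewrite e.
  have [x0 hx0] := hX0; have [[X1 X2] X3 X4] := hCg _ _ hX hx0.
  right; split; last 1 first.
  - by move=> g hg; exists X => //; apply: X4.
  - split; first by exists X.
    move=> c u a v b [Y hY hu] [Z hZ hv].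
    have [[_ Y2] _ _] := hCg _ _ hY hu; have [[_ Z2] _ _] := hCg _ _ hZ hv.
    case: (htot _ _ hY hZ) => h.
      by exists Z => //; apply: Z2 => //; apply: h.
    by exists Y => //; apply: Y2 => //; apply: h.
  - by move=> a [Y hY hu]; have [_ + _] := hCg _ _ hY hu; apply.
have [[M0 Ml] Mf MG] : good M.
  case: hM => // e; exfalso; apply: (hmax G); last by right; split.
  by rewrite e; split=> // h; have := h _ hG.1.
have dom w : exists a, M (w, a).
  apply: contrapT => hw.
  pose M' : set (W * k) := [set z | exists v c, M (v, z.2) /\ z.1 = v + c *: w].
  apply: (hmax M').
    split=> [[v a] hv|h].
      by exists v, 0; split=> //=; rewrite scale0r addr0.
    apply: hw; exists 0; apply: h; exists 0, 1; split=> //=.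
    by rewrite scale1r add0r.
  right; split.
  - split=> [|c u a v b [u' [c1 [/= hu ->]]] [v' [c2 [/= hv ->]]]].
      by exists 0, 0; split=> //=; rewrite scale0r addr0.
    exists (c *: u' + v'), (c * c1 + c2); split=> /=; first exact: Ml.
    by rewrite scalerDr scalerDl scalerA addrACA.
  - move=> a [v [c [/= hv /esym/eqP]]]; rewrite addr_eq0 => /eqP ev.
    have [c0|c0] := eqVneq c 0.
      by apply: Mf; rewrite c0 scale0r oppr0 in ev; rewrite -ev.
    exfalso; apply: hw; exists (- c^-1 * a + 0).
    have -> : w = - c^-1 *: v + 0.
      by rewrite ev scalerN scaleNr opprK scalerA mulVf // scale1r addr0.
    exact: Ml.
  - by move=> [v a] /MG hv; exists v, 0; split=> //=; rewrite scale0r addr0.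
have [f hf] := choice dom.
have Mfun w a b : M (w, a) -> M (w, b) -> a = b.
  move=> ha hb; apply/eqP; rewrite -subr_eq0; apply/eqP; apply: Mf.
  have := Ml (-1) _ _ _ _ hb ha; rewrite scaleN1r addNr mulN1r addrC.
  by [].
exists f; split=> [c u v|w a /MG hw]; last exact: Mfun (hf w) hw.
by apply: Mfun (hf _) _; apply: Ml.
Qed.

(** Prescribing g on S1 and zero on S2 is consistent on S1 + S2 because g vanishes on the
    intersection. *)
Lemma functional_glue (S1 S2 : set W) (g : W -> k) : subspace S1 -> subspace S2 ->
  scalar g -> (forall w, S1 w -> S2 w -> g w = 0) ->
  exists f : W -> k, [/\ scalar f, forall w, S1 w -> f w = g w &
    forall w, S2 w -> f w = 0].
Proof.
move=> [z1 l1] [z2 l2] lg hg.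
have g0 : g 0 = 0 by apply: hg.
have gZ c u : g (c *: u) = c * g u by have := lg c u 0; rewrite !addr0 g0 addr0.
pose G : set (W * k) := [set z | exists u v, [/\ S1 u, S2 v, z.1 = u + v & z.2 = g u]].
have [||f [lf hf]] := @linear_relation_extends G.
- split; first by exists 0, 0; split=> //=; rewrite addr0.
  move=> c _ _ _ _ [u [v [/= hu hv -> ->]]] [u' [v' [/= hu' hv' -> ->]]].
  exists (c *: u + u'), (c *: v + v'); split=> /=; [exact: l1 | exact: l2 | |].
    by rewrite scalerDr addrACA.
  by rewrite lg.
- move=> a [u [v [/= hu hv e ->]]]; apply: hg => //.
  have -> : u = (-1) *: v + 0.
    by apply/eqP; rewrite addr0 scaleN1r -addr_eq0 -e.
  exact: l2.
exists f; split=> // w hw; apply: hf.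
  by exists w, 0; split=> //=; rewrite addr0.
by exists 0, w; split=> //=; rewrite add0r.
Qed.

Lemma functional_factor (V : lmodType k) (T : V -> W) (psi : V -> k) :
  linear T -> scalar psi -> (forall v, T v = 0 -> psi v = 0) ->
  exists f : W -> k, scalar f /\ forall v, psi v = f (T v).
Proof.
move=> lT lp h.
pose G : set (W * k) := [set z | exists v, z.1 = T v /\ z.2 = psi v].
have T0 : T 0 = 0.
  by have := lT (-1) 0 0; rewrite scaler0 addr0 scaleN1r addNr.
have [||f [lf hf]] := @linear_relation_extends G.
- split; first by exists 0; split=> //=; rewrite h.
  by move=> c _ _ _ _ [u [/= -> ->]] [v [/= -> ->]]; exists (c *: u + v); rewrite lT lp.
- by move=> a [v [/= e ->]]; apply: h.
by exists f; split=> // v; apply/esym/hf; exists v.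
Qed.

Lemma functional_separates (S : set W) w : subspace S -> ~ S w ->
  exists f : W -> k, [/\ scalar f, forall u, S u -> f u = 0 & f w = 1].
Proof.
move=> [S0 Sl] hw.
pose G : set (W * k) := [set z | exists u, S u /\ z.1 = u + z.2 *: w].
have [||f [lf hf]] := @linear_relation_extends G.
- split; first by exists 0; split=> //=; rewrite scale0r addr0.
  move=> c _ a _ b [u [/= hu ->]] [v [/= hv ->]]; exists (c *: u + v); split=> /=.
    exact: Sl.
  by rewrite scalerDr scalerDl scalerA addrACA.
- move=> a [u [/= hu /esym/eqP]]; rewrite addr_eq0 => /eqP e.
  apply/eqP/negPn/negP => a0; apply: hw.
  have -> : w = - a^-1 *: u + 0.
    by rewrite e scalerN scaleNr opprK scalerA mulVf // scale1r addr0.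
  exact: Sl.
exists f; split=> //.
  by move=> u hu; apply: hf; exists u; split=> //=; rewrite scale0r addr0.
by apply: hf; exists 0; split=> //=; rewrite scale1r add0r.
Qed.

End FunctionalExtension.

Lemma mxtraceB (R : pzRingType) p (A B : 'M[R]_p) : \tr (A - B) = \tr A - \tr B.
Proof. exact: raddfB. Qed.

(** * Complexes of matrices with null-homotopies of a regular sequence *)

Section Homotopies.
Variables (R : comNzRingType) (n : nat) (y : 'I_n -> R).
Hypothesis y_regular : forall (T : {set 'I_n}) j u,
  j \notin T -> span T y (y j * u) -> span T y u.

Definition mx_span (T : {set 'I_n}) p q (F : 'M[R]_(p, q)) : Prop :=
  forall i j, span T y (F i j).

Section Closure.
Variables (T : {set 'I_n}) (p q : nat).
Implicit Types F G : 'M[R]_(p, q).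
Let hT := span_is_ideal T y.

Lemma mx_span0 : mx_span T (0 : 'M[R]_(p, q)).
Proof. by move=> i j; rewrite mxE; exact: ideal0. Qed.

Lemma mx_spanD F G : mx_span T F -> mx_span T G -> mx_span T (F + G).
Proof. by move=> hF hG i j; rewrite mxE; apply: idealD. Qed.

Lemma mx_spanZ a F : mx_span T F -> mx_span T (a *: F).
Proof. by move=> hF i j; rewrite mxE; apply: idealMl. Qed.

Lemma mx_spanN F : mx_span T F -> mx_span T (- F).
Proof. by rewrite -scaleN1r; apply: mx_spanZ. Qed.

Lemma mx_spanB F G : mx_span T F -> mx_span T G -> mx_span T (F - G).
Proof. by move=> hF hG; apply: mx_spanD => //; apply: mx_spanN. Qed.

Lemma mx_span_y a F : a \in T -> mx_span T (y a *: F).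
Proof. by move=> ha i j; rewrite mxE; apply: idealMr => //; apply: span_mem. Qed.

Lemma mx_span_tr F (phi : 'M[R]_(q, p)) : mx_span T F -> span T y (\tr (phi *m F)).
Proof.
move=> hF; apply: ideal_sum => // i _; rewrite mxE; apply: ideal_sum => // j _.
by apply: idealMl.
Qed.

Lemma mx_span_linear p' q' (L : {linear 'M[R]_(p, q) -> 'M[R]_(p', q')}) F :
  mx_span T F -> mx_span T (L F).
Proof.
move=> hF; rewrite [F]matrix_sum_delta !linear_sum => i0 j0 /=.
rewrite summxE; apply: ideal_sum => // i _; rewrite linear_sum /= summxE.
by apply: ideal_sum => // j _; rewrite linearZ /= mxE; apply: idealMr.
Qed.

Lemma mx_span_decomp F : mx_span T F ->
  exists v : 'I_n -> 'M[R]_(p, q), F = \sum_(a in T) y a *: v a.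
Proof.
move=> hF; have /choice [v hv] : forall ij : 'I_p * 'I_q, exists v : 'I_n -> R,
    F ij.1 ij.2 = \sum_(a in T) v a * y a by move=> ij; exact: hF.
exists (fun a => \matrix_(i, j) v (i, j) a); apply/matrixP => i j.
rewrite summxE (hv (i, j)); apply: eq_bigr => a _.
by rewrite !mxE mulrC.
Qed.

Lemma mx_span_cancel a F : a \notin T -> mx_span T (y a *: F) -> mx_span T F.
Proof. by move=> ha h i j; have := h i j; rewrite mxE; apply: y_regular. Qed.

End Closure.

Lemma mx_span_sub (T T' : {set 'I_n}) p q (F : 'M[R]_(p, q)) :
  T \subset T' -> mx_span T F -> mx_span T' F.
Proof. by move=> h hF i j; apply: (span_sub h). Qed.

Lemma mx_span_cons a s p q (F : 'M[R]_(p, q)) : a \notin s ->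
  mx_span [set b in a :: s] F ->
  exists u, mx_span [set b in s] (F - y a *: u).
Proof.
move=> ha /mx_span_decomp [v ->]; exists (v a).
have -> : [set b in a :: s] = a |: [set b in s].
  by apply/setP => b; rewrite !inE.
rewrite big_setU1 ?inE //= addrAC subrr add0r.
elim/big_rec: _ => [|b F' hb hF']; first exact: mx_span0.
by apply: mx_spanD => //; apply: mx_span_y.
Qed.

Variables (p q : nat).
Local Notation E := 'M[R]_(p, q).
Variables (d : {linear E -> E}) (lam : 'I_n -> {linear E -> E}).
Hypothesis d_sq : forall e, d (d e) = 0.
Hypothesis lam_homotopy : forall i e, d (lam i e) + lam i (d e) = y i *: e.

Definition iterated (s : seq 'I_n) (e : E) : E := foldr (fun i => lam i) e s.

Lemma iterated_cat s1 s2 e : iterated (s1 ++ s2) e = iterated s1 (iterated s2 e).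
Proof. by rewrite /iterated foldr_cat. Qed.

Lemma iterated_linear s : linear (iterated s).
Proof. by elim: s => [|a s IH] c e f //=; rewrite IH linearP. Qed.

HB.instance Definition _ s := GRing.isLinear.Build R E E _ (iterated s) (iterated_linear s).

Lemma iteratedD s e f : iterated s (e + f) = iterated s e + iterated s f.
Proof. exact: linearD. Qed.

Lemma iteratedB s e f : iterated s (e - f) = iterated s e - iterated s f.
Proof. exact: linearB. Qed.

Lemma iteratedZ s c e : iterated s (c *: e) = c *: iterated s e.
Proof. exact: linearZ. Qed.

Lemma d_lam i e : d (lam i e) = y i *: e - lam i (d e).
Proof. by rewrite -lam_homotopy addrK. Qed.

(** Modulo y_a, the homotopy [lam a] anticommutes with [d]. *)
Lemma d_iterated s e :
  mx_span [set a in s] (d (iterated s e) - (-1) ^+ size s *: iterated s (d e)).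
Proof.
elim: s e => [|a s IH] e /=.
  by rewrite expr0 scale1r subrr; exact: mx_span0.
rewrite d_lam exprS mulN1r scaleNr opprK.
have -> : (-1) ^+ size s *: lam a (iterated s (d e)) = lam a ((-1) ^+ size s *: iterated s (d e)).
  by rewrite linearZ.
have -> : y a *: iterated s e - lam a (d (iterated s e)) +
    lam a ((-1) ^+ size s *: iterated s (d e)) =
    y a *: iterated s e -
    lam a (d (iterated s e) - (-1) ^+ size s *: iterated s (d e)).
  by rewrite linearB /= opprB addrA addrAC.
apply: mx_spanB; first by apply: mx_span_y; rewrite !inE eqxx.
apply: mx_span_linear; apply: mx_span_sub (IH e).
by apply/fintype.subsetP => b; rewrite !inE => ->; rewrite orbT.
Qed.

Lemma d_iterated_cycle s e : d e = 0 -> mx_span [set a in s] (d (iterated s e)).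
Proof. by move=> he; have := d_iterated s e; rewrite he linear0 scaler0 subr0. Qed.

(** Write e - d h = y_a u modulo the remaining y. Applying d and cancelling y_a makes u a cycle
    modulo them, so y_a u is there d(lam_a u) and is absorbed into h. *)
Lemma boundary_mod s e h : uniq s -> d e = 0 -> mx_span [set a in s] (e - d h) ->
  exists h', e = d h'.
Proof.
elim: s h => [|a s IH] h /=.
  move=> _ _ he; exists h; apply/eqP; rewrite -subr_eq0; apply/eqP/matrixP => i j.
  by have [v] := he i j; rewrite big1 => [->|b]; rewrite ?inE // mxE.
move=> /andP [ha hs] he hspan; have [u hu] := mx_span_cons ha hspan.
apply: (IH (h + lam a u)) => //.
have hdu : mx_span [set b in s] (d u).
  apply: (@mx_span_cancel _ _ _ a); first by rewrite inE.
  have := mx_span_linear d hu; rewrite linearB /= linearB /= he d_sq subrr sub0r.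
  by move/mx_spanN; rewrite opprK linearZ.
rewrite linearD /= d_lam opprD addrA opprB addrA addrAC.
by apply: mx_spanD => //; apply: mx_span_linear.
Qed.

Definition cocycle (phi : 'M[R]_(q, p)) := forall e, \tr (phi *m d e) = 0.

(** Since phi kills d(lam_j ...), y_j times the trace is tr (phi lam_j d(...)), where d(...)
    vanishes modulo the y of s; regularity cancels y_j. *)
Lemma iterated_missing s e phi j : d e = 0 -> cocycle phi -> j \notin s ->
  span [set a in s] y (\tr (phi *m iterated s e)).
Proof.
move=> he hphi hj; apply: (@y_regular _ j); first by rewrite inE.
have -> : y j * \tr (phi *m iterated s e) = \tr (phi *m lam j (d (iterated s e))).
  rewrite -mxtraceZ scalemxAr -lam_homotopy mulmxDr mxtraceD hphi add0r.
  by [].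
by apply: mx_span_tr; apply: mx_span_linear; apply: d_iterated_cycle.
Qed.

Local Notation full := (span [set: 'I_n] y).

Lemma full_sub (T : {set 'I_n}) : span T y `<=` full.
Proof. by apply: span_sub; rewrite finset.subsetT. Qed.

(** If d e = y_a u modulo the other y, then e = lam_a u + v with u and v cycles modulo the others.
    Induction treats both, and the product coming from v misses a. The prefix [pre] allows the
    induction hypothesis for u to be used behind lam_a. *)
Lemma cycle_mod_decomp s e : uniq s -> mx_span [set a in s] (d e) ->
  exists2 e1, d e1 = 0 & forall pre, {in pre, forall a, a \notin s} ->
    forall phi, cocycle phi -> full (\tr (phi *m iterated pre (e - iterated s e1))).
Proof.
have hI := span_is_ideal [set: 'I_n] y.
elim: s e => [|a s IH] e /=.
  move=> _ he; exists e => [|pre _ phi _].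
    apply/matrixP => i j; rewrite mxE.
    by have [v ->] := he i j; rewrite big1 // => b; rewrite inE.
  by rewrite subrr linear0 mulmx0 mxtrace0; exact: ideal0.
move=> /andP [ha hs] hspan; have [u hu] := mx_span_cons ha hspan.
have hdu : mx_span [set b in s] (d u).
  apply: (@mx_span_cancel _ _ _ a); first by rewrite inE.
  have := mx_span_linear d hu; rewrite linearB /= d_sq sub0r.
  by move/mx_spanN; rewrite opprK linearZ.
have hdv : mx_span [set b in s] (d (e - lam a u)).
  rewrite linearB /= d_lam opprB addrA addrAC.
  by apply: mx_spanD => //; apply: mx_span_linear.
have [u1 hu1 Hu] := IH u hs hdu; have [v1 hv1 Hv] := IH _ hs hdv.
exists u1 => // pre hpre phi hphi.
have hpre' : {in pre, forall b, b \notin s}.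
  by move=> b /hpre; rewrite inE negb_or => /andP [].
have -> : e - lam a (iterated s u1) =
    lam a (u - iterated s u1) + ((e - lam a u - iterated s v1) + iterated s v1).
  by rewrite subrK linearB /= [RHS]addrC addrA subrK.
rewrite iteratedD mulmxDr mxtraceD iteratedD mulmxDr mxtraceD; apply: idealD => //.
  have := Hu (pre ++ [:: a]) _ phi hphi; rewrite iterated_cat; apply.
  by move=> b; rewrite mem_cat inE => /orP [/hpre'|/eqP ->].
apply: idealD => //; first exact: Hv.
rewrite -iterated_cat; apply: full_sub; apply: (@iterated_missing _ _ _ a) => //.
rewrite mem_cat negb_or ha andbT; apply/negP => /hpre.
by rewrite inE eqxx.
Qed.

Section Antisymmetry.
Variables (c : 'I_n -> 'I_n -> R) (h : 'I_n -> 'I_n -> {linear E -> E}).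
Hypothesis anticommute : forall a b e,
  lam a (lam b e) + lam b (lam a e) = c a b *: e - (d (h a b e) + h a b (d e)).
Variables (e : E) (phi : 'M[R]_(q, p)).
Hypotheses (e_cycle : d e = 0) (phi_cocycle : cocycle phi).

Local Notation val s := (\tr (phi *m iterated s e)).
Let hI : is_ideal full := span_is_ideal _ _.

(** Of the error terms in [anticommute], the scalar one leaves a product missing a; in the homotopy
    one, d is moved onto the cocycle phi or the cycle e. *)
Lemma iterated_swap_adjacent s1 a b s2 : a \notin s1 ++ s2 ->
  full (val (s1 ++ [:: a, b & s2]) + val (s1 ++ [:: b, a & s2])).
Proof.
move=> ha; rewrite !iterated_cat /= -mxtraceD -mulmxDr -iteratedD anticommute.
rewrite iteratedB mulmxBr mxtraceB; apply: idealB => //.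
  rewrite iteratedZ -scalemxAr mxtraceZ; apply: idealMl => //.
  by rewrite -iterated_cat; apply: full_sub; apply: (iterated_missing _ _ ha).
rewrite iteratedD mulmxDr mxtraceD; apply: idealD => //.
  set X := h a b _.
  have := mx_span_tr phi (d_iterated s1 X).
  rewrite mulmxBr mxtraceB phi_cocycle sub0r -scalemxAr mxtraceZ.
  move/(idealN (span_is_ideal _ _)); rewrite opprK.
  move/(idealMl (span_is_ideal _ _) ((-1) ^+ size s1)).
  by rewrite mulrA -expr2 sqrr_sign mul1r; apply: full_sub.
apply: full_sub; apply: mx_span_tr; do 2 apply: mx_span_linear.
exact: (d_iterated_cycle s2 e_cycle).
Qed.

Lemma iterated_move s1 a s2 s3 : uniq (s1 ++ a :: s2 ++ s3) ->
  full (val (s1 ++ a :: s2 ++ s3) - (-1) ^+ size s2 * val (s1 ++ s2 ++ a :: s3)).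
Proof.
elim: s2 s1 => [|b s2 IH] s1 /= hu.
  by rewrite expr0 mul1r subrr; exact: ideal0.
have hu' : uniq (rcons s1 b ++ a :: s2 ++ s3).
  rewrite -(perm_uniq (_ : perm_eq (s1 ++ [:: a, b & s2 ++ s3]) _)) //.
  by rewrite cat_rcons perm_cat2l -[a :: b :: _]/([:: a] ++ [:: b] ++ _) perm_catCA.
have h1 := IH (rcons s1 b) hu'; rewrite !cat_rcons in h1.
have h2 : full (val (s1 ++ [:: a, b & s2 ++ s3]) + val (s1 ++ [:: b, a & s2 ++ s3])).
  apply: iterated_swap_adjacent.
  move: hu; rewrite -[a :: b :: _]/([:: a] ++ b :: _) uniq_catCA cat1s cons_uniq => /andP [+ _].
  by rewrite !(mem_cat, in_cons, negb_or) => /and4P [-> _ -> ->].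
set v1 := val _ in h2 *; set v2 := val (s1 ++ [:: b, a & _]) in h1 h2.
set v3 := val (s1 ++ b :: s2 ++ a :: s3) in h1 *.
have -> : v1 - (-1) ^+ (size s2).+1 * v3 = (v1 + v2) - (v2 - (-1) ^+ size s2 * v3).
  by rewrite exprS; ring.
exact: idealB.
Qed.

(** Both words are compared with s1 s2 b a s3: one is [size s2 + 1] adjacent swaps away, the other
    [size s2]. *)
Lemma iterated_swap s1 a s2 b s3 : uniq (s1 ++ a :: s2 ++ b :: s3) ->
  full (val (s1 ++ a :: s2 ++ b :: s3) + val (s1 ++ b :: s2 ++ a :: s3)).
Proof.
move=> hu.
have hp : perm_eq (s1 ++ a :: s2 ++ b :: s3) (s1 ++ b :: s2 ++ a :: s3).
  by apply/seq.permP => P; rewrite !count_cat /= !count_cat /=; ring.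
have hu2 : uniq (s1 ++ b :: s2 ++ a :: s3) by rewrite -(perm_uniq hp).
have h1 := @iterated_move s1 a (s2 ++ [:: b]) s3; have h2 := @iterated_move s1 b s2 (a :: s3).
rewrite -!catA /= in h1; move/(_ hu): h1 => h1; move/(_ hu2): h2 => h2.
rewrite size_cat addn1 exprS in h1.
set v1 := val _ in h1 *; set v2 := val _ in h2 *; set v3 := val _ in h1; rewrite -/v3 in h2.
have -> : v1 + v2 = (v1 - -1 * (-1) ^+ size s2 * v3) + (v2 - (-1) ^+ size s2 * v3) by ring.
exact: idealD.
Qed.

Lemma iterated_tperm s a b : uniq s -> a \in s -> b \in s -> a != b ->
  full (val (map (tperm a b) s) + val s).
Proof.
have key s1 s2 s3 a' b' : uniq (s1 ++ a' :: s2 ++ b' :: s3) ->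
    map (tperm a' b') (s1 ++ a' :: s2 ++ b' :: s3) = s1 ++ b' :: s2 ++ a' :: s3.
  move=> hu; rewrite map_cat /= map_cat /= tpermL tpermR.
  have hid r : {in r, forall z, z != a' /\ z != b'} -> map (tperm a' b') r = r.
    by move=> hr; apply: map_id_in => z /hr [h1 h2]; rewrite tpermD // eq_sym.
  move: hu; rewrite cat_uniq /= has_cat /= mem_cat inE cat_uniq /= !negb_or.
  move=> /and3P [_ /and3P [na1 h12 /andP [nb1 h13]]].
  move=> /and3P [/and3P [na2 nab na3] _ /and3P [/andP [nb2 h23] nb3 _]].
  congr (_ ++ _ :: _ ++ _ :: _); apply: hid => z hz; split;
    by apply: contraTneq hz => ->.
move=> hu ha hb ne; case/splitPr: ha hu hb => s1 s2 hu.
rewrite mem_cat in_cons eq_sym (negbTE ne) /= => /orP [] hb.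
  case/splitPr: hb hu => s0 s1'; rewrite -catA /= => hu.
  by rewrite tpermC key // addrC; apply: iterated_swap.
case/splitPr: hb hu => s0 s1' hu.
by rewrite key // addrC; apply: iterated_swap.
Qed.

Lemma iterated_perm (sigma : 'S_n) :
  full (val (map sigma (enum 'I_n)) - (-1) ^+ sigma * val (enum 'I_n)).
Proof.
case: (prod_tpermP sigma) => ts -> {sigma}; elim/last_ind: ts => [_|ts [a b] IH].
  rewrite big_nil odd_perm1 expr0 mul1r (eq_map (perm1 (T := _))) map_id subrr.
  exact: ideal0.
rewrite all_rcons big_rcons /= /dpair /= => /andP [ne /IH {}IH].
set pi := (\prod_(t <- ts) _)%g in IH *.
have -> : map (pi * tperm a b)%g (enum 'I_n) = map (tperm a b) (map pi (enum 'I_n)).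
  by rewrite -map_comp; apply: eq_map => i /=; rewrite permM.
rewrite odd_permM odd_tperm ne signr_addb expr1 mulrN1.
set s := map pi _ in IH *.
have mem_s i : i \in s.
  apply/mapP; exists (pi^-1%g i); rewrite ?permKV //.
  by rewrite fintype.mem_enum.
have us : uniq s by rewrite map_inj_uniq ?enum_uniq //; exact: perm_inj.
have hab := iterated_tperm us (mem_s a) (mem_s b) ne.
set v1 := val (map _ s) in hab *; set v0 := val (enum _) in IH *.
set sg : R := (-1) ^+ odd_perm pi in IH *; move: sg IH => sg IH.
have -> : v1 - - sg * v0 = (v1 + val s) - (val s - sg * v0) by ring.
exact: idealB.
Qed.

Lemma iterated_alternating_sum :
  full (\sum_(sigma : 'S_n) (-1) ^+ sigma * val (map sigma (enum 'I_n))
        - n`!%:R * val (enum 'I_n)).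
Proof.
have -> : n`!%:R * val (enum 'I_n) =
    \sum_(sigma : 'S_n) (-1) ^+ sigma * ((-1) ^+ sigma * val (enum 'I_n)).
  under eq_bigr => sigma _ do rewrite mulrA -expr2 sqrr_sign mul1r.
  by rewrite sumr_const card_Sn mulr_natl.
rewrite -sumrB; apply: ideal_sum => // sigma _; rewrite -mulrBr.
by apply: idealMl => //; exact: iterated_perm.
Qed.

End Antisymmetry.
End Homotopies.

(** * Representing functionals that kill boundaries by cycles *)

Section Duality.
Variables (k : fieldType) (R : comAlgType k) (n : nat) (y : 'I_n -> R).
Hypothesis y_regular : forall (T : {set 'I_n}) j u,
  j \notin T -> span T y (y j * u) -> span T y u.
Local Notation full := (span [set: 'I_n] y).
Variable theta : R -> k.
Hypotheses (theta_scalar : scalar theta)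
  (theta_full : forall u, full u -> theta u = 0)
  (theta_nondeg : forall u, (forall r, theta (r * u) = 0) -> full u)
  (theta_rep : forall g : R -> k, scalar g -> (forall u, full u -> g u = 0) ->
     exists c, forall r, g r = theta (r * c)).
Variables (p q : nat).
Variables (d : {linear 'M[R]_(p, q) -> 'M[R]_(p, q)})
  (lam : 'I_n -> {linear 'M[R]_(p, q) -> 'M[R]_(p, q)}).
Variables (d' : {linear 'M[R]_(q, p) -> 'M[R]_(q, p)})
  (lam' : 'I_n -> {linear 'M[R]_(q, p) -> 'M[R]_(q, p)}).
Hypotheses (d_sq : forall e, d (d e) = 0) (d'_sq : forall e, d' (d' e) = 0).
Hypothesis lam_homotopy : forall i e, d (lam i e) + lam i (d e) = y i *: e.
Hypothesis lam'_homotopy : forall i e, d' (lam' i e) + lam' i (d' e) = y i *: e.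
Hypothesis d_adjoint : forall phi e, \tr (phi *m d e) = \tr (d' phi *m e).

Let theta0 : theta 0 = 0.
Proof. by apply: theta_full; apply: ideal0; exact: span_is_ideal. Qed.

Let thetaD u v : theta (u + v) = theta u + theta v.
Proof. by have := theta_scalar 1 u v; rewrite scale1r mul1r. Qed.

Lemma theta_functional_rep (g : kmatrix R q p -> k) : scalar g ->
  (forall phi, mx_span y [set: 'I_n] (phi : 'M[R]_(q, p)) -> g phi = 0) ->
  exists e : 'M[R]_(p, q), forall phi : 'M[R]_(q, p), g phi = theta (\tr (phi *m e)).
Proof.
move=> lg hg.
have g0 : g 0 = 0 by apply: hg; exact: mx_span0.
have gD u v : g (u + v) = g u + g v by have := lg 1 u v; rewrite scale1r mul1r.
have hi : forall ij : 'I_q * 'I_p, exists c, forall r : R,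
    g (r *: delta_mx ij.1 ij.2 : 'M[R]_(q, p)) = theta (r * c).
  move=> ij; apply: (theta_rep (g := fun r => g (r *: delta_mx ij.1 ij.2 : 'M[R]_(q, p)))).
    move=> c r s; rewrite -lg; congr g; rewrite kmatrix_scaleE scalerA scalerDl.
    by rewrite mulr_algl.
  move=> u hu; apply: hg => i j; rewrite mxE; apply: idealMr => //.
  exact: span_is_ideal.
have [c hc] := choice hi.
exists (\matrix_(j, i) c (i, j)) => phi.
rewrite [in LHS](matrix_sum_delta phi) /mxtrace.
have gsum (I : Type) (r : seq I) (F : I -> kmatrix R q p) :
    g (\sum_(i <- r) F i) = \sum_(i <- r) g (F i).
  by elim/big_rec2: _ => [|i x1 x2 _ <-]; rewrite ?gD.
have tsum (I : Type) (r : seq I) (F : I -> R) :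
    theta (\sum_(i <- r) F i) = \sum_(i <- r) theta (F i).
  by elim/big_rec2: _ => [|i x1 x2 _ <-]; rewrite ?thetaD.
rewrite gsum tsum; apply: eq_bigr => i _; rewrite gsum mxE tsum; apply: eq_bigr => j _.
by rewrite (hc (i, j)) mxE.
Qed.

(* A functional that kills the boundaries also kills the cycles in [y E'],
   which are boundaries; so it can be changed, off the cycles, into one that
   factors through [E' / y E'], where it is represented by [theta]. *)
Theorem cycle_represents (g : kmatrix R q p -> k) s : scalar g ->
  (forall phi, g (d' phi) = 0) -> uniq s -> (forall i, i \in s) ->
  exists e, d e = 0 /\
    forall phi, d' phi = 0 -> g phi = theta (\tr (phi *m iterated lam s e)).
Proof.
move=> lg hg us hs.
have es : [set a in s] = [set: 'I_n]%SET by apply/setP => a; rewrite !inE hs.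
have hI := span_is_ideal [set: 'I_n] y.
have dZ (c : k) (u : kmatrix R q p) : d' (c *: u : kmatrix R q p) = c%:A *: d' u.
  by rewrite kmatrix_scaleE linearZ.
have [|||g1 [lg1 hg1 hg1y]] := @functional_glue k (kmatrix R q p)
    [set phi | d' phi = 0] [set phi | mx_span y [set: 'I_n] (phi : 'M[R]_(q, p))] g _ _ lg.
- split=> [|c u v /= hu hv] /=; first exact: linear0.
  by rewrite (linearD d') dZ hu hv scaler0 addr0.
- split=> [|c u v /= hu hv] /=; first exact: mx_span0.
  by apply: mx_spanD => //; apply: mx_spanZ.
- move=> phi /= hphi hy; have [|h ->] := @boundary_mod _ _ _ y_regular _ _ _ _ d'_sq lam'_homotopy
    s phi 0 us hphi; last exact: hg.
  by rewrite linear0 subr0 es.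
have [e0 he0] := theta_functional_rep lg1 hg1y.
(* Testing against multiples of a matrix unit isolates one entry of d e0. Since g1 kills boundaries,
   [theta] kills all multiples of that entry, so it lies in (y) by nondegeneracy. *)
have hde0 : mx_span y [set a in s] (d e0).
  rewrite es => i j; apply: theta_nondeg => r.
  pose phi : 'M[R]_(q, p) := r *: delta_mx j i.
  have -> : r * d e0 i j = \tr (phi *m d e0).
    rewrite /phi -scalemxAl mxtraceZ; congr (_ * _).
    rewrite /mxtrace (bigD1 j) //= big1 ?addr0 => [|l ne]; rewrite mxE.
      rewrite (bigD1 i) //= big1 ?addr0 => [|l ne]; rewrite mxE eqxx /=.
        by rewrite eqxx mul1r.
      by rewrite (negbTE ne) mul0r.
    by rewrite big1 // => l' _; rewrite mxE (negbTE ne) mul0r.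
  by rewrite d_adjoint -he0 hg1 ?hg //= d'_sq.
have [e1 he1 H] := cycle_mod_decomp y_regular d_sq lam_homotopy us hde0.
exists e1; split=> // phi hphi.
rewrite -hg1 // he0 -[e0](subrK (iterated lam s e1)) mulmxDr mxtraceD thetaD.
rewrite theta_full ?add0r //.
apply: (H [::]) => // e; by rewrite d_adjoint hphi mul0mx mxtrace0.
Qed.

End Duality.

(** * Antisymmetrised products and determinants *)

Section AlternatingProducts.
Variable R : comNzRingType.

Definition alternating_prod n r (D : 'I_n -> 'M[R]_r) : 'M[R]_r :=
  \sum_(sigma : 'S_n) (-1) ^+ sigma *: \prod_(i < n) D (sigma i).

(** A Cauchy-Binet expansion without commutativity: the coefficient of the word given by f is the
    determinant of the columns of C selected by f, zero unless f is injective. *)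
Lemma alternating_prod_linear n r (C : 'M[R]_n) (D : 'I_n -> 'M[R]_r) :
  alternating_prod (fun j => \sum_l C j l *: D l) = \det C *: alternating_prod D.
Proof.
pose S (f : {ffun 'I_n -> 'I_n}) : R := \sum_(s : 'S_n) (-1) ^+ s * \prod_i C (s i) (f i).
pose W (f : {ffun 'I_n -> 'I_n}) := \prod_i D (f i).
have -> : alternating_prod (fun j => \sum_l C j l *: D l) = \sum_f S f *: W f.
  under [RHS]eq_bigr => f _ do rewrite scaler_suml.
  rewrite exchange_big; apply: eq_bigr => s _ /=.
  rewrite bigA_distr_bigA scaler_sumr; apply: eq_bigr => f _.
  rewrite -scalerA; congr (_ *: _); rewrite /W.
  elim/big_rec3: _ => [|i u v t _ ->]; first by rewrite scale1r.
  by rewrite /= -!mulmxE -scalemxAl -scalemxAr scalerA.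
pose Cf (f : {ffun 'I_n -> 'I_n}) : 'M[R]_n := \matrix_(i, j) C j (f i).
have SE f : S f = \det (Cf f).
  by apply: eq_bigr => s _; congr (_ * _); apply: eq_bigr => i _; rewrite mxE.
rewrite (bigID (fun f : {ffun 'I_n -> 'I_n} => injectiveb f)) /= addrC big1 ?add0r => [|f Uf].
  rewrite (reindex (@pval _)) /=; last first.
    pose in_Sn := insubd (1%g : 'S_n).
    by exists in_Sn => /= f Uf; first apply: val_inj; apply: insubdK.
  rewrite scaler_sumr; apply: eq_big => [s|s _]; first by rewrite (valP s).
  rewrite SE (_ : Cf (pval s) = row_perm s C^T).
    by rewrite row_permE det_mulmx det_perm det_tr scalerA mulrC /W pvalE.
  by apply/matrixP => i j; rewrite !mxE pvalE.
rewrite SE; have [i1 [i2 [ne e]]] : exists i1 i2, i1 != i2 /\ f i1 = f i2.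
  have /injectivePn [i1 [i2 ne e]] := Uf; by exists i1, i2.
by rewrite (determinant_alternate ne) ?scale0r // => j; rewrite !mxE e.
Qed.

End AlternatingProducts.

(** * Parity of matrices and the grading operator *)

Section Parity.
Variable R : comNzRingType.

Definition homogeneous p q (u : 'I_p -> bool) (v : 'I_q -> bool) (c : bool)
  (A : 'M[R]_(p, q)) := forall i j, u i (+) v j != c -> A i j = 0.

(** The grading operator: products with it express degree-dependent signs by operations linear on
    matrices of mixed parity. *)
Definition sign_mx p (u : 'I_p -> bool) : 'M[R]_p := diag_mx (\row_i (-1) ^+ u i).

Definition component p q (u : 'I_p -> bool) (v : 'I_q -> bool) (c : bool)
  (A : 'M[R]_(p, q)) : 'M[R]_(p, q) :=
  \matrix_(i, j) if u i (+) v j == c then A i j else 0.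

Lemma sign_mxK p (u : 'I_p -> bool) : sign_mx u *m sign_mx u = 1%:M.
Proof.
rewrite mul_diag_mx; apply/matrixP => i j; rewrite !mxE.
by case: eqP => [->|_]; rewrite ?mulr1n ?mulr0n ?mulr0 // -expr2 sqrr_sign.
Qed.

Section Rect.
Variables (p q : nat) (u : 'I_p -> bool) (v : 'I_q -> bool).
Implicit Types A B : 'M[R]_(p, q).

Lemma homogeneous_sign c A : homogeneous u v c A ->
  sign_mx u *m A *m sign_mx v = (-1) ^+ c *: A.
Proof.
move=> hA; rewrite mul_diag_mx mul_mx_diag; apply/matrixP => i j; rewrite !mxE.
have [e|ne] := boolP (u i (+) v j == c); last by rewrite hA // !mulr0 mul0r.
by rewrite mulrAC -signr_addb (eqP e).
Qed.

Lemma homogeneous_sign_swap c A : homogeneous u v c A ->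
  sign_mx u *m A = (-1) ^+ c *: (A *m sign_mx v).
Proof.
move=> hA; have := congr1 (mulmxr (sign_mx v)) (homogeneous_sign hA).
by rewrite /= -mulmxA sign_mxK mulmx1 scalemxAl.
Qed.

Lemma component_homogeneous c A : homogeneous u v c (component u v c A).
Proof. by move=> i j h; rewrite mxE (negbTE h). Qed.

Lemma component_id c A : homogeneous u v c A -> component u v c A = A.
Proof.
by move=> h; apply/matrixP => i j; rewrite mxE; case: ifP => // /negbT /h ->.
Qed.

Lemma component_other c A : homogeneous u v (~~ c) A -> component u v c A = 0.
Proof.
move=> h; apply/matrixP => i j; rewrite !mxE; case: eqP => // e; apply: h.
by rewrite e; case: (c).
Qed.

Lemma component_sum c A : A = component u v c A + component u v (~~ c) A.
Proof.
apply/matrixP => i j; rewrite !mxE.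
by case: (_ (+) _) (c) => [] [] /=; rewrite ?addr0 ?add0r.
Qed.

Lemma component_linear c : linear (component u v c).
Proof.
move=> a A B; apply/matrixP => i j; rewrite !mxE.
by case: ifP; rewrite ?mulr0 ?addr0.
Qed.

Lemma homogeneous_disjoint c A B : homogeneous u v c A -> homogeneous u v (~~ c) B ->
  A + B = 0 -> A = 0 /\ B = 0.
Proof.
move=> hA hB e; suff A0 : A = 0 by split=> //; rewrite A0 add0r in e.
have := congr1 (component u v c) e; have := component_linear c 1 A B.
rewrite !scale1r => -> ; rewrite component_id // component_other // addr0 => ->.
by apply/matrixP => i j; rewrite !mxE if_same.
Qed.

Lemma homogeneousD c A B : homogeneous u v c A -> homogeneous u v c B ->
  homogeneous u v c (A + B).
Proof. by move=> hA hB i j h; rewrite mxE hA // hB // addr0. Qed.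

Lemma homogeneousZ c a A : homogeneous u v c A -> homogeneous u v c (a *: A).
Proof. by move=> hA i j h; rewrite mxE hA // mulr0. Qed.

Lemma homogeneous0 c : homogeneous u v c (0 : 'M[R]_(p, q)).
Proof. by move=> i j _; rewrite mxE. Qed.

End Rect.

Lemma homogeneous_mul p q r (u : 'I_p -> bool) (v : 'I_q -> bool) (t : 'I_r -> bool) a b
    (A : 'M[R]_(p, q)) (B : 'M[R]_(q, r)) :
  homogeneous u v a A -> homogeneous v t b B -> homogeneous u t (a (+) b) (A *m B).
Proof.
move=> hA hB i j hij; rewrite mxE big1 // => l _.
have [e|ne] := boolP (u i (+) v l == a); last by rewrite hA // mul0r.
rewrite hB ?mulr0 //; apply: contra hij => /eqP <-; rewrite -(eqP e).
by case: (u i) (v l) (t j) => [] [] [].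
Qed.

Lemma homogeneous_sum p q (u : 'I_p -> bool) (v : 'I_q -> bool) c
    (I : finType) (P : pred I) (F : I -> 'M[R]_(p, q)) :
  (forall i, P i -> homogeneous u v c (F i)) -> homogeneous u v c (\sum_(i | P i) F i).
Proof.
move=> h; elim/big_ind: _ => //; first exact: homogeneous0.
by move=> A B; exact: homogeneousD.
Qed.

Lemma homogeneous_prod p (u : 'I_p -> bool) n (D : 'I_n -> 'M[R]_p) :
  (forall i, homogeneous u u true (D i)) -> homogeneous u u (odd n) (\prod_(i < n) D i).
Proof.
elim: n D => [|n IH] D h.
  rewrite big_ord0 => i j hij; rewrite -[1]/(1%:M) mxE; case: eqP => // e.
  by move: hij; rewrite e addbb.
rewrite big_ord_recl -mulmxE -[odd n.+1]/(true (+) odd n).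
by apply: homogeneous_mul => //; apply: IH => i; exact: h.
Qed.

End Parity.

(** * The Hom differentials on matrices of mixed degree *)

Section Operators.
Variables (R : comNzRingType) (w : R) (X Y : matfact w) (n : nat).
Local Notation p := (mf_rank Y).
Local Notation q := (mf_rank X).
Local Notation QX := (mf_d X).
Local Notation QY := (mf_d Y).
Local Notation gX := (sign_mx R (@mf_par R w X)).
Local Notation gY := (sign_mx R (@mf_par R w Y)).

Lemma mf_d_homogeneous (Z : matfact w) :
  homogeneous (@mf_par R w Z) (@mf_par R w Z) true (mf_d Z).
Proof.
move=> i j h; apply: mf_odd; move: h.
by case: (mf_par i); case: (mf_par j).
Qed.

Lemma odd_sign_swap (Z : matfact w) (A : 'M[R]_(mf_rank Z)) :
  homogeneous (@mf_par R w Z) (@mf_par R w Z) true A ->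
  sign_mx R (@mf_par R w Z) *m A = - (A *m sign_mx R (@mf_par R w Z)).
Proof. by move/homogeneous_sign_swap ->; rewrite expr1 scaleN1r. Qed.

(* The differential F |-> d F - (-1)^|F| F d on matrices of mixed degree. *)
Definition total_diff (F : 'M[R]_(p, q)) : 'M[R]_(p, q) :=
  QY *m F - gY *m F *m gX *m QX.

(* The transpose of [total_diff] for the pairing tr (phi *m F). *)
Definition dual_total_diff (phi : 'M[R]_(q, p)) : 'M[R]_(q, p) :=
  phi *m QY - gX *m QX *m phi *m gY.

Fact total_diff_linear : linear total_diff.
Proof.
move=> a F G; rewrite /total_diff !(mulmxDl, mulmxDr) -!scalemxAr -!scalemxAl.
by rewrite scalerBr opprD addrACA.
Qed.
HB.instance Definition _ := GRing.isLinear.Build R _ _ _ total_diff total_diff_linear.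

Fact dual_total_diff_linear : linear dual_total_diff.
Proof.
move=> a F G; rewrite /dual_total_diff !(mulmxDl, mulmxDr) -!scalemxAr -!scalemxAl.
by rewrite scalerBr opprD addrACA.
Qed.
HB.instance Definition _ :=
  GRing.isLinear.Build R _ _ _ dual_total_diff dual_total_diff_linear.

Lemma gYQ : gY *m QY = - (QY *m gY).
Proof. exact/odd_sign_swap/mf_d_homogeneous. Qed.

Lemma gXQ : gX *m QX = - (QX *m gX).
Proof. exact/odd_sign_swap/mf_d_homogeneous. Qed.

Lemma total_diff_sq F : total_diff (total_diff F) = 0.
Proof.
have tE G : total_diff G = QY *m G - gY *m (G *m gX *m QX) by rewrite /total_diff !mulmxA.
have h1 : F *m gX *m QX *m gX *m QX = - (w *: F).
  rewrite -(mulmxA F gX QX) gXQ mulmxN !mulNmx mulmxA -(mulmxA (F *m QX)) sign_mxK mulmx1.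
  by rewrite -mulmxA mf_sq mul_mx_scalar.
have h2 : QY *m (QY *m F) = w *: F by rewrite mulmxA mf_sq mul_scalar_mx.
have h4 : gY *m (QY *m F *m gX *m QX) = - (QY *m (gY *m (F *m gX *m QX))).
  by rewrite !mulmxA gYQ !mulNmx.
have h5 : gY *m (gY *m (F *m gX *m QX) *m gX *m QX) = F *m gX *m QX *m gX *m QX.
  by rewrite !mulmxA sign_mxK mul1mx.
rewrite [total_diff (total_diff F)]tE [total_diff F]tE mulmxBr h2 !mulmxBl mulmxBr h4 h5 h1.
by rewrite opprK [- _ + _]addrC subrr.
Qed.

Lemma dual_total_diff_sq phi : dual_total_diff (dual_total_diff phi) = 0.
Proof.
have tE G : dual_total_diff G = G *m QY - gX *m (QX *m G *m gY).
  by rewrite /dual_total_diff !mulmxA.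
have h2 : phi *m QY *m QY = w *: phi by rewrite -mulmxA mf_sq mul_mx_scalar.
have h4 : gX *m (QX *m phi *m gY) *m QY = - (gX *m (QX *m (phi *m QY) *m gY)).
  by rewrite -!mulmxA gYQ !mulmxN.
have h5 : gX *m (QX *m (gX *m (QX *m phi *m gY)) *m gY) = - (w *: phi).
  rewrite !mulmxA gXQ !mulNmx -(mulmxA _ gX gX) sign_mxK mulmx1 mf_sq.
  by rewrite mul_scalar_mx -mulmxA sign_mxK mulmx1.
rewrite [dual_total_diff (dual_total_diff phi)]tE [dual_total_diff phi]tE mulmxBl h2 h4.
rewrite mulmxBr mulmxBl mulmxBr h5.
by rewrite !opprK [X in _ - X]addrC subrr.
Qed.

Lemma total_diff_adjoint phi F :
  \tr (phi *m total_diff F) = \tr (dual_total_diff phi *m F).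
Proof.
rewrite /total_diff /dual_total_diff mulmxBr mulmxBl !mxtraceB !mulmxA; congr (_ - _).
by rewrite -(mulmxA _ gX QX) mxtrace_mulC !mulmxA.
Qed.

Section OddMatrix.
Variable M : 'M[R]_p.
Hypothesis M_odd : homogeneous (@mf_par R w Y) (@mf_par R w Y) true M.

Let gM : gY *m M = - (M *m gY). Proof. exact: odd_sign_swap. Qed.

(** An odd M anticommutes with the grading operator, so the terms in [QX] cancel and M becomes a
    homotopy for its anticommutator with [QY]. *)
Lemma total_diff_mul F :
  total_diff (M *m F) + M *m total_diff F = (QY *m M + M *m QY) *m F.
Proof.
rewrite /total_diff !mulmxA gM !mulNmx mulmxBr !mulmxA opprK mulmxDl.
by rewrite addrACA subrr addr0.
Qed.

Lemma dual_total_diff_mul phi :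
  dual_total_diff (phi *m M) + dual_total_diff phi *m M = phi *m (QY *m M + M *m QY).
Proof.
rewrite /dual_total_diff !mulmxA mulmxBl -(mulmxA _ gY M) gM mulmxN opprK mulmxDr !mulmxA.
by rewrite addrC addrACA subrr addr0.
Qed.

End OddMatrix.

End Operators.

Section Derivation.
Variables (R : comNzRingType) (D : R -> R).
Hypotheses (DD : {morph D : a b / a + b}) (DM : forall a b, D (a * b) = a * D b + b * D a).

Lemma derivation0 : D 0 = 0.
Proof. by apply: (@addrI _ (D 0)); rewrite -DD !addr0. Qed.

Lemma derivation_sum (I : Type) (r : seq I) (P : pred I) (F : I -> R) :
  D (\sum_(i <- r | P i) F i) = \sum_(i <- r | P i) D (F i).
Proof. by elim/big_rec2: _ => [|i u v _ <-]; rewrite ?derivation0 ?DD. Qed.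

Lemma map_mx_derivation_mul p q r (A : 'M[R]_(p, q)) (B : 'M[R]_(q, r)) :
  map_mx D (A *m B) = map_mx D A *m B + A *m map_mx D B.
Proof.
apply/matrixP => i j; rewrite !mxE derivation_sum -big_split; apply: eq_bigr => l _ /=.
by rewrite !mxE DM addrC [B l j * _]mulrC.
Qed.

Lemma map_mx_derivation_add p q (A B : 'M[R]_(p, q)) :
  map_mx D (A + B) = map_mx D A + map_mx D B.
Proof. by apply/matrixP => i j; rewrite !mxE DD. Qed.

Lemma map_mx_derivation_scalar p a : map_mx D (a%:M : 'M[R]_p) = (D a)%:M.
Proof.
by apply/matrixP => i j; rewrite !mxE; case: eqP; rewrite ?mulr1n // mulr0n derivation0.
Qed.

Lemma map_mx_derivation_homogeneous p q (u : 'I_p -> bool) (v : 'I_q -> bool) c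
  (A : 'M[R]_(p, q)) : homogeneous u v c A -> homogeneous u v c (map_mx D A).
Proof. by move=> h i j hij; rewrite mxE h // derivation0. Qed.

End Derivation.

(** * The Kapustin-Li pairing and its non-degeneracy *)

Section Pairing.
Variables (k : fieldType) (R : comAlgType k) (m : set R) (n : nat).
Variable x : 'I_n -> R.
Hypotheses (noethR : noetherian R) (locR : local_ring m) (augR : augmented m).
Hypotheses (x_regular : regular_sequence x) (x_gen : m = gen_ideal (range x)).
Hypothesis char0 : [pchar k] =i pred0.
Variable del : 'I_n -> R -> R.
Hypotheses (del_linear : forall i (c : k) f g, del i (c *: f + g) = c *: del i f + del i g)
  (del_mul : forall i f g, del i (f * g) = f * del i g + g * del i f).
Variables (w : R) (X Y : matfact w).
Local Notation t := (fun l => del l w).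
Variables (i : nat) (C : 'M[R]_n).
Hypotheses (t_primary : ideal_pow m i.+1 `<=` gen_ideal (range t))
  (t_expresses : expresses x t i.+1 C).

Local Notation p := (mf_rank Y).
Local Notation q := (mf_rank X).
Local Notation QX := (mf_d X).
Local Notation QY := (mf_d Y).
Local Notation gX := (sign_mx R (@mf_par R w X)).
Local Notation gY := (sign_mx R (@mf_par R w Y)).
Local Notation th := (theta augR x_gen i).

Let y j := x j ^+ i.+1.
Local Notation full := (span [set: 'I_n] y).

Let delD l : {morph del l : a b / a + b}.
Proof. by move=> a b; have := del_linear l 1 a b; rewrite !scale1r. Qed.

Let y_regular (T : {set 'I_n}) j u : j \notin T -> span T y (y j * u) -> span T y u.
Proof.
move=> hj; apply: nonzerodivisorX.
exact: (@span_nonzerodivisor _ _ _ _ noethR locR x_regular x_gen T j (fun=> i.+1) hj).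
Qed.

Let th_full u : full u -> th u = 0.
Proof. exact: theta_span. Qed.

Let th_scalar : scalar th.
Proof. exact: coef_linear. Qed.

Let thD u v : th (u + v) = th u + th v.
Proof. by have := th_scalar 1 u v; rewrite scale1r mul1r. Qed.

Let th0 : th 0 = 0.
Proof. by apply: th_full; apply: ideal0; exact: span_is_ideal. Qed.

Let thZ (c : k) u : th (c%:A * u) = c * th u.
Proof. by rewrite mulr_algl; have := th_scalar c u 0; rewrite !addr0 th0 addr0. Qed.

Let th_sign b u : th ((-1) ^+ b * u) = (-1) ^+ b * th u.
Proof.
by rewrite -thZ; congr (theta _ _ _ (_ * _)); rewrite -[RHS]/(in_alg R _) rmorphXn rmorphN1.
Qed.

Let th_eq u v : full (u - v) -> th u = th v.
Proof. by move=> /th_full h; rewrite -[u](subrK v) thD h add0r. Qed.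

Let D l := map_mx (del l) QY.
Let Mu j := \sum_l C j l *: D l.

Let D_odd l : homogeneous (@mf_par R w Y) (@mf_par R w Y) true (D l).
Proof. exact/(map_mx_derivation_homogeneous (@delD l))/mf_d_homogeneous. Qed.

Let D_relation l : QY *m D l + D l *m QY = (t l)%:M.
Proof.
rewrite -(map_mx_derivation_scalar (@delD l)) -(mf_sq Y).
by rewrite (map_mx_derivation_mul (@delD l) (@del_mul l)) addrC.
Qed.

Let Mu_odd j : homogeneous (@mf_par R w Y) (@mf_par R w Y) true (Mu j).
Proof. by apply: homogeneous_sum => l _; apply: homogeneousZ. Qed.

Let Mu_relation j : QY *m Mu j + Mu j *m QY = (y j)%:M.
Proof.
rewrite /y t_expresses mulmx_sumr mulmx_suml -big_split /= raddf_sum /=.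
apply: eq_bigr => l _; rewrite -scalemxAr -scalemxAl -scalerDr D_relation.
by rewrite scale_scalar_mx.
Qed.

Let lam j : {linear 'M[R]_(p, q) -> 'M[R]_(p, q)} := mulmx (Mu j).
Let lam' j : {linear 'M[R]_(q, p) -> 'M[R]_(q, p)} := mulmxr (Mu j).
Let dE : {linear 'M[R]_(p, q) -> 'M[R]_(p, q)} := @total_diff R w X Y.
Let dE' : {linear 'M[R]_(q, p) -> 'M[R]_(q, p)} := @dual_total_diff R w X Y.

Let lam_homotopy j F : dE (lam j F) + lam j (dE F) = y j *: F.
Proof. by rewrite /dE /lam /= total_diff_mul // Mu_relation mul_scalar_mx. Qed.

Let lam'_homotopy j phi : dE' (lam' j phi) + lam' j (dE' phi) = y j *: phi.
Proof. by rewrite /dE' /lam' /= dual_total_diff_mul // Mu_relation mul_mx_scalar. Qed.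

(** Second derivatives of [QY] contracted with rows a and b of C, and likewise those of w in [cH]:
    differentiating [D_relation] expresses anticommutators of first derivatives through them. *)
Let H a b := \sum_l \sum_l' (C a l * C b l') *: map_mx (del l) (D l').
Let cH a b := \sum_l \sum_l' C a l * C b l' * del l (t l').

Let H_odd a b : homogeneous (@mf_par R w Y) (@mf_par R w Y) true (H a b).
Proof.
do 2 apply: homogeneous_sum => ? _; apply: homogeneousZ.
exact/(map_mx_derivation_homogeneous (@delD _))/D_odd.
Qed.

Let Mu_anticommute a b :
  Mu a *m Mu b + Mu b *m Mu a = (cH a b)%:M - (QY *m H a b + H a b *m QY).
Proof.
have e l l' : D l *m D l' + D l' *m D l = (del l (t l'))%:M
    - (QY *m map_mx (del l) (D l') + map_mx (del l) (D l') *m QY).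
  have := congr1 (map_mx (del l)) (D_relation l').
  rewrite map_mx_derivation_add // !(map_mx_derivation_mul (@delD l) (@del_mul l)).
  rewrite (map_mx_derivation_scalar (@delD l)) -/(D l) => <-.
  by rewrite [map_mx (del l) (D l') *m QY + _]addrC addrACA addrK.
have -> : Mu b *m Mu a = \sum_l \sum_l' (C a l * C b l') *: (D l' *m D l).
  rewrite /Mu mulmx_suml exchange_big /=; apply: eq_bigr => l' _.
  by rewrite mulmx_sumr; apply: eq_bigr => l _; rewrite -scalemxAr -scalemxAl scalerA.
have -> : Mu a *m Mu b = \sum_l \sum_l' (C a l * C b l') *: (D l *m D l').
  rewrite /Mu mulmx_suml; apply: eq_bigr => l' _.
  by rewrite mulmx_sumr; apply: eq_bigr => l _; rewrite -scalemxAr -scalemxAl scalerA mulrC.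
rewrite /H /cH mulmx_sumr mulmx_suml raddf_sum -!big_split -sumrB /=.
apply: eq_bigr => l _; rewrite mulmx_sumr mulmx_suml raddf_sum -!big_split -sumrB /=.
apply: eq_bigr => l' _; rewrite -scalerDr e -scalemxAr -scalemxAl -scalerDr.
by rewrite scalerBr scale_scalar_mx.
Qed.

Let hH a b : {linear 'M[R]_(p, q) -> 'M[R]_(p, q)} := mulmx (H a b).

Let lam_anticommute a b F : lam a (lam b F) + lam b (lam a F) =
  cH a b *: F - (dE (hH a b F) + hH a b (dE F)).
Proof.
rewrite /lam /hH /dE /= total_diff_mul // !mulmxA -mulmxDl Mu_anticommute mulmxBl.
by rewrite mul_scalar_mx.
Qed.

Let iteratedE s F : iterated lam s F = (\prod_(a <- s) Mu a) *m F.
Proof.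
elim: s => [|a s IH] /=; first by rewrite big_nil mul1mx.
by rewrite big_cons IH -mulmxE mulmxA.
Qed.

Let iteratedE' s phi : iterated lam' (rev s) phi = phi *m \prod_(a <- s) Mu a.
Proof.
elim: s phi => [|a s IH] phi /=; first by rewrite big_nil mulmx1.
by rewrite rev_cons -cats1 iterated_cat IH /= big_cons -mulmxE mulmxA.
Qed.

Let wedge : 'M[R]_p := alternating_prod Mu.

Let wedge_homogeneous : homogeneous (@mf_par R w Y) (@mf_par R w Y) (odd n) wedge.
Proof.
apply: homogeneous_sum => s _; apply: homogeneousZ.
by apply: homogeneous_prod => j; exact: Mu_odd.
Qed.

Let wedge_trace phi F : \tr (phi *m (wedge *m F)) =
  \sum_(s : 'S_n) (-1) ^+ s * \tr (phi *m iterated lam (map s (enum 'I_n)) F).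
Proof.
rewrite /wedge /alternating_prod mulmx_suml mulmx_sumr raddf_sum /=.
apply: eq_bigr => s _; rewrite -scalemxAl -scalemxAr mxtraceZ; congr (_ * _).
by rewrite iteratedE big_map enumT [index_enum _]unlock.
Qed.

(** Each product of n homotopies commutes with [dE] up to (-1)^n modulo the y, which [th] ignores.
    No cycle condition is involved, so the pairing is compatible with differentials exactly. *)
Let th_wedge_boundary phi F :
  th (\tr (phi *m (wedge *m dE F))) = (-1) ^+ n * th (\tr (dE' phi *m (wedge *m F))).
Proof.
rewrite -th_sign !wedge_trace mulr_sumr; apply: th_eq; rewrite -sumrB.
apply: ideal_sum => [|s _]; first exact: span_is_ideal.
rewrite mulrCA -mulrBr; apply: idealMl; first exact: span_is_ideal.
set r := map _ _.
have sz : size r = n by rewrite size_map size_enum_ord.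
have := d_iterated lam_homotopy r F; rewrite sz => /(mx_span_tr phi).
rewrite mulmxBr mxtraceB -scalemxAr mxtraceZ total_diff_adjoint => h.
apply: (full_sub (T := [set a in r])).
have -> : \tr (phi *m iterated lam r (dE F)) - (-1) ^+ n * \tr (dE' phi *m iterated lam r F)
  = - (-1) ^+ n * (\tr (dE' phi *m iterated lam r F) - (-1) ^+ n * \tr (phi *m iterated lam r (dE F))).
  have e : (-1) ^+ n * (-1) ^+ n = 1 :> R by rewrite -expr2 sqrr_sign.
  set a := \tr _; set b := \tr _; set sg := (-1) ^+ n in e *.
  rewrite mulNr mulrBr mulrA e mul1r opprB; ring.
by apply: idealMl; [exact: span_is_ideal | exact: h].
Qed.

Let th_wedge_cycles phi F : dE F = 0 -> dE' phi = 0 ->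
  th (\tr (phi *m (wedge *m F))) = n`!%:R * th (\tr (phi *m iterated lam (enum 'I_n) F)).
Proof.
move=> hF hphi.
have hc : cocycle dE phi by move=> e; rewrite /dE /= total_diff_adjoint -/(dE' phi) hphi mul0mx mxtrace0.
rewrite -thZ scaler_nat; apply: th_eq; rewrite wedge_trace.
exact: (iterated_alternating_sum y_regular lam_homotopy lam_anticommute hF hc).
Qed.

Local Notation KL F G := (@kapustin_li k R m n x del w X Y F G).

(** The last sign comes from moving [wedge] past the grading operator that turns the trace into the
    supertrace. *)
Let coefKL : k := (-1) ^+ 'C(n.+1, 2) * (n`!%:R)^-1 * (-1) ^+ n.

Lemma kapustin_liE (F : 'M[R]_(p, q)) (G : 'M[R]_(q, p)) :
  KL F G = coefKL * th (\tr (G *m gY *m (wedge *m F))).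
Proof.
rewrite /kapustin_li (residueE noethR locR augR x_regular x_gen _ t_primary t_expresses).
rewrite /coefKL -[RHS]mulrA -th_sign; congr (_ * theta _ _ _ _).
have -> : supertrace (F *m G *m dQ_wedge del Y) = \tr (gY *m (F *m G *m dQ_wedge del Y)).
  by apply: eq_bigr => a _; rewrite mul_diag_mx !mxE.
rewrite -mxtraceZ scalemxAr scalemxAr.
have -> : \det C *: dQ_wedge del Y = wedge by rewrite /wedge alternating_prod_linear.
have -> : gY *m (F *m G *m wedge) = (gY *m F) *m (G *m wedge) by rewrite !mulmxA.
rewrite mxtrace_mulC.
have -> : G *m wedge *m (gY *m F) = G *m (wedge *m gY) *m F by rewrite !mulmxA.
have := homogeneous_sign_swap wedge_homogeneous; rewrite signr_odd => e.
have -> : wedge *m gY = (-1) ^+ n *: (gY *m wedge).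
  by rewrite e scalerA -expr2 sqrr_sign scale1r.
by rewrite -scalemxAr -scalemxAl mxtraceZ !mulmxA.
Qed.

Lemma kapustin_li_linear_l (c : k) (F F' : mf_hom X Y) G :
  KL (c *: F + F') G = c * KL F G + KL F' G.
Proof.
rewrite !kapustin_liE.
have -> : wedge *m (c *: F + F' : 'M[R]_(p, q)) =
    c%:A *: (wedge *m (F : 'M[R]_(p, q))) + wedge *m (F' : 'M[R]_(p, q)).
  by rewrite mulmxDr kmatrix_scaleE -scalemxAr.
by rewrite mulmxDr -scalemxAr mxtraceD mxtraceZ thD thZ mulrDr mulrCA.
Qed.

Lemma kapustin_li_linear_r (c : k) F (G G' : mf_hom Y (mf_shift n X)) :
  KL F (c *: G + G') = c * KL F G + KL F G'.
Proof.
rewrite !kapustin_liE.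
have -> : (c *: G + G' : 'M[R]_(q, p)) *m gY =
    c%:A *: ((G : 'M[R]_(q, p)) *m gY) + (G' : 'M[R]_(q, p)) *m gY.
  by rewrite mulmxDl kmatrix_scaleE -scalemxAl.
by rewrite mulmxDl -scalemxAl mxtraceD mxtraceZ thD thZ mulrDr mulrCA.
Qed.

Local Notation pX := (@mf_par R w X).
Local Notation pY := (@mf_par R w Y).
Local Notation X' := (mf_shift n X).
Local Notation pX' := (@mf_par R w X').
Local Notation partE := (component pY pX).
Local Notation partG := (component pX' pY).

Lemma shift_homogeneous c (G : 'M[R]_(q, p)) :
  homogeneous pX' pY c G <-> homogeneous pX pY (c (+) odd n) G.
Proof.
have e a b : (pX' a (+) pY b == c) = (pX a (+) pY b == c (+) odd n).
  rewrite /= -[in RHS](addbK (odd n) (pX a (+) pY b)) (inj_eq (@addIb _)).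
  by rewrite addbAC.
by split=> h a b hab; apply: h; rewrite ?e // -e.
Qed.

Lemma hom_diff_total b (F : 'M[R]_(p, q)) : homogeneous pY pX b F ->
  hom_diff (X := X) (Y := Y) b F = dE F.
Proof.
by move=> hF; rewrite /hom_diff /dE /= /total_diff (homogeneous_sign hF) scalemxAl.
Qed.

(** The twist G to G gY turns the differential of Hom(Y, X[n]) into the trace adjoint [dE']; the
    sign of the shifted differential is matched by the parity shift. *)
Lemma hom_diff_dual c (G : 'M[R]_(q, p)) : homogeneous pX' pY c G ->
  hom_diff (X := Y) (Y := X') c G = (-1) ^+ c *: (dE' (G *m gY) *m gY).
Proof.
move=> hG; have /shift_homogeneous/homogeneous_sign hG' := hG.
have e1 : G *m gY *m QY *m gY = - (G *m QY).
  have -> : G *m gY *m QY *m gY = G *m (gY *m QY *m gY) by rewrite !mulmxA.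
  by rewrite gYQ mulNmx -mulmxA sign_mxK mulmx1 mulmxN.
have e2 : gX *m QX *m (G *m gY) *m gY *m gY = - ((-1) ^+ (c (+) odd n) *: (QX *m G)).
  rewrite -(mulmxA _ gY gY) sign_mxK mulmx1 gXQ mulNmx -mulmxA (mulmxA gX) hG'.
  by rewrite -scalemxAr.
rewrite /dE' /= /dual_total_diff mulmxBl e1 e2 scalerBr !scalerN opprK.
rewrite signr_addb scalerA mulrA -expr2 sqrr_sign mul1r signr_odd addrC.
by rewrite /hom_diff /= -scalemxAl.
Qed.

Lemma dual_hom_diff c (G : 'M[R]_(q, p)) : homogeneous pX' pY c G ->
  dE' (G *m gY) = (-1) ^+ c *: ((hom_diff (X := Y) (Y := X') c G : 'M[R]_(q, p)) *m gY).
Proof.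
move=> hG; rewrite (hom_diff_dual hG) -scalemxAl -mulmxA sign_mxK mulmx1.
by rewrite scalerA -expr2 sqrr_sign scale1r.
Qed.

(** [wedge] times F G is odd in this case, and an odd matrix has zero diagonal. *)
Lemma kapustin_li_parity b (F : 'M[R]_(p, q)) (G : 'M[R]_(q, p)) :
  homogeneous pY pX b F -> homogeneous pX' pY (~~ b) G -> KL F G = 0.
Proof.
move=> hF /shift_homogeneous hG; rewrite kapustin_liE.
have -> : G *m gY *m (wedge *m F) = G *m (gY *m wedge *m F) by rewrite !mulmxA.
rewrite mxtrace_mulC.
have -> : gY *m wedge *m F *m G = gY *m (wedge *m (F *m G)) by rewrite !mulmxA.
have h := homogeneous_mul wedge_homogeneous (homogeneous_mul hF hG).
rewrite /mxtrace big1 ?th0 ?mulr0 // => a _; rewrite mul_diag_mx mxE h ?mulr0 //.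
by rewrite addbb addbCA; case: (b) (odd n) => [] [].
Qed.

Lemma kapustin_li_cycles (F : 'M[R]_(p, q)) (G : 'M[R]_(q, p)) :
  dE F = 0 -> dE' (G *m gY) = 0 ->
  KL F G = coefKL * n`!%:R * th (\tr (G *m gY *m iterated lam (enum 'I_n) F)).
Proof. by move=> hF hG; rewrite kapustin_liE th_wedge_cycles // mulrA. Qed.

Lemma kapustin_li_boundary b (F : 'M[R]_(p, q)) (G : 'M[R]_(q, p)) :
  homogeneous pY pX b F -> homogeneous pX' pY (~~ b) G ->
  KL (hom_diff (X := X) (Y := Y) b F) G =
  (-1) ^+ odd n * - ((-1) ^+ b * KL F (hom_diff (X := Y) (Y := X') (~~ b) G)).
Proof.
move=> hF hG; rewrite hom_diff_total // !kapustin_liE th_wedge_boundary.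
rewrite (dual_hom_diff hG) -scalemxAl mxtraceZ th_sign signr_odd.
have -> : (-1) ^+ (~~ b) = - (-1) ^+ b :> k by case: (b); rewrite ?expr1 ?expr0 ?opprK.
by rewrite mulNr !mulrN; congr (- _); rewrite [in RHS](mulrCA _ coefKL) [in RHS](mulrCA _ coefKL).
Qed.

Let hom_dec b (F : 'M[R]_(p, q)) : F = partE b F + partE (~~ b) F.
Proof. exact: component_sum. Qed.

Let hom_decG b (G : 'M[R]_(q, p)) : G = partG b G + partG (~~ b) G.
Proof. exact: component_sum. Qed.

Lemma component_cycle b (F : 'M[R]_(p, q)) : dE F = 0 -> dE (partE b F) = 0.
Proof.
rewrite {1}(hom_dec b F) (linearD dE).
have h1 : homogeneous pY pX (~~ b) (dE (partE b F)).
  rewrite -(hom_diff_total (@component_homogeneous R p q pY pX b F)).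
  by apply: hom_diff_odd; exact: component_homogeneous.
have h2 : homogeneous pY pX b (dE (partE (~~ b) F)).
  rewrite -(hom_diff_total (@component_homogeneous R p q pY pX (~~ b) F)).
  rewrite -[X in homogeneous _ _ X]negbK.
  by apply: hom_diff_odd; exact: component_homogeneous.
rewrite addrC => /(homogeneous_disjoint h2 h1) [] //.
Qed.

Lemma component_dual_cycle b (G : 'M[R]_(q, p)) :
  dE' (G *m gY) = 0 -> hom_diff (X := Y) (Y := X') b (partG b G) = 0.
Proof.
have hc c : homogeneous pX' pY c (partG c G) by exact: component_homogeneous.
rewrite {1}(hom_decG b G) mulmxDl (linearD dE') (dual_hom_diff (hc b)) (dual_hom_diff (hc (~~ b))) !scalemxAl -mulmxDl.
move/(congr1 (mulmxr gY)); rewrite /= -mulmxA sign_mxK mulmx1 mul0mx addrC.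
move/homogeneous_disjoint => /(_ pX' pY b) [].
- apply: homogeneousZ; rewrite -[X in homogeneous _ _ X]negbK.
  exact: (hom_diff_odd (~~ b) (hc (~~ b))).
- by apply: homogeneousZ; exact: (hom_diff_odd b (hc b)).
move=> _ /(congr1 (fun M => (-1) ^+ b *: M)); rewrite scaler0 scalerA -expr2 sqrr_sign.
by rewrite scale1r.
Qed.

Let coef_unit : coefKL * n`!%:R != 0.
Proof.
have hn : (n`!%:R : k) != 0 by rewrite ((pcharf0P k).1 char0) -lt0n fact_gt0.
by rewrite /coefKL !mulf_neq0 ?signr_eq0 ?invr_neq0.
Qed.

Let enum_all (a : 'I_n) : a \in enum 'I_n. Proof. by rewrite fintype.mem_enum. Qed.

Let adjoint phi F : \tr (phi *m dE F) = \tr (dE' phi *m F).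
Proof. exact: total_diff_adjoint. Qed.

Let adjoint' F phi : \tr (F *m dE' phi) = \tr (dE F *m phi).
Proof. by rewrite mxtrace_mulC -adjoint mxtrace_mulC. Qed.

Let th_nondeg u : (forall r, th (r * u) = 0) -> full u.
Proof. exact: theta_nondegenerate. Qed.

Let th_rep (g : R -> k) : scalar g -> (forall u, full u -> g u = 0) ->
  exists c, forall r, g r = th (r * c).
Proof. exact: theta_represents. Qed.

(** Read through the twist by gY, v' is represented by a cycle e. Its component of degree b
    suffices, as the other pairs to zero with G by parity; it is divided by the constant relating
    the pairing to the product of homotopies. *)
Lemma kapustin_li_surjective b (v' : dual_space Y X') : dual_piece b v' ->
  (forall G, v' (hom_diff (X := Y) (Y := X') (~~ b) G) = 0) ->
  exists v : 'M[R]_(p, q), [/\ homogeneous pY pX b v, dE v = 0 &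
    forall G, homogeneous pX' pY b G -> dE' (G *m gY) = 0 -> v' G = KL v G].
Proof.
move=> [lv hv] hd.
have v'D G G' : v' (G + G') = v' G + v' G'.
  by have := lv 1 G G'; rewrite scale1r mul1r.
have v'0 : v' 0 = 0 by apply: (@addrI _ (v' 0)); rewrite -v'D !addr0.
have v'Z (c : k) G : v' (c *: G) = c * v' G.
  by have := lv c G 0; rewrite !addr0 v'0 addr0.
pose g (phi : kmatrix R q p) : k := v' ((phi : 'M[R]_(q, p)) *m gY : mf_hom Y X').
have lg : scalar g.
  move=> c u u'; rewrite /g.
  have -> : (c *: u + u' : 'M[R]_(q, p)) *m gY =
     (c *: ((u : 'M[R]_(q, p)) *m gY : mf_hom Y X') + ((u' : 'M[R]_(q, p)) *m gY : mf_hom Y X')).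
    by rewrite mulmxDl !kmatrix_scaleE -scalemxAl.
  by rewrite v'D v'Z.
have hg phi : g (dE' phi) = 0.
  have hc c : homogeneous pX' pY c (partG c (phi *m gY)) by exact: component_homogeneous.
  have ephi : phi = partG b (phi *m gY) *m gY + partG (~~ b) (phi *m gY) *m gY.
    by rewrite -mulmxDl -hom_decG -mulmxA sign_mxK mulmx1.
  rewrite /g {1}ephi (linearD dE') (dual_hom_diff (hc b)) (dual_hom_diff (hc (~~ b))) mulmxDl -!scalemxAl -!mulmxA sign_mxK !mulmx1.
  have sgE c (G : mf_hom Y X') : ((-1) ^+ c *: (G : 'M[R]_(q, p))) = ((-1) ^+ c : k) *: G.
    rewrite kmatrix_scaleE; congr (_ *: _).
    by rewrite -[RHS]/(in_alg R _) rmorphXn rmorphN1.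
  rewrite !sgE v'D !v'Z hd mulr0 addr0 hv ?mulr0 //.
  exact: (hom_diff_odd b (hc b)).
have [e [he hrep]] := cycle_represents y_regular th_scalar th_full th_nondeg th_rep
  (@total_diff_sq R w X Y) (@dual_total_diff_sq R w X Y) lam_homotopy lam'_homotopy adjoint
  lg hg (enum_uniq 'I_n) enum_all.
pose c := (coefKL * n`!%:R)^-1.
exists (c%:A *: partE b e); split.
- by apply: homogeneousZ; exact: component_homogeneous.
- by rewrite linearZ /= component_cycle // scaler0.
move=> G hG hdG; rewrite kapustin_li_cycles //; last first.
  by rewrite linearZ /= component_cycle // scaler0.
have -> : v' G = g (G *m gY) by rewrite /g -mulmxA sign_mxK mulmx1.
rewrite hrep // iteratedZ -scalemxAr mxtraceZ thZ mulrA /c divff // mul1r.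
rewrite {1}(hom_dec b e) iteratedD mulmxDr mxtraceD thD.
suff -> : th (\tr (G *m gY *m iterated lam (enum 'I_n) (partE (~~ b) e))) = 0 by rewrite addr0.
have := @kapustin_li_parity (~~ b) (partE (~~ b) e) G.
rewrite negbK => /(_ (@component_homogeneous _ _ _ _ _ _ _) hG).
rewrite kapustin_li_cycles //; last exact: component_cycle.
by move/eqP; rewrite mulf_eq0 (negbTE coef_unit) => /eqP.
Qed.

(** If v is no boundary, some functional separates it from the boundaries. Represented by a cycle of
    the other complex, that functional takes at v a value built from pairings that vanish by
    hypothesis. *)
Lemma kapustin_li_injective b (v : 'M[R]_(p, q)) : homogeneous pY pX b v -> dE v = 0 ->
  (forall G, homogeneous pX' pY b G -> dE' (G *m gY) = 0 -> KL v G = 0) ->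
  exists u, homogeneous pY pX (~~ b) u /\ v = dE u.
Proof.
move=> hv hdv hKL.
case: (pselect (exists h, v = dE h)) => [[h e]|hno].
  exists (partE (~~ b) h); split; first exact: component_homogeneous.
  have h1 : homogeneous pY pX (~~ b) (dE (partE b h)).
    rewrite -(hom_diff_total (@component_homogeneous R p q pY pX b h)).
    by apply: hom_diff_odd; exact: component_homogeneous.
  have h2 : homogeneous pY pX b (dE (partE (~~ b) h)).
    rewrite -(hom_diff_total (@component_homogeneous R p q pY pX (~~ b) h)).
    rewrite -[X in homogeneous _ _ X]negbK.
    by apply: hom_diff_odd; exact: component_homogeneous.
  rewrite -(component_id hv) e {1}(hom_dec b h) (linearD dE).
  have := component_linear pY pX b 1 (dE (partE b h)) (dE (partE (~~ b) h)).
  by rewrite !scale1r => ->; rewrite component_other // component_id // add0r.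
pose S : set (kmatrix R p q) := [set F | exists h : 'M[R]_(p, q), F = dE h].
have hS : subspace S.
  split; first by exists 0; rewrite linear0.
  move=> c _ _ [h ->] [h' ->]; exists (c%:A *: h + h').
  by rewrite linearP kmatrix_scaleE.
have [|g [lg gS gv]] := @functional_separates k (kmatrix R p q) S v hS.
  by move=> [h e]; apply: hno; exists h.
have hg F : g (dE F) = 0 by apply: gS; exists F.
(* Right multiplications compose in the opposite order, so the reversed word yields the same product
   of the [Mu]. *)
have urev : uniq (rev (enum 'I_n)) by rewrite rev_uniq enum_uniq.
have arev a : a \in rev (enum 'I_n) by rewrite mem_rev.
have [phi [hphi hrep]] := cycle_represents y_regular th_scalar th_full th_nondeg th_rep
  (@dual_total_diff_sq R w X Y) (@total_diff_sq R w X Y) lam'_homotopy lam_homotopy adjoint'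
  lg hg urev arev.
have : g v = 0; last by move=> e; move: gv; rewrite e => /esym/eqP; rewrite oner_eq0.
rewrite hrep //.
rewrite iteratedE' mxtrace_mulC -mulmxA -iteratedE.
pose G := phi *m gY.
have eG : phi = G *m gY by rewrite /G -mulmxA sign_mxK mulmx1.
have hdG : dE' (G *m gY) = 0 by rewrite -eG.
have K0 c : homogeneous pX' pY c (partG c G) by exact: component_homogeneous.
have hdc c : dE' (partG c G *m gY) = 0.
  by rewrite (dual_hom_diff (K0 c)) component_dual_cycle // mul0mx scaler0.
have K1 : KL v (partG b G) = 0 by apply: hKL.
have K2 : KL v (partG (~~ b) G) = 0 by apply: (kapustin_li_parity hv).
have e c : KL v (partG c G) = 0 ->
    th (\tr (partG c G *m gY *m iterated lam (enum 'I_n) v)) = 0.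
  rewrite kapustin_li_cycles // => /eqP; rewrite mulf_eq0 (negbTE coef_unit).
  by move/eqP.
by rewrite eG {1}(hom_decG b G) !mulmxDl mxtraceD thD (e _ K1) (e _ K2) addr0.
Qed.

Theorem kapustin_li_quasi_isomorphism :
  quasi_isomorphism (C := hom_complex X Y) (D := dual_hom_complex Y X')
    (fun (F : mf_hom X Y) (G : mf_hom Y X') => KL F G).
Proof.
have KL_piece b (F : 'M[R]_(p, q)) : homogeneous pY pX b F ->
    dual_piece b (fun G : mf_hom Y X' => KL F G).
  move=> hF; split=> [c G G'|G hG]; first exact: kapustin_li_linear_r.
  exact: (kapustin_li_parity hF).
have dualK b (G : 'M[R]_(q, p)) : homogeneous pX' pY b G ->
    hom_diff (X := Y) (Y := X') b G = 0 -> dE' (G *m gY) = 0.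
  by move=> hG e; rewrite (dual_hom_diff hG) e mul0mx scaler0.
have hcG c (G : 'M[R]_(q, p)) : homogeneous pX' pY c (partG c G).
  exact: component_homogeneous.
split=> /=.
- by move=> c F F'; apply/funext => G; rewrite kapustin_li_linear_l.
- exact: KL_piece.
(* The global sign (-1)^n is that of moving the differential past n odd homotopies. *)
- exists (odd n) => b F hF; apply/funext => G.
  rewrite !fctE /dual_diff /=.
  have [lF hF0] := KL_piece _ _ hF.
  have hdF : homogeneous pY pX (~~ b) (hom_diff (X := X) (Y := Y) b F) by exact: hom_diff_odd.
  have [ldF hdF0] := KL_piece _ _ hdF.
  have KD (F0 : mf_hom X Y) (G0 G1 : mf_hom Y X') : KL F0 (G0 + G1) = KL F0 G0 + KL F0 G1.
    by have := kapustin_li_linear_r 1 F0 G0 G1; rewrite scale1r mul1r.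
  rewrite {1 2}(hom_decG b G) KD hdF0 ?negbK //; last exact: hcG.
  have -> : hom_diff (X := Y) (Y := X') (~~ b) (partG b G + partG (~~ b) G) =
     hom_diff (X := Y) (Y := X') (~~ b) (partG b G) + hom_diff (X := Y) (Y := X') (~~ b) (partG (~~ b) G).
    have := @hom_diff_linear k R w Y X' (~~ b) 1 (partG b G) (partG (~~ b) G).
    by rewrite !scale1r.
  rewrite KD hF0; last exact: (hom_diff_odd (~~ b) (hcG b G)).
  by rewrite !add0r kapustin_li_boundary.
- move=> b v hv hdv [u [hu eu]].
  have hdv' : dE v = 0 by rewrite -(hom_diff_total hv).
  have [|u' [hu' eu']] := kapustin_li_injective hv hdv'.
    move=> G hG hdG; have := congr1 (fun f => f G) eu; rewrite /dual_diff /= negbK => ->.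
    have -> : hom_diff (X := Y) (Y := X') b G = 0.
      by rewrite (hom_diff_dual hG) hdG mul0mx scaler0.
    have [lu _] := hu; have := lu 1 0 0; rewrite scale1r mul1r addr0 => /eqP.
    by rewrite -subr_eq0 opprD addNKr oppr_eq0 => /eqP ->; rewrite mulr0 oppr0.
  by exists u'; split=> //; rewrite hom_diff_total.
- move=> b v' hv' hdv'.
  have hd G : v' (hom_diff (X := Y) (Y := X') (~~ b) G) = 0.
    have := congr1 (fun f => f G) hdv'; rewrite /dual_diff /= => /eqP.
    by rewrite oppr_eq0 mulf_eq0 signr_eq0 => /eqP.
  have [v [hv hdv hvG]] := kapustin_li_surjective hv' hd.
  have [lv' hv'0] := hv'; have [lK hK0] := KL_piece _ _ hv.
  (* It vanishes on cycles of degree b, hence factors through the differential [TT]; the factor,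
     extended to the whole space, supplies the primitive. *)
  pose psi (G : mf_hom Y X') : k := v' G - KL v G.
  have lpsi : scalar psi.
    move=> c G G'; rewrite /psi lv' kapustin_li_linear_r /GRing.scale /=; ring.
  have psi_other G : homogeneous pX' pY (~~ b) G -> psi G = 0.
    by move=> hG; rewrite /psi hv'0 // hK0 // subrr.
  have psiD (G0 G1 : mf_hom Y X') : psi (G0 + G1) = psi G0 + psi G1.
    by have := lpsi 1 G0 G1; rewrite !scale1r mul1r.
  pose TT (G : mf_hom Y X') : mf_hom Y X' := hom_diff (X := Y) (Y := X') b (partG b G).
  have lpart c : linear (fun G : mf_hom Y X' => partG c G : mf_hom Y X').
    move=> a G G'; rewrite kmatrix_scaleE.
    by have := component_linear pX' pY c a%:A G G'.
  have lTT : linear TT by move=> a G G'; rewrite /TT lpart hom_diff_linear.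
  have hker G : TT G = 0 -> psi G = 0.
    move=> hG; rewrite (hom_decG b G) psiD [X in _ + X]psi_other; last exact: hcG.
    by rewrite addr0 /psi (hvG _ (hcG b G) (dualK b _ (hcG b G) hG)) subrr.
  have [f [lf hf]] := functional_factor lTT lpsi hker.
  (* Restricted to the component of degree [~~ b] to be homogeneous; the sign cancels the one in
     [dual_diff]. *)
  pose u' (G : mf_hom Y X') : k^o := (-1) ^+ b * f (partG (~~ b) G : mf_hom Y X').
  exists v, u'; split=> //.
  - by rewrite hom_diff_total.
  - split=> [c G G'|G]; first by rewrite /u' lpart lf /GRing.scale /=; ring.
    rewrite negbK => hG; rewrite /u' component_other ?negbK //.
    have f0 : f 0 = 0.
      have := lf 1 0 0; rewrite !scale1r addr0 mul1r => /eqP.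
      by rewrite -subr_eq0 opprD addNKr oppr_eq0 => /eqP.
    by rewrite f0 mulr0.
  apply/funext => G; rewrite !fctE /dual_diff /u' negbK.
  have -> : (-1) ^+ (~~ b) = - (-1) ^+ b :> k by case: (b); rewrite ?expr1 ?expr0 ?opprK.
  rewrite mulNr opprK mulrA -expr2 sqrr_sign mul1r.
  have -> : partG (~~ b) (hom_diff (X := Y) (Y := X') b G) = TT G.
    rewrite /TT {1}(hom_decG b G).
    have -> : hom_diff (X := Y) (Y := X') b (partG b G + partG (~~ b) G) =
       hom_diff (X := Y) (Y := X') b (partG b G) + hom_diff (X := Y) (Y := X') b (partG (~~ b) G).
      have := @hom_diff_linear k R w Y X' b 1 (partG b G) (partG (~~ b) G).
      by rewrite !scale1r.
    have := component_linear pX' pY (~~ b) 1 (hom_diff (X := Y) (Y := X') b (partG b G))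
      (hom_diff (X := Y) (Y := X') b (partG (~~ b) G)).
    rewrite !scale1r => ->; rewrite component_id; last exact: (hom_diff_odd b (hcG b G)).
    by rewrite (component_other (hom_diff_odd b (hcG (~~ b) G))) addr0.
  by rewrite -hf /psi addrC subrK.
Qed.

End Pairing.

Theorem theorem3p4 (k : fieldType) (char0 : [pchar k] =i pred0)
  (R : comAlgType k) (m : set R) (n : nat)
  (R_regular : regular_local_ring m n) (R_augmented : augmented m)
  (x : 'I_n -> R) (x_regular : regular_sequence x)
  (x_gen : m = gen_ideal (range x))
  (Omega : lmodType R) (d : R -> Omega) (d_univ : universally_finite d)
  (del : 'I_n -> R -> R) (del_partial : partial_derivatives d x del)
  (w : R) (w_in_m : m w) (w_isolated : isolated_singularity m w)
  (X Y : matfact w) :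
  (* the pairing is R-balanced, i.e. defined on the tensor product over R *)
  (forall (a : R) (F : 'M[R]_(mf_rank Y, mf_rank X))
          (G : 'M[R]_(mf_rank X, mf_rank Y)),
     @kapustin_li k R m n x del w X Y (a *: F) G
     = @kapustin_li k R m n x del w X Y F (a *: G)) /\
  quasi_isomorphism (C := hom_complex X Y)
    (D := dual_hom_complex Y (mf_shift n X))
    (fun (F : mf_hom X Y) (G : mf_hom Y (mf_shift n X)) =>
       kapustin_li m x del F G).
Proof.
have [noethR locR _ _] := R_regular.
have [N hN] := jacobian_primary R_regular R_augmented x_regular x_gen char0
  d_univ del_partial w_in_m w_isolated.
(* Raised from N to fit the shifted index of [theta]. *)
have t_primary : ideal_pow m N.+1 `<=` gen_ideal (range (fun l => del l w)).
  by move=> u /ideal_powS; exact: hN.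
have /choice [c hc] : forall j, exists c : 'I_n -> R,
    x j ^+ N.+1 = \sum_l c l * del l w.
  move=> j; apply/gen_range_is_sum/t_primary/ideal_pow_exp.
  by rewrite x_gen; apply: gen_ideal_sub; exists j.
have t_expresses : expresses x (fun l => del l w) N.+1 (\matrix_(j, l) c j l).
  by move=> j; rewrite hc; apply: eq_bigr => l _; rewrite mxE.
split; last first.
  exact: (kapustin_li_quasi_isomorphism noethR locR R_augmented x_regular x_gen char0
    (del_linear noethR locR R_augmented x_regular x_gen d_univ del_partial)
    (del_mul noethR locR R_augmented x_regular x_gen d_univ del_partial)
    X Y t_primary t_expresses).
by move=> a F G; rewrite /kapustin_li -scalemxAl -scalemxAr.
Qed.
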